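(* There exists a map $(t,v,w)\mapsto \Gamma(t,v,w)=(x,v_1,w_1)$, in the extended phase space, of the form $$x=\gamma(t,v,w),\qquad v_1=\eta(t,v,w),\qquad w_1=\theta(t,v,w)=v^2\,w\,\eta(t,v,w)^{-2},$$ which transforms the system $$(\mathrm{A})\qquad \frac{dv_1}{dx}=\frac{2}{w_1}-6-x\,w_1^2v_1^4,\qquad \frac{dw_1}{dx}=\frac{12}{v_1}\Big(w_1-\frac14\Big)+2x\,w_1^3v_1^3$$ into the system $$(\mathrm{B})\qquad \frac{dv}{dt}=\frac{2}{w}-6,\qquad \frac{dw}{dt}=\frac{12}{v}\Big(w-\frac14\Big)$$ and has the following properties. (i) $\Gamma$ is holomorphic in a neighborhood of each point $(x_0,0,1/4)$, $x_0\in\mathbb{C}$. Namely, for every $x_0\in\mathbb{C}$ there exist $R\ge 1$ and $0<\epsilon<1/4$ such that $\Gamma$ is holomorphic in the polydisk $$\Delta(x_0)=\Big\{(t,v,w)\in\mathbb{C}^3:\ |t-x_0|<1,\ |v|<R^{-1},\ \big|w-\tfrac14\big|<\epsilon\Big\},$$ and there its power series in $v$ has the form $$\gamma(t,v,w)=t+\sum_{k\ge5}\gamma_k(t,w)v^k,\qquad \eta(t,v,w)=v+\sum_{k\ge4}\eta_k(t,w)v^k,\qquad \theta(t,v,w)=w+\sum_{k\ge4}\theta_k(t,w)v^k .$$ (ii) $\Gamma$ is a biholomorphism of $\Delta(x_0)$ onto its image. Its inverse is holomorphic near $(x_0,0,1/4)$ and $\Gamma^{-1}=\mathrm{Id}+O(v_1^4)$.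 (iii) Let $t\mapsto (v(t),w(t))$ be a solution of (B) such that $(t,v(t),w(t))\in\Delta(x_0)$ for $t$ in some disk $|t-t_1|<\epsilon'$. Then the function $t\mapsto\gamma(t,v(t),w(t))$ is a biholomorphism of the disk $|t-t_1|<\epsilon'$ onto its image.
   Context: All variables are complex. ''Extended phase space'' means the space of the independent variable together with the dependent variables, i.e. $(t,v,w)\in\mathbb{C}^3$ for (B) and $(x,v_1,w_1)\in\mathbb{C}^3$ for (A). That $\Gamma$ transforms (A) into (B) means that substituting $(x,v_1,w_1)=\Gamma(t,v,w)$ in (A) yields (B): along a solution $t\mapsto(v(t),w(t))$ of (B) lying in the domain of $\Gamma$, the curve $t\mapsto (x,v_1,w_1)=\Gamma(t,v(t),w(t))$ is (the parametrized graph of) a solution of (A). Background: (A) is the Painlevé P1 equation $y''=6y^2+x$ (with $'=d/dx$) written in the variables $v_1=-y^{-2}\,y'$, $w_1=y^3(y')^{-2}$, and (B) is the elliptic equation $u''=6u^2$ (with $'=d/dt$) written in the variables $v=-u^{-2}u'$, $w=u^3(u')^{-2}$. If $p$ is a pole of $u(t)$, then $v(t)$ and $w(t)$ have removable singularities at $p$, with $v(p)=0$ and $w(p)=1/4$; solutions of (B) are understood to be extended holomorphically to such points. The numbers $R$ and $\epsilon$ may depend on $x_0$. In (ii) and (iii), $\Delta(x_0)$ is the polydisk of (i). *)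

(* Defs.v *)
From Stdlib Require Export Reals.
From Coquelicot Require Export Coquelicot.

Open Scope C_scope.

(* Extended phase space; a point is [(t, v, w)], that is [((t, v), w)]. *)
Definition C3 : NormedModule C_AbsRing :=
  prod_NormedModule C_AbsRing
    (prod_NormedModule C_AbsRing C_NormedModule C_NormedModule) C_NormedModule.

(* [filterdiff] over [C_AbsRing] asks for a complex-linear differential, so on
   an open set this is holomorphy, in one or several variables. *)
Definition holomorphic_on {U V : NormedModule C_AbsRing}
    (D : U -> Prop) (f : U -> V) : Prop :=
  forall p : U, D p -> ex_filterdiff f (locally p).

Definition image {U V : Type} (D : U -> Prop) (f : U -> V) : V -> Prop :=
  fun q => exists p, D p /\ f p = q.

(* [g] is the inverse of [f : D -> f(D)]; its values outside [f(D)] are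
   irrelevant. *)
Definition biholomorphic_onto_image {U V : NormedModule C_AbsRing}
    (D : U -> Prop) (f : U -> V) (g : V -> U) : Prop :=
  holomorphic_on D f /\
  open (image D f) /\
  holomorphic_on (image D f) g /\
  (forall p : U, D p -> g (f p) = p).

Definition regular_at (F G : C -> C -> C -> C) (v w : C -> C) (t : C) : Prop :=
  v t <> 0 /\ w t <> 0 /\
  is_derive v t (F t (v t) (w t)) /\
  is_derive w t (G t (v t) (w t)).

(* Solution on the open set [D] of  dv/dt = F(t,v,w), dw/dt = G(t,v,w),  where
   [F] and [G] have poles at [v = 0] or [w = 0].  The second alternative is a
   removable singularity (a pole of the underlying function [u] or [y]) across
   which the solution has been extended holomorphically: the equations hold at
   all nearby points, and the value there is [(0, 1/4)]. *)
Definition solution (F G : C -> C -> C -> C) (D : C -> Prop) (v w : C -> C)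
    : Prop :=
  open D /\
  forall t : C, D t ->
    regular_at F G v w t \/
    (v t = 0 /\ w t = 1 / 4 /\
     ex_derive (K := C_AbsRing) v t /\ ex_derive (K := C_AbsRing) w t /\
     locally' t (regular_at F G v w)).

Definition solution_A : (C -> Prop) -> (C -> C) -> (C -> C) -> Prop :=
  solution
    (fun x v1 w1 => 2 / w1 - 6 - x * w1 ^ 2 * v1 ^ 4)
    (fun x v1 w1 => 12 / v1 * (w1 - 1 / 4) + 2 * x * w1 ^ 3 * v1 ^ 3).

Definition solution_B : (C -> Prop) -> (C -> C) -> (C -> C) -> Prop :=
  solution
    (fun _ v w => 2 / w - 6)
    (fun _ v w => 12 / v * (w - 1 / 4)).

(* The curve [c = (x, v1, w1)] on [D] is the parametrized graph of a solution
   of (A): near each parameter value [x] is a local coordinate, with inverse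
   [g], and [v1], [w1] expressed as functions of [x] solve (A).  Being
   local, this allows [x] to take the same value at distinct parameters. *)
Definition graph_of_solution_A (D : C -> Prop) (c : C -> C3) : Prop :=
  forall t0 : C, D t0 ->
    exists (B : C -> Prop) (g : C -> C),
      open B /\ B t0 /\ (forall t, B t -> D t) /\
      let x := fun t => fst (fst (c t)) in
      let v1 := fun t => snd (fst (c t)) in
      let w1 := fun t => snd (c t) in
      biholomorphic_onto_image (U := C_NormedModule) (V := C_NormedModule)
        B x g /\
      solution_A (image B x) (fun z => v1 (g z)) (fun z => w1 (g z)).

Definition transforms_A_into_B (Om : C3 -> Prop) (Gam : C3 -> C3) : Prop :=
  forall (D : C -> Prop) (v w : C -> C),
    solution_B D v w ->
    (forall t, D t -> Om (t, v t, w t)) ->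
    graph_of_solution_A D (fun t => Gam (t, v t, w t)).

Definition disk (c : C) (r : R) : C -> Prop := fun t => (Cmod (t - c) < r)%R.

Definition polydisk (x0 : C) (rho eps : R) : C3 -> Prop :=
  fun p => let '(t, v, w) := p in
    (Cmod (t - x0) < 1)%R /\ (Cmod v < / rho)%R /\ (Cmod (w - 1 / 4) < eps)%R.

(* [f(t,v,w) = f0(t,v,w) + sum_(k >= m) a_k(t,w) v^k] on [D]. *)
Definition expansion_in_v (D : C3 -> Prop) (f f0 : C3 -> C) (m : nat) : Prop :=
  exists a : nat -> C -> C -> C,
    forall t v w : C, D (t, v, w) ->
      is_series (K := C_AbsRing) (V := C_NormedModule)
        (fun n => a (m + n)%nat t w * v ^ (m + n))
        (f (t, v, w) - f0 (t, v, w)).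

(* Main.v *)
Require Import Defs.
From Stdlib Require Import Lra Lia ClassicalEpsilon.

(* With [v = - u'/u^2] and [w = u^3/u'^2] one has [v^2 w = 1/u], so the relation
   [theta eta^2 = v^2 w] says that the map sends a solution [u(t)] of
   [u'' = 6 u^2] to a solution [y(x)] of P1 with [y(x(t)) = u(t)].  Take
   [rho = u^(-1/2) = y^(-1/2)] as the independent variable (hodograph).  With
   [e = y'^2/(4 y^3) - 1], P1 becomes

     [dx/drho = m],  [m^2 (1 + e) = 1],  [rho de/drho = 6 e - rho^4 x],

   and the elliptic equation is the same system without the term [rho^4 x].
   The solution with [x = p] at [rho = 0] is [x = p + rho (1 + psi(a, b, k))],
   where [a = p rho^4], [b = rho^5], [k = h rho^6] and [h] is the free constant
   at the resonance; there is no logarithm because [x] has no [rho^2] term.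
   The series [e], [m], [psi] are homogeneous for the weights 4, 5, 6 of [a],
   [b], [k] and solve a triangular recursion.  For the elliptic equation
   [a = b = 0], [k = 4 - 1/w], [rho = v mu/2], [mu = m(0, 0, k) = 2 sqrt w], and
   [p = t - rho (1 + psi(0, 0, k))].  This gives
   [gamma = p + rho (1 + psi(a, b, k))], [eta = v mu/m], [theta = m^2/4].

   Convergence, holomorphy, Lipschitz bounds and the expansion in [v] all come
   from one estimate: the recursion is solved in any Banach algebra in which
   [a], [b], [k] have norm at most 1/20.  As [a] and [b] are divisible by
   [v^4], so is [Gamma - Id]; it is a contraction on a small polydisk, which
   makes [Gamma] biholomorphic. *)

(** No branch of a square root is ever chosen: powers of [rho] enter only through [a], [b], [k], and
    [rho] itself is [v * mu w / 2], where [mu] is a series with value 1 at [w = 1/4]. Holomorphy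
    means complex differentiability at each point; the norms carry a Lipschitz constant, which plays
    the part of Cauchy's estimates. The weights also give the transport of the vector field. Along a
    solution of (B) the logarithmic derivatives of [a], [b], [k] are 4, 5, 6 times that of [rho], so
    differentiating a series multiplies its term of degree [n] by [n], and the recursion turns back
    into the hodograph system without any partial derivative. This computation divides by [v];
    points with [v = 0] are treated separately, through the expansion in [v]. The map is given by
    formulas independent of [x0]. Only the size of the polydisk depends on [x0], because [a] is
    proportional to [p], which is about as large as [x0]. *)

(** * Dominated series of complex numbers *)

Lemma is_series_C_iff (a : nat -> C) (l : C) :
  is_series (K := C_AbsRing) (V := C_NormedModule) a l <->
  (forall eps : R, (0 < eps)%R -> exists N, forall n, (N <= n)%nat ->
     (Cmod (sum_n a n - l) < eps)%R).
Proof.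
  split.
  - intros H eps He.
    destruct (H (fun y => ball_norm (V := C_NormedModule) l (mkposreal eps He) y))
      as [N HN].
    + apply (locally_le_locally_norm (V := C_NormedModule)).
      exists (mkposreal eps He). now intros y Hy.
    + exists N. intros n Hn. exact (HN n Hn).
  - intros H P HP.
    apply (locally_norm_le_locally (V := C_NormedModule)) in HP.
    destruct HP as [eps He].
    destruct (H eps (cond_pos eps)) as [N HN].
    exists N. intros n Hn. apply He. exact (HN n Hn).
Qed.

Lemma Cmod_sum_n (a : nat -> C) (n : nat) :
  (Cmod (sum_n a n) <= sum_n (fun k => Cmod (a k)) n)%R.
Proof.
  induction n as [|n IH].
  - rewrite !sum_O. lra.
  - rewrite !sum_Sn. eapply Rle_trans; [apply Cmod_triangle|].
    apply Rplus_le_compat_r, IH.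
Qed.

(** A bound on all partial sums, rather than a limit, is what the recursion propagates; for
    nonnegative terms it already yields convergence and uniform tails. *)
Definition summable_below (b : nat -> R) (M : R) : Prop :=
  (forall n, 0 <= b n)%R /\ forall K, (sum_n b K <= M)%R.

Lemma sum_n_incr_le (b : nat -> R) (n m : nat) :
  (forall k, 0 <= b k)%R -> (n <= m)%nat -> (sum_n b n <= sum_n b m)%R.
Proof.
  intros Hb. induction 1 as [|m Hm IH]; [lra|].
  rewrite sum_Sn. unfold plus; simpl. specialize (Hb (S m)). lra.
Qed.

Lemma summable_below_term (b : nat -> R) (M : R) (n : nat) :
  summable_below b M -> (b n <= M)%R.
Proof.
  intros [Hb HM]. specialize (HM n). destruct n.
  - now rewrite sum_O in HM.
  - rewrite sum_Sn in HM. unfold plus in HM; simpl in HM.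
    assert (H := sum_n_incr_le b 0 n Hb (Nat.le_0_l n)). rewrite sum_O in H.
    specialize (Hb 0%nat). lra.
Qed.

Lemma summable_below_ge0 (b : nat -> R) (M : R) :
  summable_below b M -> (0 <= M)%R.
Proof.
  intros H. assert (H1 := summable_below_term b M 0 H). destruct H as [H _].
  specialize (H 0%nat). lra.
Qed.

Lemma summable_below_tail (b : nat -> R) (M eps : R) :
  summable_below b M -> (0 < eps)%R ->
  exists N, forall K, (sum_n b K - sum_n b N <= eps)%R.
Proof.
  intros [Hb HM] He.
  destruct (ex_finite_lim_seq_incr (sum_n b) M) as [l Hl].
  - intros n. apply sum_n_incr_le; auto.
  - exact HM.
  - assert (Hle : forall n, (sum_n b n <= l)%R).
    { intros n. apply (is_lim_seq_incr_compare (sum_n b) l Hl).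
      intros m. apply sum_n_incr_le; auto. }
    destruct (proj2 (is_lim_seq_spec _ _) Hl (mkposreal eps He)) as [N HN].
    exists N. intros K. specialize (HN N (Nat.le_refl _)). simpl in HN.
    specialize (Hle K). apply Rabs_def2 in HN. lra.
Qed.

Lemma Cmod_sum_n_tail (a : nat -> C) (b : nat -> R) (N n : nat) :
  (forall k, (Cmod (a k) <= b k)%R) -> (N <= n)%nat ->
  (Cmod (sum_n a n - sum_n a N) <= sum_n b n - sum_n b N)%R.
Proof.
  intros Hab. induction 1 as [|n Hn IH].
  - unfold Cminus. rewrite Cplus_opp_r, Cmod_0. lra.
  - rewrite !sum_Sn. unfold plus; simpl.
    replace (sum_n a n + a (S n) - sum_n a N)%C
      with ((sum_n a n - sum_n a N) + a (S n)) by ring.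
    eapply Rle_trans; [apply Cmod_triangle|]. specialize (Hab (S n)). lra.
Qed.

(** A total operator, so that a series of functions is again a function and convergence is a
    separate matter. *)
Definition Cseries (a : nat -> C) : C :=
  iota (T := CompleteNormedModule.CompleteSpace C_AbsRing C_CompleteNormedModule)
    (is_series (K := C_AbsRing) (V := C_NormedModule) a).

Lemma Cseries_unique (a : nat -> C) (l : C) :
  is_series (K := C_AbsRing) (V := C_NormedModule) a l -> Cseries a = l.
Proof.
  intros H. apply (iota_unique (V := C_CompleteNormedModule)).
  - intros y Hy.
    exact (filterlim_locally_unique (V := C_NormedModule) _ _ _ Hy H).
  - exact H.
Qed.

Lemma summable_below_ex_series (b : nat -> R) (M : R) :
  summable_below b M -> ex_series b.
Proof.
  intros [Hb HM].
  destruct (ex_finite_lim_seq_incr (sum_n b) M) as [l Hl].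
  - intros n. apply sum_n_incr_le; auto.
  - exact HM.
  - exists l. exact Hl.
Qed.

Section Dominated.
Variables (a : nat -> C) (b : nat -> R) (M : R).
Hypothesis (Hb : summable_below b M).
Hypothesis (Hab : forall n, (Cmod (a n) <= b n)%R).

Lemma Cseries_correct :
  is_series (K := C_AbsRing) (V := C_NormedModule) a (Cseries a).
Proof.
  destruct (ex_series_le (V := C_CompleteNormedModule) a b) as [l Hl].
  - exact Hab.
  - exact (summable_below_ex_series b M Hb).
  - now rewrite (Cseries_unique a l Hl).
Qed.

(** If the error exceeded [eps], a partial sum close enough to the limit would already violate the
    bound on the tail of [b]. *)
Lemma Cseries_tail (N : nat) (eps : R) :
  (forall K, (sum_n b K - sum_n b N <= eps)%R) ->
  (Cmod (Cseries a - sum_n a N) <= eps)%R.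
Proof.
  intros HN. apply Rnot_lt_le. intros Hlt.
  destruct (proj1 (is_series_C_iff _ _) Cseries_correct
              (Cmod (Cseries a - sum_n a N) - eps)%R) as [N' HN'].
  { lra. }
  assert (H1 := HN' _ (Nat.le_max_r N N')).
  assert (H2 := Cmod_sum_n_tail a b N _ Hab (Nat.le_max_l N N')).
  specialize (HN (Nat.max N N')).
  assert (H3 := Cmod_triangle (sum_n a (Nat.max N N') - sum_n a N)
                  (- (sum_n a (Nat.max N N') - Cseries a))).
  rewrite Cmod_opp in H3.
  replace (sum_n a (Nat.max N N') - sum_n a N +
           - (sum_n a (Nat.max N N') - Cseries a))%C
    with (Cseries a - sum_n a N) in H3 by ring.
  lra.
Qed.

Lemma Cseries_bound : (Cmod (Cseries a) <= M)%R.
Proof.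
  assert (H := Cseries_tail 0 (M - b 0%nat)%R).
  rewrite !sum_O in H.
  replace (Cseries a) with ((Cseries a - a 0%nat) + a 0%nat) by ring.
  eapply Rle_trans; [apply Cmod_triangle|].
  assert (H1 : (Cmod (Cseries a - a 0%nat) <= M - b 0%nat)%R).
  { apply H. intros K. destruct Hb as [_ HM]. specialize (HM K). lra. }
  specialize (Hab 0%nat). lra.
Qed.

End Dominated.

Definition conv {K : Ring} (x y : nat -> K) (n : nat) : K :=
  sum_n (fun k => mult (x k) (y (n - k)%nat)) n.

Lemma is_series_C_components (a : nat -> C) (l : C) :
  is_series (K := C_AbsRing) (V := C_NormedModule) a l <->
  is_series (fun n => fst (a n)) (fst l) /\ is_series (fun n => snd (a n)) (snd l).
Proof.
  assert (Hs : forall n, sum_n a n =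
     (sum_n (fun k => fst (a k)) n, sum_n (fun k => snd (a k)) n)).
  { induction n as [|n IH].
    - rewrite !sum_O. apply surjective_pairing.
    - rewrite !sum_Sn, IH. reflexivity. }
  split.
  - intros H. split.
    + apply (filterlim_ext (fun n => fst (sum_n a n))).
      { intros n. now rewrite Hs. }
      eapply filterlim_comp; [exact H|].
      apply (continuous_fst (U := R_UniformSpace) (V := R_UniformSpace)).
    + apply (filterlim_ext (fun n => snd (sum_n a n))).
      { intros n. now rewrite Hs. }
      eapply filterlim_comp; [exact H|].
      apply (continuous_snd (U := R_UniformSpace) (V := R_UniformSpace)).
  - intros [H1 H2].
    assert (Hp := filterlim_pair _ _ H1 H2).
    intros P HP. destruct HP as [eps HP].
    assert (HQ := Hp (fun z : R * R => P z)).
    destruct HQ as [N HN].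
    + apply Filter_prod with (ball (fst l) eps) (ball (snd l) eps).
      * apply locally_ball.
      * apply locally_ball.
      * intros x y Hx Hy. apply HP. split; assumption.
    + exists N. intros n Hn. rewrite Hs. exact (HN n Hn).
Qed.

(** The real and imaginary parts of the product are a difference and a sum of real Cauchy products,
    which converge because the components are absolutely summable under [ha] and [hb]. *)
Lemma is_series_conv (a b : nat -> C) (ha hb : nat -> R) (Ma Mb : R) (la lb : C) :
  summable_below ha Ma -> summable_below hb Mb ->
  (forall n, (Cmod (a n) <= ha n)%R) -> (forall n, (Cmod (b n) <= hb n)%R) ->
  is_series (K := C_AbsRing) (V := C_NormedModule) a la ->
  is_series (K := C_AbsRing) (V := C_NormedModule) b lb ->
  is_series (K := C_AbsRing) (V := C_NormedModule)
    (conv (K := C_Ring) a b) (la * lb).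
Proof.
  intros Ha Hb Haa Hbb HA HB.
  apply is_series_C_components in HA. destruct HA as [HA1 HA2].
  apply is_series_C_components in HB. destruct HB as [HB1 HB2].
  assert (E : forall (c : nat -> C) (h : nat -> R) (M : R), summable_below h M ->
     (forall n, (Cmod (c n) <= h n)%R) ->
     ex_series (fun n => Rabs (fst (c n))) /\ ex_series (fun n => Rabs (snd (c n)))).
  { intros c h M Hh Hc. split.
    - apply (ex_series_le (V := R_CompleteNormedModule)) with h.
      + intros n. unfold norm; simpl. unfold abs; simpl. rewrite Rabs_Rabsolu.
        apply Rle_trans with (2 := Hc n).
        eapply Rle_trans; [apply Rmax_l|apply Rmax_Cmod].
      + exact (summable_below_ex_series h M Hh).
    - apply (ex_series_le (V := R_CompleteNormedModule)) with h.
      + intros n. unfold norm; simpl. unfold abs; simpl. rewrite Rabs_Rabsolu.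
        apply Rle_trans with (2 := Hc n).
        eapply Rle_trans; [apply Rmax_r|apply Rmax_Cmod].
      + exact (summable_below_ex_series h M Hh). }
  destruct (E a ha Ma Ha Haa) as [EA1 EA2].
  destruct (E b hb Mb Hb Hbb) as [EB1 EB2].
  apply is_series_C_components.
  assert (Hc : forall n, conv (K := C_Ring) a b n =
    (sum_n (fun k => fst (a k) * fst (b (n - k)%nat) - snd (a k) * snd (b (n - k)%nat))%R n,
     sum_n (fun k => fst (a k) * snd (b (n - k)%nat) + snd (a k) * fst (b (n - k)%nat))%R n)).
  { intros n.
    assert (G : forall (m : nat) (u v : nat -> R),
      sum_n (G := C_AbelianMonoid) (fun k => (u k, v k)) m = (sum_n u m, sum_n v m)).
    { intros m u v. induction m as [|m IH]; [now rewrite !sum_O|].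
      rewrite !sum_Sn, IH. reflexivity. }
    exact (G n _ _). }
  split.
  - eapply is_series_ext.
    2: { apply (is_series_minus (V := R_NormedModule)).
         - apply (is_series_mult _ _ _ _ HA1 HB1 EA1 EB1).
         - apply (is_series_mult _ _ _ _ HA2 HB2 EA2 EB2). }
    intros n. eapply eq_trans; [|exact (eq_sym (f_equal fst (Hc n)))].
    rewrite <- !sum_n_Reals.
    assert (G : forall (u v : nat -> R) m,
      plus (sum_n u m) (opp (sum_n v m)) = sum_n (fun k => u k - v k)%R m).
    { intros u v m. induction m as [|m IH]; [now rewrite !sum_O|].
      rewrite !sum_Sn, <- IH. unfold plus, opp; simpl. ring. }
    exact (G _ _ n).
  - eapply is_series_ext.
    2: { apply (is_series_plus (V := R_NormedModule)).
         - apply (is_series_mult _ _ _ _ HA1 HB2 EA1 EB2).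
         - apply (is_series_mult _ _ _ _ HA2 HB1 EA2 EB1). }
    intros n. eapply eq_trans; [|exact (eq_sym (f_equal snd (Hc n)))].
    rewrite <- !sum_n_Reals.
    exact (eq_sym (sum_n_plus (G := R_AbelianMonoid) _ _ n)).
Qed.

Lemma sum_n_Rmult_r (b : nat -> R) (c : R) (n : nat) :
  sum_n (fun k => b k * c)%R n = (sum_n b n * c)%R.
Proof. exact (sum_n_mult_r (K := R_Ring) c b n). Qed.

Lemma summable_below_scal_r (b : nat -> R) (M c : R) :
  (0 <= c)%R -> summable_below b M -> summable_below (fun n => b n * c)%R (M * c)%R.
Proof.
  intros Hc [Hb HM]. split.
  - intros n. apply Rmult_le_pos; auto.
  - intros K. rewrite sum_n_Rmult_r. apply Rmult_le_compat_r; auto.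
Qed.

(** * Differentials in terms of norms *)

Lemma locally_iff_norm {K : AbsRing} {U : NormedModule K} (x : U) (P : U -> Prop) :
  locally x P <->
  exists d : posreal, forall y, (norm (minus y x) < d)%R -> P y.
Proof.
  split.
  - intros H. apply locally_norm_le_locally in H. destruct H as [d Hd].
    exists d. exact Hd.
  - intros [d Hd]. apply locally_le_locally_norm. exists d. exact Hd.
Qed.

Lemma filterdiff_iff_norm {K : AbsRing} {U V : NormedModule K}
    (f : U -> V) (x : U) (l : U -> V) :
  filterdiff f (locally x) l <->
  is_linear l /\
  forall eps : posreal, exists d : posreal, forall y, (norm (minus y x) < d)%R ->
    (norm (minus (minus (f y) (f x)) (l (minus y x))) <= eps * norm (minus y x))%R.
Proof.
  split.
  - intros [Hl H]. split; [exact Hl|]. intros eps.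
    exact (proj1 (locally_iff_norm _ _) (H x (fun P HP => HP) eps)).
  - intros [Hl H]. split; [exact Hl|]. intros x' Hx' eps.
    assert (E : x' = x).
    { apply eq_sym, is_filter_lim_locally_unique, Hx'. }
    subst x'. apply locally_iff_norm, H.
Qed.

Lemma is_linear_C_scal (l : C) :
  is_linear (U := C_NormedModule) (V := C_NormedModule) (fun h : C => h * l).
Proof.
  constructor.
  - intros x y. apply Cmult_plus_distr_r.
  - intros k x. symmetry. apply Cmult_assoc.
  - exists (Cmod l + 1)%R. assert (H := Cmod_ge_0 l). split; [lra|].
    intros x. change (Cmod (x * l) <= (Cmod l + 1) * Cmod x)%R.
    rewrite Cmod_mult. assert (H1 := Cmod_ge_0 x). nra.
Qed.

(** [is_derive] takes [C] as a module over itself, while [C_NormedModule] has the product uniform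
    structure. The norms agree, so the epsilon-delta form passes from one to the other. *)
Lemma is_derive_C_iff (f : C -> C) (x l : C) :
  is_derive (K := C_AbsRing) (V := C_NormedModule) f x l <->
  filterdiff (U := C_NormedModule) (V := C_NormedModule) f (locally x) (fun h => h * l).
Proof.
  unfold is_derive. rewrite !filterdiff_iff_norm.
  split; intros [_ H]; (split; [|exact H]).
  - apply is_linear_C_scal.
  - apply is_linear_scal_l.
Qed.

Lemma ex_derive_C_iff (f : C -> C) (x : C) :
  ex_derive (K := C_AbsRing) (V := C_NormedModule) f x <->
  ex_filterdiff (U := C_NormedModule) (V := C_NormedModule) f (locally x).
Proof.
  split.
  - intros [l Hl]. eexists. apply is_derive_C_iff, Hl.
  - intros [l Hl]. exists (l (RtoC 1)). apply is_derive_C_iff.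
    apply filterdiff_ext_lin with l; [exact Hl|]. intros h.
    destruct Hl as [Hl _].
    change (l h = scal (V := C_NormedModule) h (l (RtoC 1))).
    rewrite <- (linear_scal l Hl). f_equal. symmetry. apply Cmult_1_r.
Qed.

Lemma is_derive_C_eps (f : C -> C) (x l : C) :
  is_derive (K := C_AbsRing) (V := C_NormedModule) f x l <->
  forall eps : posreal, exists d : posreal, forall y, (Cmod (y - x) < d)%R ->
    (Cmod (f y - f x - (y - x) * l) <= eps * Cmod (y - x))%R.
Proof.
  rewrite is_derive_C_iff, filterdiff_iff_norm. split.
  - intros [_ H]. exact H.
  - intros H. split; [apply is_linear_C_scal|exact H].
Qed.

Section Group.
Context {G : AbelianGroup}.
Implicit Types a b c d : G.

Lemma minus_plus_l a b : minus (plus a b) a = b.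
Proof.
  unfold minus. rewrite plus_comm, plus_assoc.
  eapply eq_trans; [apply (f_equal (fun z => plus z b)), (plus_opp_l a)|].
  apply plus_zero_l.
Qed.

Lemma plus_minus_l a b : plus (minus a b) b = a.
Proof.
  unfold minus. rewrite <- plus_assoc.
  eapply eq_trans; [apply (f_equal (plus a)), (plus_opp_l b)|].
  apply plus_zero_r.
Qed.

Lemma plus_opp_minus a c : plus a (opp (minus a c)) = c.
Proof. rewrite opp_minus, plus_comm. apply plus_minus_l. Qed.

Lemma minus_minus_same_r a b c : minus (minus a c) (minus b c) = minus a b.
Proof.
  rewrite (minus_trans b a c).
  apply (plus_reg_r (minus b c)). apply plus_minus_l.
Qed.

Lemma minus_minus_swap a b c d :
  minus (minus a b) (minus c d) = minus (minus a c) (minus b d).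
Proof.
  apply (plus_reg_r (minus c d)). rewrite plus_minus_l.
  rewrite (minus_trans c a b), (minus_trans b c d).
  rewrite (plus_comm (minus c b)), plus_assoc.
  now rewrite plus_minus_l.
Qed.

End Group.

(** Testing on the points [x + s h] with small real [s > 0] turns a bound on the increments of [f]
    into one on its differential. *)
Lemma filterdiff_norm_le {U V : NormedModule C_AbsRing} (f D : U -> V) (x : U) (b : R) :
  (0 <= b)%R -> filterdiff f (locally x) D ->
  locally x (fun y => norm (minus (f y) (f x)) <= b * norm (minus y x))%R ->
  forall h, (norm (D h) <= b * norm h)%R.
Proof.
  intros Hb HD Hloc h. apply Rnot_lt_le. intros Hlt.
  apply locally_iff_norm in Hloc. destruct Hloc as [d0 Hd0].
  destruct (proj1 (filterdiff_iff_norm _ _ _) HD) as [Hlin Hd].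
  assert (Hh : (0 < norm h)%R).
  { destruct (norm_ge_0 h) as [H|H]; [exact H|].
    apply eq_sym, norm_eq_zero in H. subst h.
    rewrite (linear_zero D Hlin), !norm_zero in Hlt. lra. }
  (* Half of the supposed excess per unit of [norm h], so that the two estimates at [x + s h]
     contradict each other. *)
  set (eps := ((norm (D h) - b * norm h) / (2 * norm h))%R).
  assert (Heps : (0 < eps)%R) by (unfold eps; apply Rdiv_lt_0_compat; lra).
  destruct (Hd (mkposreal eps Heps)) as [d1 Hd1]. simpl in Hd1.
  assert (Hmin : (0 < Rmin d0 d1)%R)
    by (apply Rmin_glb_lt; [apply (cond_pos d0)|apply (cond_pos d1)]).
  set (s := (Rmin d0 d1 / (2 * norm h))%R).
  assert (Hs : (0 < s)%R) by (unfold s; apply Rdiv_lt_0_compat; lra).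
  (* One inequality is the norm axiom; the other is the same axiom applied to [/ s]. *)
  assert (Ns : forall (W : NormedModule C_AbsRing) (z : W),
             norm (scal (RtoC s : AbsRing.sort C_AbsRing) z) = (s * norm z)%R).
  { assert (N1 : forall (c : R) (W : NormedModule C_AbsRing) (z : W), (0 < c)%R ->
       (norm (scal (RtoC c : AbsRing.sort C_AbsRing) z) <= c * norm z)%R).
    { intros c W z Hc.
      eapply Rle_trans; [exact (norm_scal (K := C_AbsRing) (RtoC c) z)|].
      change (Cmod (RtoC c) * norm z <= c * norm z)%R.
      rewrite Cmod_R, Rabs_pos_eq by lra. lra. }
    intros W z. apply Rle_antisym; [apply N1; exact Hs|].
    apply Rmult_le_reg_l with (/ s)%R; [apply Rinv_0_lt_compat, Hs|].
    rewrite <- Rmult_assoc, Rinv_l, Rmult_1_l by lra.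
    eapply Rle_trans; [|apply N1, Rinv_0_lt_compat, Hs].
    right. f_equal. symmetry.
    eapply eq_trans; [apply (scal_assoc (K := AbsRing.Ring C_AbsRing))|].
    eapply eq_trans; [|apply (scal_one (K := AbsRing.Ring C_AbsRing))].
    apply (f_equal (fun c => scal c z)).
    change (RtoC (/ s) * RtoC s = RtoC 1)%C.
    rewrite <- RtoC_mult, Rinv_l by lra. reflexivity. }
  set (y := plus x (scal (RtoC s : AbsRing.sort C_AbsRing) h)).
  assert (Ey : minus y x = scal (RtoC s : AbsRing.sort C_AbsRing) h).
  { unfold y, minus. rewrite plus_comm, plus_assoc, plus_opp_l. apply plus_zero_l. }
  assert (Hy : (norm (minus y x) < Rmin d0 d1)%R).
  { rewrite Ey, Ns. unfold s.
    replace (Rmin d0 d1 / (2 * norm h) * norm h)%R with (Rmin d0 d1 / 2)%R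
      by (field; lra). lra. }
  assert (H0 := Hd0 y (Rlt_le_trans _ _ _ Hy (Rmin_l _ _))).
  assert (H1 := Hd1 y (Rlt_le_trans _ _ _ Hy (Rmin_r _ _))).
  rewrite Ey in H0, H1. rewrite (linear_scal _ Hlin) in H1.
  assert (H2 : (norm (scal (RtoC s : AbsRing.sort C_AbsRing) (D h)) <=
    norm (minus (f y) (f x)) +
    norm (minus (minus (f y) (f x)) (scal (RtoC s : AbsRing.sort C_AbsRing) (D h))))%R).
  { eapply Rle_trans;
      [right; apply f_equal; symmetry; apply (plus_opp_minus (minus (f y) (f x)))|].
    eapply Rle_trans; [apply norm_triangle|].
    apply Rplus_le_compat_l. right. apply norm_opp. }
  rewrite Ns in H0, H1. rewrite Ns in H2.
  assert (H4 : (norm (D h) <= (b + eps) * norm h)%R).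
  { apply Rmult_le_reg_l with s; [exact Hs|]. lra. }
  assert (H5 : (eps * norm h = (norm (D h) - b * norm h) / 2)%R).
  { unfold eps. field. lra. }
  lra.
Qed.

Section Mult.
Context {U : NormedModule C_AbsRing}.

Lemma filterdiff_Cmult (f g : U -> C) (x : U) (lf lg : U -> C) :
  filterdiff (V := C_NormedModule) f (locally x) lf ->
  filterdiff (V := C_NormedModule) g (locally x) lg ->
  filterdiff (V := C_NormedModule) (fun y => f y * g y) (locally x)
    (fun h => lf h * g x + f x * lg h).
Proof.
  intros Hf Hg.
  (* The product rule is applied on [C] as a module over itself; since the norms are equal,
     differentials for the two structures are the same. *)
  assert (T : forall (k : U -> C) l,
    filterdiff (V := C_NormedModule) k (locally x) l <->
    filterdiff (V := AbsRing_NormedModule C_AbsRing) k (locally x) l).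
  { intros k l. rewrite !filterdiff_iff_norm.
    split; intros [[H1 H2 H3] H]; (split; [constructor; assumption|exact H]). }
  apply T. apply T in Hf. apply T in Hg.
  apply (filterdiff_comp'_2 (U := AbsRing_NormedModule C_AbsRing) (V := AbsRing_NormedModule C_AbsRing)
    (W := AbsRing_NormedModule C_AbsRing) f g (fun a b : C => a * b) x lf lg
    (fun a b => a * g x + f x * b) Hf Hg).
  apply (filterdiff_mult (K := C_AbsRing) (f x, g x)).
  - intros P HP. exact HP.
  - intros a b. apply Cmult_comm.
Qed.

Lemma filterdiff_Cplus (f g : U -> C) (x : U) (lf lg : U -> C) :
  filterdiff (V := C_NormedModule) f (locally x) lf ->
  filterdiff (V := C_NormedModule) g (locally x) lg ->
  filterdiff (V := C_NormedModule) (fun y => f y + g y) (locally x)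
    (fun h => lf h + lg h).
Proof.
  intros Hf Hg.
  exact (filterdiff_plus_fct (V := C_NormedModule) f g lf lg Hf Hg).
Qed.

(* The difference quotients of the terms are dominated by [b]. *)
Lemma filterdiff_Cseries (f : nat -> U -> C) (D : nat -> U -> C)
    (b b0 : nat -> R) (M M0 : R) (x : U) :
  summable_below b M -> summable_below b0 M0 ->
  (forall n, filterdiff (V := C_NormedModule) (f n) (locally x) (D n)) ->
  locally x (fun y => forall n, (Cmod (f n y) <= b0 n)%R /\
    (Cmod (f n y - f n x) <= b n * norm (minus y x))%R) ->
  filterdiff (V := C_NormedModule) (fun y => Cseries (fun n => f n y)) (locally x)
    (fun h => Cseries (fun n => D n h)).
Proof.
  intros Hb Hb0 HD Hloc.
  assert (DL : forall n h, (Cmod (D n h) <= b n * norm h)%R).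
  { intros n. apply (filterdiff_norm_le (V := C_NormedModule) (f n) (D n) x (b n)).
    - apply Hb.
    - apply HD.
    - eapply filter_imp; [|exact Hloc]. intros y Hy. apply Hy. }
  assert (Hbh : forall h : U, summable_below (fun n => b n * norm h)%R (M * norm h)).
  { intros h. apply summable_below_scal_r; [apply norm_ge_0|exact Hb]. }
  apply filterdiff_iff_norm. split.
  - constructor.
    + intros h k. apply Cseries_unique.
      eapply is_series_ext.
      2: { apply (is_series_plus (V := C_NormedModule)).
           - apply (Cseries_correct _ _ _ (Hbh h)). intros n. apply DL.
           - apply (Cseries_correct _ _ _ (Hbh k)). intros n. apply DL. }
      intros n. symmetry. apply (linear_plus _ (proj1 (HD n))).
    + intros c h. apply Cseries_unique.
      eapply is_series_ext.
      2: { apply (is_series_scal (V := C_NormedModule) c).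
           apply (Cseries_correct _ _ _ (Hbh h)). intros n. apply DL. }
      intros n. symmetry. apply (linear_scal _ (proj1 (HD n))).
    + exists (M + 1)%R. split.
      { assert (H := summable_below_ge0 b M Hb). lra. }
      intros h. apply Rle_trans with (M * norm h)%R.
      * apply (Cseries_bound _ _ _ (Hbh h)). intros n. apply DL.
      * apply Rmult_le_compat_r; [apply norm_ge_0|lra].
  - intros eps.
    (* One third each for the finite sum up to [N], the tail of the increments and the tail of the
       differentials; both tails are at most [norm (y - x)] times the tail of [b]. *)
    destruct (summable_below_tail b M (eps / 3)%R Hb) as [N HN].
    { assert (H := cond_pos eps). lra. }
    assert (HF : filterdiff (V := C_NormedModule)
                  (fun y => sum_n (fun n => f n y) N) (locally x)
                  (fun h => sum_n (fun n => D n h) N)).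
    { clear HN. induction N as [|N IH].
      - apply (filterdiff_ext (f 0%nat)).
        { intros y. exact (eq_sym (sum_O (G := C_AbelianMonoid) (fun n => f n y))). }
        eapply filterdiff_ext_lin; [apply (HD 0%nat)|].
        intros h. exact (eq_sym (sum_O (G := C_AbelianMonoid) (fun n => D n h))).
      - apply (filterdiff_ext (fun y => sum_n (fun n => f n y) N + f (S N) y)).
        { intros y. exact (eq_sym (sum_Sn (G := C_AbelianMonoid) (fun n => f n y) N)). }
        eapply filterdiff_ext_lin; [apply filterdiff_Cplus; [exact IH|apply (HD (S N))]|].
        intros h. exact (eq_sym (sum_Sn (G := C_AbelianMonoid) (fun n => D n h) N)). }
    destruct (proj1 (filterdiff_iff_norm _ _ _) HF) as [_ HF2].
    assert (He3 : (0 < eps / 3)%R) by (assert (H := cond_pos eps); lra).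
    destruct (HF2 (mkposreal _ He3)) as [d1 Hd1]. simpl in Hd1.
    apply locally_iff_norm in Hloc. destruct Hloc as [d0 Hd0].
    assert (Hmin : (0 < Rmin d0 d1)%R)
      by (apply Rmin_glb_lt; [apply (cond_pos d0)|apply (cond_pos d1)]).
    exists (mkposreal _ Hmin). simpl. intros y Hy.
    assert (H1 := Hd1 y (Rlt_le_trans _ _ _ Hy (Rmin_r _ _))).
    assert (H0 := Hd0 y (Rlt_le_trans _ _ _ Hy (Rmin_l _ _))).
    assert (Hx0 : forall n, (Cmod (f n x) <= b0 n)%R).
    { intros n. apply (Hd0 x). eapply Rle_lt_trans; [|exact (cond_pos d0)]. right.
      eapply eq_trans; [apply f_equal, (minus_eq_zero (G := U))|apply (norm_zero (V := U))]. }
    set (h := minus y x) in *.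
    change (Cmod (sum_n (fun n => f n y) N - sum_n (fun n => f n x) N
                  - sum_n (fun n => D n h) N) <= eps / 3 * norm h)%R in H1.
    change (Cmod (Cseries (fun n => f n y) - Cseries (fun n => f n x)
                  - Cseries (fun n => D n h)) <= eps * norm h)%R.
    assert (E1 : Cseries (fun n => f n y - f n x) =
                 Cseries (fun n => f n y) - Cseries (fun n => f n x)).
    { apply Cseries_unique. apply (is_series_minus (V := C_NormedModule)).
      - apply (Cseries_correct _ _ _ Hb0). intros n. apply H0.
      - apply (Cseries_correct _ _ _ Hb0). exact Hx0. }
    assert (E2 : sum_n (fun n => f n y - f n x) N =
                 sum_n (fun n => f n y) N - sum_n (fun n => f n x) N).
    { clear. induction N as [|N IH]; [now rewrite !sum_O|].
      rewrite !sum_Sn, IH. unfold plus; simpl. ring. }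
    assert (Htail : forall K, (sum_n (fun n => b n * norm h) K -
                               sum_n (fun n => b n * norm h) N <= eps / 3 * norm h)%R).
    { intros K. rewrite !sum_n_Rmult_r.
      specialize (HN K). assert (H := norm_ge_0 h). nra. }
    assert (T1 := Cseries_tail (fun n => f n y - f n x) _ _ (Hbh h)
                    (fun n => proj2 (H0 n)) N _ Htail).
    assert (T2 := Cseries_tail (fun n => D n h) _ _ (Hbh h)
                    (fun n => DL n h) N _ Htail).
    rewrite E1, E2 in T1.
    assert (Tr1 := Cmod_triangle
      (Cseries (fun n => f n y) - Cseries (fun n => f n x) -
        (sum_n (fun n => f n y) N - sum_n (fun n => f n x) N))
      (sum_n (fun n => f n y) N - sum_n (fun n => f n x) N - sum_n (fun n => D n h) N)).
    assert (Tr2 := Cmod_triangle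
      (Cseries (fun n => f n y) - Cseries (fun n => f n x) -
        (sum_n (fun n => f n y) N - sum_n (fun n => f n x) N) +
      (sum_n (fun n => f n y) N - sum_n (fun n => f n x) N - sum_n (fun n => D n h) N))
      (- (Cseries (fun n => D n h) - sum_n (fun n => D n h) N))).
    rewrite Cmod_opp in Tr2.
    match type of Tr2 with (Cmod ?u <= _)%R =>
      replace u with (Cseries (fun n => f n y) - Cseries (fun n => f n x)
                  - Cseries (fun n => D n h))%C in Tr2 by ring end.
    lra.
Qed.

End Mult.

(** Sequential completeness in the norm passes to products, hence to [C3], and is the form in which
    the Newton iteration uses it. *)
Definition norm_complete (E : NormedModule C_AbsRing) : Prop :=
  forall u : nat -> E,
    (forall eps, (0 < eps)%R -> exists N, forall n m, (N <= n)%nat -> (N <= m)%nat ->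
       (norm (minus (u n) (u m)) < eps)%R) ->
    exists l, forall eps, (0 < eps)%R -> exists N, forall n, (N <= n)%nat ->
       (norm (minus (u n) l) < eps)%R.

Lemma norm_complete_C : norm_complete C_NormedModule.
Proof.
  intros u Hu.
  destruct (proj1 (filterlim_locally_cauchy
    (U := CompleteNormedModule.CompleteSpace C_AbsRing C_CompleteNormedModule)
    (F := eventually) u)) as [l Hl].
  - intros eps.
    destruct (proj1 (locally_iff_norm (U := C_NormedModule) (RtoC 0) (ball (RtoC 0) eps))
      (locally_ball _ _)) as [d Hd].
    destruct (Hu d (cond_pos d)) as [N HN].
    exists (fun n => (N <= n)%nat). split; [exists N; auto|].
    intros n m Hn Hm. assert (H := HN m n Hm Hn).
    assert (H1 := Hd (u m - u n)%C).
    assert (H2 : ball (RtoC 0) eps (u m - u n)%C).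
    { apply H1. unfold minus at 1.
      change (Cmod (u m - u n - RtoC 0) < d)%R.
      replace (u m - u n - RtoC 0)%C with (u m - u n)%C by ring. exact H. }
    destruct H2 as [H2 H3].
    unfold ball in H2, H3; simpl in H2, H3. unfold AbsRing_ball in H2, H3.
    unfold abs, minus, plus, opp in H2, H3; simpl in H2, H3.
    split; unfold ball; simpl; unfold AbsRing_ball, abs, minus, plus, opp; simpl.
    + match goal with |- (Rabs ?a < _)%R =>
        match type of H2 with (Rabs ?b < _)%R => replace a with b by ring end end.
      exact H2.
    + match goal with |- (Rabs ?a < _)%R =>
        match type of H3 with (Rabs ?b < _)%R => replace a with b by ring end end.
      exact H3.
  - exists l. intros eps He.
    assert (H := Hl (ball_norm (V := C_NormedModule) l (mkposreal eps He))
                  (locally_ball_norm (V := C_NormedModule) _ _)).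
    destruct H as [N HN]. exists N. exact HN.
Qed.

Lemma norm_fst_le {K : AbsRing} {U V : NormedModule K} (p : prod_NormedModule K U V) :
  (norm (fst p) <= norm p)%R.
Proof.
  destruct p as [x y]. eapply Rle_trans; [apply Rmax_l|apply (proj1 (norm_prod x y))].
Qed.

Lemma norm_snd_le {K : AbsRing} {U V : NormedModule K} (p : prod_NormedModule K U V) :
  (norm (snd p) <= norm p)%R.
Proof.
  destruct p as [x y]. eapply Rle_trans; [apply Rmax_r|apply (proj1 (norm_prod x y))].
Qed.

Lemma norm_pair_le {K : AbsRing} {U V : NormedModule K} (p : prod_NormedModule K U V) :
  (norm p <= norm (fst p) + norm (snd p))%R.
Proof.
  change (sqrt (norm (fst p) ^ 2 + norm (snd p) ^ 2) <= norm (fst p) + norm (snd p))%R.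
  assert (H1 := norm_ge_0 (fst p)). assert (H2 := norm_ge_0 (snd p)).
  rewrite <- (sqrt_pow2 (norm (fst p) + norm (snd p))) by lra.
  apply sqrt_le_1_alt. nra.
Qed.

Lemma norm_complete_prod (U V : NormedModule C_AbsRing) :
  norm_complete U -> norm_complete V -> norm_complete (prod_NormedModule C_AbsRing U V).
Proof.
  intros HU HV u Hu.
  destruct (HU (fun n => fst (u n))) as [l1 H1].
  { intros eps He. destruct (Hu eps He) as [N HN]. exists N. intros n m Hn Hm.
    eapply Rle_lt_trans; [|apply (HN n m Hn Hm)].
    apply (norm_fst_le (minus (u n) (u m))). }
  destruct (HV (fun n => snd (u n))) as [l2 H2].
  { intros eps He. destruct (Hu eps He) as [N HN]. exists N. intros n m Hn Hm.
    eapply Rle_lt_trans; [|apply (HN n m Hn Hm)].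
    apply (norm_snd_le (minus (u n) (u m))). }
  exists (l1, l2). intros eps He.
  destruct (H1 (eps / 2)%R) as [N1 HN1]; [lra|].
  destruct (H2 (eps / 2)%R) as [N2 HN2]; [lra|].
  exists (Nat.max N1 N2). intros n Hn.
  eapply Rle_lt_trans; [apply norm_pair_le|].
  assert (G1 := HN1 n ltac:(lia)). assert (G2 := HN2 n ltac:(lia)).
  change (norm (minus (fst (u n)) l1) + norm (minus (snd (u n)) l2) < eps)%R.
  lra.
Qed.

(** * Perturbations of the identity *)

Section NearIdentity.
Context {E : NormedModule C_AbsRing}.
Hypothesis HE : norm_complete E.

(** The argument needs a constant below 1; with [1 / 2], both [f] and its inverse have Lipschitz
    constant at most 2. *)
Definition near_identity (D : E -> Prop) (f : E -> E) : Prop :=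
  forall x y, D x -> D y ->
    (norm (minus (minus (f x) (f y)) (minus x y)) <= / 2 * norm (minus x y))%R.

Lemma near_identity_lower (D : E -> Prop) (f : E -> E) (x y : E) :
  near_identity D f -> D x -> D y ->
  (norm (minus x y) <= 2 * norm (minus (f x) (f y)))%R.
Proof.
  intros Hf Hx Hy. specialize (Hf x y Hx Hy).
  assert (H : (norm (minus x y) <= norm (minus (f x) (f y)) +
     norm (minus (minus (f x) (f y)) (minus x y)))%R).
  { eapply Rle_trans;
      [right; apply f_equal; symmetry; apply (plus_opp_minus (minus (f x) (f y)))|].
    eapply Rle_trans; [apply norm_triangle|].
    apply Rplus_le_compat_l. right. apply norm_opp. }
  lra.
Qed.

Lemma near_identity_upper (D : E -> Prop) (f : E -> E) (x y : E) :
  near_identity D f -> D x -> D y ->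
  (norm (minus (f x) (f y)) <= 2 * norm (minus x y))%R.
Proof.
  intros Hf Hx Hy. specialize (Hf x y Hx Hy).
  assert (H : (norm (minus (f x) (f y)) <=
     norm (minus (minus (f x) (f y)) (minus x y)) + norm (minus x y))%R).
  { eapply Rle_trans;
      [right; apply f_equal; symmetry; apply (plus_minus_l (minus (f x) (f y)) (minus x y))|].
    apply norm_triangle. }
  assert (H1 := norm_ge_0 (minus x y)). lra.
Qed.

Lemma norm_minus_sym (x y : E) : norm (minus x y) = norm (minus y x).
Proof. rewrite <- (norm_opp (minus x y)). f_equal. apply opp_minus. Qed.

Lemma norm_minus_trans (x y z : E) :
  (norm (minus x z) <= norm (minus x y) + norm (minus y z))%R.
Proof.
  eapply Rle_trans; [right; apply f_equal, (minus_trans y x z)|]. apply norm_triangle.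
Qed.

Lemma norm_minus_diag (x : E) : norm (minus x x) = 0%R.
Proof. eapply eq_trans; [apply f_equal, (minus_eq_zero x)|apply norm_zero]. Qed.

(* Newton iteration [x <- x + (y - f x)]. *)
Lemma near_identity_surj (D : E -> Prop) (f : E -> E) (p y : E) (r : R) :
  near_identity D f -> (0 < r)%R ->
  (forall x, (norm (minus x p) <= r)%R -> D x) ->
  (norm (minus y (f p)) <= r / 2)%R ->
  exists x, (norm (minus x p) <= r)%R /\ f x = y.
Proof.
  intros Hf Hr HD Hy.
  set (u := fix u n := match n with O => p | S n => plus (u n) (minus y (f (u n))) end).
  assert (Hstep : forall n, minus (u (S n)) (u n) = minus y (f (u n))).
  { intros n. exact (minus_plus_l (u n) (minus y (f (u n)))). }
  (* The residual [y - f (u n)] is at least halved at each step, so the steps sum to at most [r] and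
     the iterates never leave the ball contained in [D]. *)
  assert (Hu : forall n, (norm (minus (u n) p) <= r * (1 - (/ 2) ^ n))%R /\
     (norm (minus y (f (u n))) <= r * (/ 2) ^ (S n))%R).
  { assert (Hpow : forall n, (0 < (/ 2) ^ n)%R) by (intros n; apply pow_lt; lra).
    induction n as [|n [IH1 IH2]].
    - simpl u. rewrite norm_minus_diag. simpl pow. split; lra.
    - assert (A : (norm (minus (u (S n)) p) <= r * (1 - (/ 2) ^ S n))%R).
      { eapply Rle_trans; [apply (norm_minus_trans _ (u n))|].
        rewrite Hstep. simpl pow in *. lra. }
      split; [exact A|].
      assert (D1 : D (u n)). { apply HD. specialize (Hpow n). nra. }
      assert (D2 : D (u (S n))). { apply HD. specialize (Hpow (S n)). nra. }
      assert (H := Hf (u (S n)) (u n) D2 D1). rewrite Hstep in H.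
      rewrite norm_minus_sym.
      eapply Rle_trans.
      { right. apply f_equal, eq_sym.
        apply (minus_minus_same_r (f (u (S n))) y (f (u n))). }
      eapply Rle_trans; [exact H|]. simpl pow in *. lra. }
  assert (Hpow : forall n, (0 < (/ 2) ^ n)%R) by (intros n; apply pow_lt; lra).
  assert (Hcau : forall n k, (norm (minus (u (n + k)%nat) (u n)) <= r * (/ 2) ^ n)%R).
  { intros n k.
    assert (H : (norm (minus (u (n + k)%nat) (u n)) <= r * ((/ 2) ^ n - (/ 2) ^ (n + k)))%R).
    { induction k as [|k IH].
      - rewrite Nat.add_0_r, norm_minus_diag. lra.
      - rewrite Nat.add_succ_r.
        eapply Rle_trans; [apply (norm_minus_trans _ (u (n + k)%nat))|].
        rewrite Hstep. destruct (Hu (n + k)%nat) as [_ H]. simpl pow in *. lra. }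
    specialize (Hpow (n + k)%nat). nra. }
  assert (Hlim : forall eps, (0 < eps)%R -> exists N, forall n, (N <= n)%nat ->
    (r * (/ 2) ^ n < eps)%R).
  { intros eps He.
    destruct (pow_lt_1_zero (/ 2)) with (y := (eps / r)%R) as [N HN].
    - rewrite Rabs_pos_eq; lra.
    - apply Rdiv_lt_0_compat; lra.
    - exists N. intros n Hn. specialize (HN n Hn).
      rewrite Rabs_pos_eq in HN by (apply Rlt_le, Hpow).
      apply Rmult_lt_compat_l with (r := r) in HN; [|exact Hr].
      replace (r * (eps / r))%R with eps in HN by (field; lra). exact HN. }
  destruct (HE u) as [l Hl].
  { intros eps He. destruct (Hlim (eps / 2)%R) as [N HN]; [lra|].
    exists N. intros n m Hn Hm. specialize (HN N (Nat.le_refl _)).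
    assert (H1 := Hcau N (n - N)%nat). assert (H2 := Hcau N (m - N)%nat).
    replace (N + (n - N))%nat with n in H1 by lia.
    replace (N + (m - N))%nat with m in H2 by lia.
    eapply Rle_lt_trans; [apply (norm_minus_trans _ (u N))|].
    rewrite (norm_minus_sym (u N) (u m)). lra. }
  assert (Hlp : (norm (minus l p) <= r)%R).
  { apply Rnot_lt_le. intros Hlt.
    destruct (Hl (norm (minus l p) - r)%R) as [N HN]; [lra|].
    specialize (HN N (Nat.le_refl _)). destruct (Hu N) as [H1 _].
    assert (H2 := norm_minus_trans l (u N) p). rewrite (norm_minus_sym l (u N)) in H2.
    assert (H3 := Rmult_lt_0_compat _ _ Hr (Hpow N)). lra. }
  exists l. split; [exact Hlp|].
  apply ball_norm_eq. intros eps. unfold ball_norm.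
  destruct (Hl (eps / 4)%R) as [N1 HN1]. { assert (H := cond_pos eps). lra. }
  destruct (Hlim (eps / 2)%R) as [N2 HN2]. { assert (H := cond_pos eps). lra. }
  set (n := Nat.max N1 N2).
  specialize (HN1 n ltac:(lia)). specialize (HN2 n ltac:(lia)).
  destruct (Hu n) as [H1 H2]. simpl pow in H2.
  assert (D1 : D (u n)). { apply HD. specialize (Hpow n). nra. }
  assert (H3 := near_identity_upper D f (u n) l Hf D1 (HD l Hlp)).
  assert (H4 := norm_minus_trans y (f (u n)) (f l)).
  specialize (Hpow n). nra.
Qed.

(** Injectivity comes from the lower Lipschitz bound, openness of the image from solving on small
    balls. The differential at each point is itself within [1 / 2] of the identity, hence invertible
    by the same iteration, and its inverse is the differential of the inverse map. *)
Lemma near_identity_biholomorphic (D : E -> Prop) (f : E -> E) :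
  open D -> holomorphic_on D f -> near_identity D f ->
  exists g, biholomorphic_onto_image D f g.
Proof.
  intros HD Hhol Hf.
  set (g := fun q => epsilon (inhabits (zero : E)) (fun p => D p /\ f p = q)).
  assert (Hg : forall p, D p -> g (f p) = p).
  { intros p Hp.
    assert (H : D (g (f p)) /\ f (g (f p)) = f p).
    { unfold g. apply epsilon_spec. exists p. split; [exact Hp|reflexivity]. }
    destruct H as [H1 H2].
    apply eq_sym, ball_norm_eq. intros eps. unfold ball_norm.
    eapply Rle_lt_trans; [apply (near_identity_lower D f _ _ Hf H1 Hp)|].
    rewrite H2, norm_minus_diag. assert (H := cond_pos eps). lra. }
  assert (Hopen : forall p, D p -> exists r : posreal, forall q,
     (norm (minus q (f p)) < r)%R -> image D f q).
  { intros p Hp. destruct (proj1 (locally_iff_norm _ _) (HD p Hp)) as [d Hd].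
    assert (Hd4 : (0 < d / 4)%R). { assert (H := cond_pos d). lra. }
    exists (mkposreal _ Hd4). simpl. intros q Hq.
    destruct (near_identity_surj D f p q (d / 2)%R Hf) as [x [Hx1 Hx2]].
    - lra.
    - intros x Hx. apply Hd. assert (H := cond_pos d). lra.
    - lra.
    - exists x. split; [|exact Hx2]. apply Hd. assert (H := cond_pos d). lra. }
  exists g. split; [exact Hhol|]. split; [|split; [|exact Hg]].
  - intros q [p [Hp <-]]. apply locally_iff_norm, Hopen, Hp.
  - intros q [p [Hp <-]]. destruct (Hhol p Hp) as [L HL].
    destruct (Hopen p Hp) as [r Hr].
    (* The Lipschitz bound on [f - id] passes to its differential [L - id]. *)
    assert (HLid : forall h, (norm (minus (L h) h) <= / 2 * norm h)%R).
    { apply (filterdiff_norm_le (fun y => minus (f y) y) (fun h => minus (L h) h) p).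
      - lra.
      - apply (filterdiff_minus_fct (F := locally p) f (fun y => y) L (fun h => h) HL).
        apply filterdiff_id.
      - eapply filter_imp; [|exact (HD p Hp)]. intros y Hy.
        eapply Rle_trans; [right; apply f_equal, (minus_minus_swap (f y) y (f p) p)|].
        apply Hf; assumption. }
    assert (HLlin := proj1 HL).
    (* By linearity [L] is near the identity on the whole space, so the surjectivity lemma applies
       to it with a ball as large as the target requires. *)
    assert (HLni : near_identity (fun _ => True) L).
    { intros x y _ _. eapply Rle_trans; [|apply HLid].
      right. apply f_equal. f_equal. symmetry. apply (linear_minus L _ _ HLlin). }
    assert (HLsurj : forall y, exists x, L x = y).
    { intros y.
      destruct (near_identity_surj (fun _ => True) L zero y (2 * norm y + 1)%R HLni)
        as [x [_ Hx]].
      - assert (H := norm_ge_0 y). lra.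
      - auto.
      - assert (E0 : minus y (L zero) = y).
        { eapply eq_trans; [apply f_equal, (linear_zero L HLlin)|apply (minus_zero_r y)]. }
        rewrite E0. lra.
      - exists x. exact Hx. }
    set (J := fun y => proj1_sig (constructive_indefinite_description _ (HLsurj y))).
    assert (HJ : forall y, L (J y) = y).
    { intros y. exact (proj2_sig (constructive_indefinite_description _ (HLsurj y))). }
    assert (HLinj : forall x y, L x = L y -> x = y).
    { intros x y Hxy. apply eq_sym, ball_norm_eq. intros eps. unfold ball_norm.
      eapply Rle_lt_trans; [apply (near_identity_lower _ L _ _ HLni I I)|].
      rewrite Hxy, norm_minus_diag. assert (H := cond_pos eps). lra. }
    assert (HJn : forall y, (norm (J y) <= 2 * norm y)%R).
    { intros y. assert (H := near_identity_lower _ L (J y) zero HLni I I).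
      assert (E1 : minus (J y) zero = J y) by apply (minus_zero_r (J y)).
      assert (E2 : minus (L (J y)) (L zero) = y).
      { eapply eq_trans; [apply f_equal, (linear_zero L HLlin)|].
        eapply eq_trans; [apply (minus_zero_r (L (J y)))|apply HJ]. }
      eapply Rle_trans; [right; apply f_equal, eq_sym, E1|].
      eapply Rle_trans; [exact H|]. right. do 2 apply f_equal. exact E2. }
    assert (HJlin : is_linear J).
    { constructor.
      - intros x y. apply HLinj. rewrite (linear_plus L HLlin), !HJ. reflexivity.
      - intros k x. apply HLinj. rewrite (linear_scal L HLlin), !HJ. reflexivity.
      - exists 2%R. split; [lra|exact HJn]. }
    exists J. apply filterdiff_iff_norm. split; [exact HJlin|]. intros eps.
    destruct (proj1 (filterdiff_iff_norm _ _ _) HL) as [_ Hd].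
    assert (He4 : (0 < eps / 4)%R). { assert (H := cond_pos eps). lra. }
    destruct (Hd (mkposreal _ He4)) as [d Hd']. simpl in Hd'.
    assert (Hm : (0 < Rmin r (d / 2))%R).
    { assert (H1 := cond_pos r). assert (H2 := cond_pos d). apply Rmin_glb_lt; lra. }
    exists (mkposreal _ Hm). simpl. intros q Hq.
    destruct (Hr q (Rlt_le_trans _ _ _ Hq (Rmin_l _ _))) as [x [Hx <-]].
    rewrite !Hg by assumption.
    assert (H1 := near_identity_lower D f x p Hf Hx Hp).
    assert (H2 := Hd' x).
    assert (H3 := Rlt_le_trans _ _ _ Hq (Rmin_r _ _)).
    specialize (H2 ltac:(lra)).
    (* The error of [J] is, up to sign, [J] applied to the error of [L]. The factor 2 from [J] and
       the factor 2 comparing [x - p] with [f x - f p] turn [eps / 4] into [eps]. *)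
    assert (Ex : minus (minus x p) (J (minus (f x) (f p))) =
                 opp (J (minus (minus (f x) (f p)) (L (minus x p))))).
    { apply HLinj. rewrite (linear_minus L _ _ HLlin), HJ, (linear_opp L _ HLlin), HJ.
      symmetry. apply (opp_minus (minus (f x) (f p)) (L (minus x p))). }
    rewrite Ex, norm_opp.
    eapply Rle_trans; [apply HJn|].
    assert (H4 := cond_pos eps). nra.
Qed.

End NearIdentity.

(* The mean value inequality, from the real one applied to the component of
   [f] in the direction of the increment [f b - f a]. *)
Lemma disk_mean_value (f df : C -> C) (c : C) (r k : R) :
  (0 <= k)%R ->
  (forall t, disk c r t -> is_derive (K := C_AbsRing) (V := C_NormedModule) f t (df t) /\
     (Cmod (df t) <= k)%R) ->
  forall a b, disk c r a -> disk c r b -> (Cmod (f b - f a) <= k * Cmod (b - a))%R.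
Proof.
  intros Hk Hf a b Ha Hb.
  set (u := Cconj (f b - f a)).
  set (pt := fun s : R => (a + RtoC s * (b - a))%C).
  assert (Hpt : forall s, (0 <= s <= 1)%R -> disk c r (pt s)).
  { intros s Hs. unfold disk, pt in *.
    replace (a + RtoC s * (b - a) - c)%C
      with (RtoC (1 - s) * (a - c) + RtoC s * (b - c))%C
      by (rewrite RtoC_minus; ring).
    eapply Rle_lt_trans; [apply Cmod_triangle|].
    rewrite !Cmod_mult, !Cmod_R, !Rabs_pos_eq by lra.
    destruct (Req_dec s 0) as [->|Hs0]; [lra|].
    assert (s * Cmod (b - c) < s * r)%R by (apply Rmult_lt_compat_l; lra).
    assert ((1 - s) * Cmod (a - c) <= (1 - s) * r)%R by (apply Rmult_le_compat_l; lra).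
    lra. }
  set (h := fun s : R => fst (u * f (pt s))%C).
  assert (Hh : forall s, (0 <= s <= 1)%R ->
     is_derive h s (fst (u * (df (pt s) * (b - a)))%C)).
  { intros s Hs. destruct (Hf _ (Hpt s Hs)) as [Hd _].
    assert (Hd0 := proj1 (is_derive_C_eps _ _ _) Hd). clear Hd. rename Hd0 into Hd.
    apply (proj2 (filterdiff_iff_norm (K := R_AbsRing)
      (U := AbsRing_NormedModule R_AbsRing) (V := R_NormedModule) h s _)).
    split; [apply is_linear_scal_l|]. intros eps.
    (* A bound for [Cmod u * Cmod (b - a)] that stays positive when [a = b] or [f a = f b]. *)
    set (A := ((Cmod u + 1) * (Cmod (b - a) + 1))%R).
    assert (HA : (0 < A)%R).
    { unfold A. assert (H1 := Cmod_ge_0 u). assert (H2 := Cmod_ge_0 (b - a)). nra. }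
    assert (He : (0 < eps / A)%R) by (apply Rdiv_lt_0_compat; [apply cond_pos|exact HA]).
    destruct (Hd (mkposreal _ He)) as [d Hd']. simpl in Hd'.
    assert (Hdd : (0 < d / (Cmod (b - a) + 1))%R).
    { apply Rdiv_lt_0_compat; [apply cond_pos|]. assert (H := Cmod_ge_0 (b - a)). lra. }
    exists (mkposreal _ Hdd). simpl. intros y Hy.
    change (Rabs (y - s) < d / (Cmod (b - a) + 1))%R in Hy.
    change (Rabs (h y - h s - (y - s) * fst (u * (df (pt s) * (b - a)))%C) <=
      eps * Rabs (y - s))%R.
    assert (Ep : (pt y - pt s = RtoC (y - s) * (b - a))%C).
    { unfold pt. rewrite RtoC_minus. ring. }
    assert (Np : (Cmod (pt y - pt s) = Rabs (y - s) * Cmod (b - a))%R).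
    { rewrite Ep, Cmod_mult, Cmod_R. reflexivity. }
    assert (Hy' : (Cmod (pt y - pt s) < d)%R).
    { rewrite Np. assert (H := Cmod_ge_0 (b - a)). assert (H1 := Rabs_pos (y - s)).
      apply Rmult_lt_compat_r with (r := (Cmod (b - a) + 1)%R) in Hy; [|lra].
      replace (d / (Cmod (b - a) + 1) * (Cmod (b - a) + 1))%R with (pos d) in Hy
        by (field; lra). nra. }
    specialize (Hd' _ Hy'). rewrite Np in Hd'.
    assert (Eh : (h y - h s - (y - s) * fst (u * (df (pt s) * (b - a)))%C)%R =
      fst (u * (f (pt y) - f (pt s) - (pt y - pt s) * df (pt s)))%C).
    { rewrite Ep. unfold h. generalize (f (pt y)) (f (pt s)) (df (pt s)) (b - a)%C.
      intros z1 z2 z3 z4. simpl. ring. }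
    rewrite Eh.
    eapply Rle_trans; [eapply Rle_trans; [apply Rmax_l|apply Rmax_Cmod]|].
    rewrite Cmod_mult.
    assert (H1 := Cmod_ge_0 u). assert (H2 := Cmod_ge_0 (b - a)).
    assert (H3 := Rabs_pos (y - s)).
    eapply Rle_trans.
    { apply Rmult_le_compat_l; [exact H1|exact Hd']. }
    replace (Cmod u * (eps / A * (Rabs (y - s) * Cmod (b - a))))%R
      with (eps * Rabs (y - s) * (Cmod u * Cmod (b - a) / A))%R by (field; lra).
    rewrite <- (Rmult_1_r (eps * Rabs (y - s))) at 2.
    apply Rmult_le_compat_l.
    { apply Rmult_le_pos; [apply Rlt_le, cond_pos|exact H3]. }
    apply Rmult_le_reg_r with A; [exact HA|].
    replace (Cmod u * Cmod (b - a) / A * A)%R with (Cmod u * Cmod (b - a))%R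
      by (field; lra).
    unfold A. nra. }
  destruct (MVT_gen h 0 1 (fun s => fst (u * (df (pt s) * (b - a)))%C)) as [s [Hs Es]].
  { intros s Hs. rewrite Rmin_left, Rmax_right in Hs by lra. apply Hh. lra. }
  { intros s Hs. rewrite Rmin_left, Rmax_right in Hs by lra.
    apply continuity_pt_filterlim.
    apply (ex_derive_continuous (V := R_NormedModule)). eexists. apply Hh. lra. }
  rewrite Rmin_left, Rmax_right in Hs by lra.
  (* As [u] is the conjugate of the increment, the real part of their product is the squared
     modulus; one factor is cancelled at the end. *)
  assert (E : (h 1 - h 0 = (Cmod (f b - f a)) ^ 2)%R).
  { unfold h, pt. replace (a + RtoC 1 * (b - a))%C with b by ring.
    replace (a + RtoC 0 * (b - a))%C with a by ring.
    unfold Cmod. rewrite pow2_sqrt by nra.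
    unfold u. generalize (f a) (f b). intros [x1 y1] [x2 y2]. simpl. ring. }
  rewrite E in Es.
  assert (H1 : (Cmod (f b - f a) ^ 2 <= Cmod (f b - f a) * (k * Cmod (b - a)))%R).
  { rewrite Es. eapply Rle_trans; [apply Rle_abs|].
    replace (1 - 0)%R with 1%R by ring. rewrite Rmult_1_r.
    eapply Rle_trans; [eapply Rle_trans; [apply Rmax_l|apply Rmax_Cmod]|].
    rewrite !Cmod_mult. unfold u. rewrite Cmod_conj.
    apply Rmult_le_compat_l; [apply Cmod_ge_0|].
    apply Rmult_le_compat_r; [apply Cmod_ge_0|].
    apply Hf, Hpt, Hs. }
  destruct (Cmod_ge_0 (f b - f a)) as [H|H].
  - apply Rmult_le_reg_l with (Cmod (f b - f a)); [exact H|]. simpl in H1. lra.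
  - rewrite <- H. apply Rmult_le_pos; [exact Hk|apply Cmod_ge_0].
Qed.

(** * Majorant norms *)

(* [N f M] reads "the norm of [f] is at most [M]", for a Banach algebra norm on
   some class of functions on [S]. *)
Record majorant_norm {X : Type} (S : X -> Prop) (N : (X -> C) -> R -> Prop) : Prop := {
  mn_ext : forall f g M, (forall x, S x -> f x = g x) -> N f M -> N g M;
  mn_le : forall f M M', N f M -> (M <= M')%R -> N f M';
  mn_ge0 : forall f M, N f M -> (0 <= M)%R;
  mn_bound : forall f M, N f M -> forall x, S x -> (Cmod (f x) <= M)%R;
  mn_const : forall c, N (fun _ => c) (Cmod c);
  mn_plus : forall f g M M', N f M -> N g M' -> N (fun x => f x + g x) (M + M')%R;
  mn_mult : forall f g M M', N f M -> N g M' -> N (fun x => f x * g x) (M * M')%R;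
  mn_series : forall (f : nat -> X -> C) b M, (forall n, N (f n) (b n)) ->
    summable_below b M -> N (fun x => Cseries (fun n => f n x)) M }.

(** * The weighted recursion *)

Section Recursion.
Context {K : Ring}.
Variables (h : K) (src d : nat -> K).

(* Coefficients of [e] in terms of those of [m - 1], which are [x].  The index
   shift is by the weight 5 of [b]; the terms [x 0] and [x 1] would be divided
   by [n - 6 <= 0] and are dropped, as they vanish for the solution. *)
Definition e_coef (x : nat -> K) (n : nat) : K :=
  plus (src n)
    match n with
    | S (S (S (S (S (S (S k)))))) => mult (d k) (x (S (S k)))
    | _ => zero
    end.

Definition one_plus (x : nat -> K) (n : nat) : K :=
  plus match n with O => one | S _ => zero end (x n).

(* [m - 1 = - ((m - 1)^2 + e m^2) / 2], which is [m^2 (1 + e) = 1]; [h] is [-1/2],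
   and [1/2] in the majorant series. *)
Definition rec_step (x : nat -> K) (n : nat) : K :=
  mult h (plus (conv x x n) (conv (e_coef x) (conv (one_plus x) (one_plus x)) n)).

(** Iteration from 0 replaces course-of-values recursion: each step settles one more coefficient,
    and bounds pass through a step because it consists of ring operations. *)
Fixpoint rec_iter (j : nat) : nat -> K :=
  match j with O => fun _ => zero | S j => rec_step (rec_iter j) end.

Definition rec_sol (n : nat) : K := rec_iter (S n) n.

Hypothesis src0 : src 0 = zero.

Lemma rec_iter_0 (j : nat) : rec_iter j 0 = zero.
Proof.
  induction j as [|j IH]; [reflexivity|].
  simpl. unfold rec_step, conv at 1 2. rewrite !sum_O. simpl.
  rewrite IH. unfold e_coef. rewrite src0, plus_zero_r, !mult_zero_l, plus_zero_r.
  apply mult_zero_r.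
Qed.

(** Triangularity: in either convolution, a factor [x n] would be paired with [x 0] or with the
    zeroth coefficient of [e], both zero, and inside [e_coef] the index drops by 5. *)
Lemma rec_step_ext (x y : nat -> K) (n : nat) :
  x 0%nat = zero -> y 0%nat = zero -> (forall k, (k < n)%nat -> x k = y k) ->
  rec_step x n = rec_step y n.
Proof.
  intros Hx Hy Hxy. unfold rec_step. f_equal. f_equal.
  - unfold conv. apply sum_n_ext_loc. intros k Hk.
    destruct (Nat.eq_dec k 0) as [->|Hk0]; [now rewrite Hx, Hy, !mult_zero_l|].
    destruct (Nat.eq_dec k n) as [->|Hkn].
    { now rewrite Nat.sub_diag, Hx, Hy, !mult_zero_r. }
    rewrite !Hxy by lia. reflexivity.
  - unfold conv at 1 3. apply sum_n_ext_loc. intros k Hk.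
    destruct k as [|k].
    { unfold e_coef. now rewrite src0, plus_zero_r, !mult_zero_l. }
    f_equal.
    + unfold e_coef. f_equal. do 6 (destruct k as [|k]; [reflexivity|]).
      rewrite Hxy by lia. reflexivity.
    + unfold conv. apply sum_n_ext_loc. intros i Hi. unfold one_plus.
      rewrite !Hxy by lia. reflexivity.
Qed.

Lemma rec_iter_stable (n : nat) : forall i j, (n < i)%nat -> (n < j)%nat ->
  rec_iter i n = rec_iter j n.
Proof.
  induction n as [n IH] using (well_founded_induction Wf_nat.lt_wf).
  intros [|i] [|j] Hi Hj; try lia. simpl.
  apply rec_step_ext; [apply rec_iter_0|apply rec_iter_0|].
  intros k Hk. apply IH; lia.
Qed.

Lemma rec_sol_iter (n j : nat) : (n < j)%nat -> rec_sol n = rec_iter j n.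
Proof. intros H. apply rec_iter_stable; lia. Qed.

Lemma rec_sol_0 : rec_sol 0 = zero.
Proof. apply (rec_iter_0 1). Qed.

Lemma rec_sol_eq (n : nat) : rec_sol n = rec_step rec_sol n.
Proof.
  unfold rec_sol at 1. simpl.
  apply rec_step_ext; [apply rec_iter_0|apply rec_sol_0|].
  intros k Hk. symmetry. apply rec_sol_iter, Hk.
Qed.

End Recursion.

Section RecursionNorm.
Context {X : Type} {S : X -> Prop} {N : (X -> C) -> R -> Prop}.
Hypothesis HN : majorant_norm S N.

Lemma mn_sum_n (f : nat -> X -> C) (b : nat -> R) (n : nat) :
  (forall k, N (f k) (b k)) -> N (fun x => sum_n (fun k => f k x) n) (sum_n b n).
Proof.
  intros H. induction n as [|n IH].
  - rewrite sum_O. eapply (mn_ext _ _ HN); [|apply H].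
    intros x _. exact (eq_sym (sum_O (G := C_AbelianMonoid) (fun k => f k x))).
  - rewrite sum_Sn. eapply (mn_ext _ _ HN); [|apply (mn_plus _ _ HN); [exact IH|apply H]].
    intros x _. exact (eq_sym (sum_Sn (G := C_AbelianMonoid) (fun k => f k x) n)).
Qed.

Lemma mn_conv (f g : nat -> X -> C) (b c : nat -> R) (n : nat) :
  (forall k, N (f k) (b k)) -> (forall k, N (g k) (c k)) ->
  N (fun x => conv (K := C_Ring) (fun k => f k x) (fun k => g k x) n)
    (conv (K := R_Ring) b c n).
Proof.
  intros Hf Hg. unfold conv.
  apply (mn_sum_n (fun k x => f k x * g (n - k)%nat x)). intros k.
  apply (mn_mult _ _ HN); auto.
Qed.

Lemma mn_zero : N (fun _ => RtoC 0) 0%R.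
Proof.
  apply (mn_le _ _ HN _ (Cmod 0)); [apply (mn_const _ _ HN)|right; apply Cmod_0].
Qed.

Lemma mn_one : N (fun _ => RtoC 1) 1%R.
Proof.
  apply (mn_le _ _ HN _ (Cmod 1)); [apply (mn_const _ _ HN)|right; apply Cmod_1].
Qed.

Variables (h : C) (src d : nat -> X -> C) (srcM dM : nat -> R).
Hypothesis Hsrc : forall n, N (src n) (srcM n).
Hypothesis Hd : forall n, N (d n) (dM n).

Lemma mn_e_coef (f : nat -> X -> C) (b : nat -> R) (n : nat) :
  (forall k, N (f k) (b k)) ->
  N (fun x => e_coef (K := C_Ring) (fun k => src k x) (fun k => d k x) (fun k => f k x) n)
    (e_coef (K := R_Ring) srcM dM b n).
Proof.
  intros Hf. unfold e_coef. apply (mn_plus _ _ HN); [apply Hsrc|].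
  do 7 (destruct n as [|n]; [apply mn_zero|]).
  apply (mn_mult _ _ HN); auto.
Qed.

(** An iterate is a finite expression in [h], [src] and [d]; the same expression in their bounds
    majorizes it, whatever the Banach algebra norm. *)
Lemma mn_rec_iter (j : nat) : forall n,
  N (fun x => rec_iter (K := C_Ring) h (fun k => src k x) (fun k => d k x) j n)
    (rec_iter (K := R_Ring) (Cmod h) srcM dM j n).
Proof.
  induction j as [|j IH]; intros n; [apply mn_zero|].
  simpl. unfold rec_step.
  apply (mn_mult _ _ HN); [apply (mn_const _ _ HN)|].
  apply (mn_plus _ _ HN); [apply mn_conv; exact IH|].
  apply mn_conv; [intros k; now apply mn_e_coef|].
  assert (H1 : forall k, N (fun x => one_plus (K := C_Ring)
     (rec_iter (K := C_Ring) h (fun k => src k x) (fun k => d k x) j) k)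
     (one_plus (K := R_Ring) (rec_iter (K := R_Ring) (Cmod h) srcM dM j) k)).
  { intros k. unfold one_plus. apply (mn_plus _ _ HN); [|apply IH].
    destruct k; [apply mn_one|apply mn_zero]. }
  intros k. apply mn_conv; exact H1.
Qed.

End RecursionNorm.

(** * Summability of the real majorant recursion *)

Section RealRecursion.

Lemma conv_ge0 (x y : nat -> R) (n : nat) :
  (forall k, 0 <= x k)%R -> (forall k, 0 <= y k)%R -> (0 <= conv (K := R_Ring) x y n)%R.
Proof.
  intros Hx Hy. unfold conv. rewrite sum_n_Reals.
  apply cond_pos_sum. intros k. apply Rmult_le_pos; auto.
Qed.

(** The index pairs [(i, j)] with [i + j <= K] are summed by rows, and row [i] is at most
    [x i * B]. *)
Lemma sum_conv_le (x y : nat -> R) (A B : R) (K : nat) :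
  summable_below x A -> summable_below y B ->
  (sum_n (conv (K := R_Ring) x y) K <= A * B)%R.
Proof.
  intros [Hx HA] [Hy HB].
  assert (H : (sum_n (conv (K := R_Ring) x y) K <=
     sum_n (fun k => x k * sum_n y (K - k))%R K)%R).
  { right. clear HA HB Hx Hy. induction K as [|K IH].
    - unfold conv. rewrite !sum_O. reflexivity.
    - assert (E1 : conv (K := R_Ring) x y (S K) =
        (sum_n (fun k => x k * y (S K - k)%nat)%R K + x (S K) * y 0%nat)%R).
      { unfold conv. rewrite sum_Sn, Nat.sub_diag. reflexivity. }
      assert (E2 : sum_n (fun k => x k * sum_n y (S K - k))%R (S K) =
        (sum_n (fun k => x k * sum_n y (S K - k))%R K + x (S K) * y 0%nat)%R).
      { rewrite sum_Sn, Nat.sub_diag, sum_O. reflexivity. }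
      assert (E3 : sum_n (fun k => x k * sum_n y (S K - k))%R K =
        (sum_n (fun k => x k * sum_n y (K - k))%R K +
         sum_n (fun k => x k * y (S K - k)%nat)%R K)%R).
      { eapply eq_trans; [|exact (sum_n_plus (G := R_AbelianMonoid) _ _ K)].
        apply sum_n_ext_loc. intros k Hk.
        replace (S K - k)%nat with (S (K - k)) by lia.
        rewrite sum_Sn. apply Rmult_plus_distr_l. }
      rewrite sum_Sn, IH, E1, E2, E3. apply eq_sym, Rplus_assoc. }
  eapply Rle_trans; [exact H|].
  assert (HB0 : (0 <= B)%R) by (apply (summable_below_ge0 y B); split; assumption).
  apply Rle_trans with (sum_n (fun k => x k * B)%R K).
  - rewrite !sum_n_Reals. apply sum_Rle. intros k _.
    apply Rmult_le_compat_l; auto.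
  - rewrite sum_n_Rmult_r. apply Rmult_le_compat_r; auto.
Qed.

Lemma summable_below_conv (x y : nat -> R) (A B : R) :
  summable_below x A -> summable_below y B ->
  summable_below (conv (K := R_Ring) x y) (A * B).
Proof.
  intros Hx Hy. split.
  - intros n. apply conv_ge0; [apply Hx|apply Hy].
  - intros K. now apply sum_conv_le.
Qed.

Lemma summable_below_plus (x y : nat -> R) (A B : R) :
  summable_below x A -> summable_below y B ->
  summable_below (fun n => x n + y n)%R (A + B).
Proof.
  intros [Hx HA] [Hy HB]. split.
  - intros n. specialize (Hx n). specialize (Hy n). lra.
  - intros K. eapply Rle_trans; [right; exact (sum_n_plus (G := R_AbelianMonoid) _ _ K)|].
    specialize (HA K). specialize (HB K). unfold plus; simpl. lra.
Qed.

Lemma summable_below_scal (x : nat -> R) (A c : R) :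
  (0 <= c)%R -> summable_below x A -> summable_below (fun n => c * x n)%R (c * A).
Proof.
  intros Hc [Hx HA]. split.
  - intros n. apply Rmult_le_pos; auto.
  - intros K. eapply Rle_trans; [right; exact (sum_n_mult_l (K := R_Ring) c x K)|].
    apply Rmult_le_compat_l; auto.
Qed.

Lemma summable_below_indicator0 : summable_below (fun n => match n with O => 1 | S _ => 0 end)%R 1.
Proof.
  split; [intros [|n]; lra|]. intros K. right. induction K as [|K IH].
  - now rewrite sum_O.
  - rewrite sum_Sn, IH. unfold plus; simpl. ring.
Qed.

Variables (srcM dM : nat -> R) (E0 beta : R).
Hypothesis Hsrc : summable_below srcM E0.
Hypothesis Hd : forall n, (0 <= dM n <= beta)%R.

Lemma summable_below_e_coef (x : nat -> R) (A : R) :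
  summable_below x A ->
  summable_below (e_coef (K := R_Ring) srcM dM x) (E0 + beta * A).
Proof.
  intros Hx. unfold e_coef.
  apply (summable_below_plus srcM (fun n => match n with
    | S (S (S (S (S (S (S k)))))) => mult (dM k) (x (S (S k)))
    | _ => zero end) E0 (beta * A)%R Hsrc).
  destruct Hx as [Hx HA].
  assert (Hb : (0 <= beta)%R) by (specialize (Hd 0%nat); lra).
  assert (HA0 : (0 <= A)%R) by (apply (summable_below_ge0 x); split; assumption).
  set (y := fun n => match n with
    | S (S (S (S (S (S (S k)))))) => mult (dM k) (x (S (S k)))
    | _ => zero end).
  assert (Hy : forall n, (0 <= y n)%R).
  { intros n. unfold y. do 7 (destruct n as [|n]; [right; reflexivity|]).
    apply Rmult_le_pos; [apply Hd|apply Hx]. }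
  split; [exact Hy|]. intros K.
  (* The shift by 5 pairs [y (K + 7)] with [x (K + 2)]. Lengthening both ranges lets the induction
     start at [y 7 = dM 0 * x 2], the first term not zero by definition. *)
  apply Rle_trans with (sum_n y (K + 7)).
  { apply sum_n_incr_le; [exact Hy|lia]. }
  apply Rle_trans with (beta * sum_n x (K + 2))%R.
  2: { apply Rmult_le_compat_l; auto. }
  induction K as [|K IH].
  - simpl Nat.add. rewrite !sum_Sn, !sum_O. unfold plus, y, zero, mult; simpl.
    assert (H0 := Hx 0%nat). assert (H1 := Hx 1%nat). assert (H2 := Hx 2%nat).
    assert (H3 := Hd 0%nat). nra.
  - simpl Nat.add in *. rewrite (sum_Sn y), (sum_Sn x).
    replace (y (S (K + 7))) with (dM (S K) * x (S (K + 2)))%R.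
    2: { replace (S (K + 7)) with (S (S (S (S (S (S (S (S K)))))))) by lia.
         replace (S (K + 2)) with (S (S (S K))) by lia. reflexivity. }
    unfold plus; simpl. assert (H0 := Hx (S (K + 2))). assert (H1 := Hd (S K)). nra.
Qed.

Variable tau : R.
Hypothesis Htau : (0 <= tau)%R.
Hypothesis Hfix : (/ 2 * (tau * tau + (E0 + beta * tau) * ((1 + tau) * (1 + tau))) <= tau)%R.

(** Summed over all degrees, the recursion becomes a scalar map increasing in its argument. [Hfix]
    says that [tau] is a supersolution of it, so iteration from 0 stays below [tau]. *)
Lemma summable_below_rec_iter (j : nat) :
  summable_below (rec_iter (K := R_Ring) (/ 2)%R srcM dM j) tau.
Proof.
  induction j as [|j IH].
  - simpl. split; [intros n; right; reflexivity|]. intros K.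
    eapply Rle_trans; [right|exact Htau]. induction K as [|K IH].
    + apply sum_O.
    + rewrite sum_Sn, IH. apply Rplus_0_l.
  - simpl. unfold rec_step.
    assert (H1 : summable_below (one_plus (K := R_Ring)
              (rec_iter (K := R_Ring) (/ 2)%R srcM dM j)) (1 + tau)).
    { apply summable_below_plus; [apply summable_below_indicator0|exact IH]. }
    assert (H := summable_below_scal _ _ (/ 2)%R ltac:(lra)
      (summable_below_plus _ _ _ _ (summable_below_conv _ _ _ _ IH IH)
        (summable_below_conv _ _ _ _ (summable_below_e_coef _ _ IH)
          (summable_below_conv _ _ _ _ H1 H1)))).
    destruct H as [Ha Hb]. split; [exact Ha|].
    intros K. eapply Rle_trans; [apply Hb|exact Hfix].
Qed.

(** Up to degree [K] the solution coincides with the iterate of index [S K], so each of its partial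
    sums is one of an iterate. *)
Lemma summable_below_rec_sol :
  srcM 0%nat = 0%R -> summable_below (rec_sol (K := R_Ring) (/ 2)%R srcM dM) tau.
Proof.
  intros Hs0. split.
  - intros n. apply (summable_below_rec_iter (S n)).
  - intros K. eapply Rle_trans; [|apply (summable_below_rec_iter (S K)) with (K := K)].
    right. apply sum_n_ext_loc. intros n Hn. apply rec_sol_iter; [exact Hs0|lia].
Qed.

End RealRecursion.

Lemma epsilon_choice {A B : Type} (P : A -> B -> Prop) :
  (forall x, exists y, P x y) -> exists f : A -> B, forall x, P x (f x).
Proof.
  intros H.
  exists (fun x => proj1_sig (constructive_indefinite_description _ (H x))).
  intros x. exact (proj2_sig (constructive_indefinite_description _ (H x))).
Qed.

Lemma is_series_ge_sum (b : nat -> R) (l : R) (n : nat) :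
  (forall k, 0 <= b k)%R -> is_series b l -> (sum_n b n <= l)%R.
Proof.
  intros Hb Hl. apply (is_lim_seq_incr_compare (sum_n b) l Hl).
  intros m. apply sum_n_incr_le; auto.
Qed.

Lemma is_series_le_bound (b : nat -> R) (l M : R) :
  is_series b l -> (forall n, (sum_n b n <= M)%R) -> (l <= M)%R.
Proof.
  intros Hl HM.
  exact (is_lim_seq_le (sum_n b) (fun _ => M) l M HM Hl (is_lim_seq_const M)).
Qed.

Lemma summable_below_Series (b : nat -> R) (M : R) :
  summable_below b M -> summable_below b (Series b) /\ (Series b <= M)%R.
Proof.
  intros H. assert (Hs := Series_correct b (summable_below_ex_series b M H)).
  destruct H as [Hb HM]. split; [split; [exact Hb|]|].
  - intros K. now apply is_series_ge_sum.
  - now apply (is_series_le_bound b).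
Qed.

Lemma summable_below_le (b c : nat -> R) (M : R) :
  (forall n, 0 <= b n <= c n)%R -> summable_below c M -> summable_below b M.
Proof.
  intros Hbc [Hc HM]. split; [intros n; apply Hbc|].
  intros K. eapply Rle_trans; [|apply (HM K)].
  rewrite !sum_n_Reals. apply sum_Rle. intros n _. apply Hbc.
Qed.

(** The exact sums serve as [M0] and [M1], so that their weighted combination does not exceed [M].
    This is how series are summed in a norm made of two weighted parts. *)
Lemma summable_below_weighted (b0 b1 : nat -> R) (c M : R) :
  (0 < c)%R -> (forall n, 0 <= b0 n)%R -> (forall n, 0 <= b1 n)%R ->
  summable_below (fun n => b0 n + c * b1 n)%R M ->
  exists M0 M1, summable_below b0 M0 /\ summable_below b1 M1 /\ (M0 + c * M1 <= M)%R.
Proof.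
  intros Hc H0 H1 H.
  assert (S0 : summable_below b0 M).
  { apply (summable_below_le _ (fun n => b0 n + c * b1 n)%R); [|exact H].
    intros n. specialize (H0 n). specialize (H1 n). nra. }
  assert (S1' : summable_below (fun n => c * b1 n)%R M).
  { apply (summable_below_le _ (fun n => b0 n + c * b1 n)%R); [|exact H].
    intros n. specialize (H0 n). specialize (H1 n). nra. }
  assert (S1 : summable_below b1 (/ c * M)%R).
  { apply (summable_below_le _ (fun n => / c * (c * b1 n))%R).
    - intros n. rewrite <- Rmult_assoc, Rinv_l, Rmult_1_l by lra.
      specialize (H1 n). lra.
    - apply summable_below_scal; [|exact S1']. apply Rlt_le, Rinv_0_lt_compat, Hc. }
  exists (Series b0), (Series b1).
  split; [apply (summable_below_Series _ _ S0)|].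
  split; [apply (summable_below_Series _ _ S1)|].
  rewrite <- Series_scal_l, <- Series_plus.
  - apply (summable_below_Series _ _ H).
  - exact (summable_below_ex_series _ _ S0).
  - exact (summable_below_ex_series _ _ S1').
Qed.

(** * Instances of the norm: Lipschitz functions, power series, slices, pairs *)

Section LipschitzNorm.
Context {U : NormedModule C_AbsRing}.
Variables (S : U -> Prop) (sigma : R).
Hypothesis (HS : open S) (Hsigma : (0 < sigma)%R).

(** Sup bound plus [sigma] times a Lipschitz constant is submultiplicative, since a product has
    Lipschitz constant [b0 b1' + b1 b0']. Differentiability survives infinite sums because the
    difference quotients are dominated by the summable Lipschitz constants. *)
Definition lip_norm (f : U -> C) (M : R) : Prop :=
  exists b0 b1, (0 <= b0)%R /\ (0 <= b1)%R /\ (b0 + sigma * b1 <= M)%R /\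
    (forall x, S x -> (Cmod (f x) <= b0)%R) /\
    (forall x y, S x -> S y -> (Cmod (f y - f x) <= b1 * norm (minus y x))%R) /\
    (forall x, S x -> ex_filterdiff (V := C_NormedModule) f (locally x)).

Lemma lip_norm_lip (f : U -> C) (M : R) (x y : U) :
  lip_norm f M -> S x -> S y -> (Cmod (f y - f x) <= M / sigma * norm (minus y x))%R.
Proof.
  intros (b0 & b1 & H0 & H1 & HM & _ & Hl & _) Hx Hy.
  eapply Rle_trans; [apply Hl; assumption|].
  apply Rmult_le_compat_r; [apply norm_ge_0|].
  apply Rmult_le_reg_r with sigma; [exact Hsigma|].
  replace (M / sigma * sigma)%R with M by (field; lra). lra.
Qed.

Lemma lip_norm_diff (f : U -> C) (M : R) (x : U) :
  lip_norm f M -> S x -> ex_filterdiff (V := C_NormedModule) f (locally x).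
Proof. intros (b0 & b1 & _ & _ & _ & _ & _ & H) Hx. now apply H. Qed.

Lemma majorant_lip_norm : majorant_norm S lip_norm.
Proof.
  constructor.
  - intros f g M Hfg (b0 & b1 & H0 & H1 & HM & Hb & Hl & Hd).
    exists b0, b1. repeat split; auto.
    + intros x Hx. rewrite <- Hfg by assumption. auto.
    + intros x y Hx Hy. rewrite <- !Hfg by assumption. auto.
    + intros x Hx. destruct (Hd x Hx) as [l Hl']. exists l.
      eapply (filterdiff_ext_locally (V := C_NormedModule) f); [|exact Hl'].
      eapply filter_imp; [|exact (HS x Hx)]. intros y Hy. now apply Hfg.
  - intros f M M' (b0 & b1 & H0 & H1 & HM & H) HMM'.
    exists b0, b1. split; [exact H0|split; [exact H1|split; [lra|exact H]]].
  - intros f M (b0 & b1 & H0 & H1 & HM & _). nra.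
  - intros f M (b0 & b1 & H0 & H1 & HM & Hb & _) x Hx.
    specialize (Hb x Hx). nra.
  - intros c. exists (Cmod c), 0%R. repeat split.
    + apply Cmod_ge_0.
    + lra.
    + lra.
    + intros x _. lra.
    + intros x y _ _. unfold Cminus. rewrite Cplus_opp_r, Cmod_0. lra.
    + intros x _. eexists. apply filterdiff_const.
  - intros f g M M' (b0 & b1 & H0 & H1 & HM & Hb & Hl & Hd)
      (b0' & b1' & H0' & H1' & HM' & Hb' & Hl' & Hd').
    exists (b0 + b0')%R, (b1 + b1')%R. repeat split.
    + lra.
    + lra.
    + nra.
    + intros x Hx. eapply Rle_trans; [apply Cmod_triangle|].
      specialize (Hb x Hx). specialize (Hb' x Hx). lra.
    + intros x y Hx Hy. specialize (Hl x y Hx Hy). specialize (Hl' x y Hx Hy).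
      replace (f y + g y - (f x + g x))%C with ((f y - f x) + (g y - g x))%C by ring.
      eapply Rle_trans; [apply Cmod_triangle|]. lra.
    + intros x Hx. destruct (Hd x Hx) as [l L]. destruct (Hd' x Hx) as [l' L'].
      eexists. exact (filterdiff_Cplus f g x l l' L L').
  - intros f g M M' (b0 & b1 & H0 & H1 & HM & Hb & Hl & Hd)
      (b0' & b1' & H0' & H1' & HM' & Hb' & Hl' & Hd').
    exists (b0 * b0')%R, (b0 * b1' + b1 * b0')%R. repeat split.
    + nra.
    + assert (0 <= b0 * b1')%R by nra. assert (0 <= b1 * b0')%R by nra. lra.
    + apply Rle_trans with ((b0 + sigma * b1) * (b0' + sigma * b1'))%R.
      * assert (0 <= (sigma * b1) * (sigma * b1'))%R.
        { apply Rmult_le_pos; apply Rmult_le_pos; lra. } lra.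
      * apply Rmult_le_compat; try lra; nra.
    + intros x Hx. rewrite Cmod_mult.
      apply Rmult_le_compat; auto; apply Cmod_ge_0.
    + intros x y Hx Hy. specialize (Hl x y Hx Hy). specialize (Hl' x y Hx Hy).
      replace (f y * g y - f x * g x)%C
        with (f y * (g y - g x) + (f y - f x) * g x)%C by ring.
      eapply Rle_trans; [apply Cmod_triangle|]. rewrite !Cmod_mult, Rmult_plus_distr_r.
      apply Rplus_le_compat.
      * rewrite Rmult_assoc. apply Rmult_le_compat; auto; apply Cmod_ge_0.
      * replace (b1 * b0' * norm (minus y x))%R with (b1 * norm (minus y x) * b0')%R by ring.
        apply Rmult_le_compat; auto; apply Cmod_ge_0.
    + intros x Hx. destruct (Hd x Hx) as [l L]. destruct (Hd' x Hx) as [l' L'].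
      eexists. exact (filterdiff_Cmult f g x l l' L L').
  - intros f b M Hf Hb.
    destruct (epsilon_choice _ Hf) as [b0 Hf0].
    destruct (epsilon_choice _ Hf0) as [b1 Hf1]. clear Hf Hf0.
    destruct (summable_below_weighted b0 b1 sigma M Hsigma) as (M0 & M1 & S0 & S1 & HM).
    { intros n. apply Hf1. }
    { intros n. apply Hf1. }
    { apply (summable_below_le _ b); [|exact Hb]. intros n.
      destruct (Hf1 n) as (H0 & H1 & H2 & _). split; [nra|exact H2]. }
    assert (Hbd : forall x, S x -> forall n, (Cmod (f n x) <= b0 n)%R).
    { intros x Hx n. now apply Hf1. }
    exists M0, M1. repeat split.
    + exact (summable_below_ge0 _ _ S0).
    + exact (summable_below_ge0 _ _ S1).
    + exact HM.
    + intros x Hx. apply (Cseries_bound _ _ _ S0). now apply Hbd.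
    + intros x y Hx Hy.
      assert (E : Cseries (fun n => f n y - f n x) =
        Cseries (fun n => f n y) - Cseries (fun n => f n x)).
      { apply Cseries_unique, (is_series_minus (V := C_NormedModule));
          apply (Cseries_correct _ _ _ S0); now apply Hbd. }
      rewrite <- E.
      apply (Cseries_bound _ (fun n => b1 n * norm (minus y x))%R).
      * apply summable_below_scal_r; [apply norm_ge_0|exact S1].
      * intros n. now apply Hf1.
    + intros x Hx.
      destruct (epsilon_choice (fun n D => filterdiff (V := C_NormedModule) (f n) (locally x) D))
        as [D HD].
      { intros n. now apply Hf1. }
      eexists. apply (filterdiff_Cseries f D b1 b0 M1 M0 x S1 S0 HD).
      eapply filter_imp; [|exact (HS x Hx)]. intros y Hy n.
      split; [now apply Hbd|now apply Hf1].
Qed.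

End LipschitzNorm.

Section PowerSeriesNorm.
Variables (S : C -> Prop) (r : R).
Hypothesis (Hr : (0 < r)%R) (HS : forall v, S v -> (Cmod v <= r)%R).

(** The weighted l1 norm of Taylor coefficients at radius [r]; existential in the coefficients,
    since a general [S] does not determine them. *)
Definition ps_norm (f : C -> C) (M : R) : Prop :=
  exists a : nat -> C, summable_below (fun n => Cmod (a n) * r ^ n)%R M /\
    forall v, S v -> is_series (K := C_AbsRing) (V := C_NormedModule)
      (fun n => a n * v ^ n) (f v).

Lemma Cmod_pow (v : C) (n : nat) : Cmod (v ^ n) = (Cmod v ^ n)%R.
Proof.
  induction n as [|n IH]; [apply Cmod_1|].
  simpl. now rewrite Cmod_mult, IH.
Qed.

Lemma ps_term_le (a : nat -> C) (v : C) (n : nat) :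
  S v -> (Cmod (a n * v ^ n) <= Cmod (a n) * r ^ n)%R.
Proof.
  intros Hv. rewrite Cmod_mult, Cmod_pow.
  apply Rmult_le_compat_l; [apply Cmod_ge_0|].
  apply pow_incr. split; [apply Cmod_ge_0|now apply HS].
Qed.

Lemma is_series_sum_n (a : nat -> nat -> C) (l : nat -> C) (n : nat) :
  (forall m, is_series (K := C_AbsRing) (V := C_NormedModule) (a m) (l m)) ->
  is_series (K := C_AbsRing) (V := C_NormedModule)
    (fun k => sum_n (fun m => a m k) n) (sum_n l n).
Proof.
  intros H. induction n as [|n IH].
  - rewrite sum_O. eapply is_series_ext; [|apply (H 0%nat)].
    intros k. exact (eq_sym (sum_O (G := C_AbelianMonoid) (fun m => a m k))).
  - rewrite sum_Sn.
    eapply is_series_ext; [|apply (is_series_plus (V := C_NormedModule)); [exact IH|apply (H (Datatypes.S n))]].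
    intros k. exact (eq_sym (sum_Sn (G := C_AbelianMonoid) (fun m => a m k) n)).
Qed.

(** A rearrangement of a double series: the coefficient of [v ^ n] is the sum of column [n], which
    converges because [Cmod (a m n) * r ^ n <= B m]. *)
Lemma ps_norm_series (f : nat -> C -> C) (B : nat -> R) (M : R) :
  (forall n, ps_norm (f n) (B n)) -> summable_below B M ->
  ps_norm (fun v => Cseries (fun n => f n v)) M.
Proof.
  intros Hf HB. destruct (epsilon_choice _ Hf) as [a Ha]. clear Hf.
  assert (Hrn : forall n, (0 < r ^ n)%R) by (intros n; now apply pow_lt).
  assert (Hfm : forall v, S v -> forall m, (Cmod (f m v) <= B m)%R).
  { intros v Hv m. destruct (Ha m) as [H1 H2].
    rewrite <- (Cseries_unique _ _ (H2 v Hv)).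
    apply (Cseries_bound _ _ _ H1). intros n. now apply ps_term_le. }
  assert (Hcol : forall n, summable_below (fun m => Cmod (a m n)) (M * / r ^ n)).
  { intros n. apply (summable_below_le _ (fun m => / r ^ n * B m)%R).
    - intros m. split; [apply Cmod_ge_0|]. destruct (Ha m) as [H1 _].
      apply (summable_below_term _ _ n) in H1.
      apply Rmult_le_reg_l with (r ^ n)%R; [apply Hrn|].
      rewrite <- Rmult_assoc, Rinv_r, Rmult_1_l by (apply Rgt_not_eq, Hrn). lra.
    - rewrite Rmult_comm. apply summable_below_scal; [|exact HB].
      apply Rlt_le, Rinv_0_lt_compat, Hrn. }
  set (A := fun n => Cseries (fun m => a m n)).
  exists A. split.
  - split.
    { intros n. apply Rmult_le_pos; [apply Cmod_ge_0|apply Rlt_le, Hrn]. }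
    intros K.
    (* With finitely many columns, the sum over columns commutes with the series over rows, and row
       [m] contributes at most [B m]. *)
    assert (HS' : is_series (fun m => sum_n (fun n => Cmod (a m n) * r ^ n)%R K)
      (sum_n (fun n => Series (fun m => Cmod (a m n)) * r ^ n)%R K)).
    { induction K as [|K IH].
      - rewrite sum_O. eapply is_series_ext.
        2: { apply (is_series_scal_r (r ^ 0)), Series_correct.
             exact (summable_below_ex_series _ _ (Hcol 0%nat)). }
        intros m. rewrite sum_O. reflexivity.
      - rewrite sum_Sn. eapply is_series_ext.
        2: { apply (is_series_plus (V := R_NormedModule)); [exact IH|].
             apply (is_series_scal_r (r ^ (Datatypes.S K))), Series_correct.
             exact (summable_below_ex_series _ _ (Hcol (Datatypes.S K))). }
        intros m. rewrite sum_Sn. reflexivity. }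
    apply Rle_trans with (sum_n (fun n => Series (fun m => Cmod (a m n)) * r ^ n)%R K).
    { rewrite !sum_n_Reals. apply sum_Rle. intros n _.
      apply Rmult_le_compat_r; [apply Rlt_le, Hrn|].
      apply (Cseries_bound _ (fun m => Cmod (a m n))); [|intros m; lra].
      apply (summable_below_Series _ _ (Hcol n)). }
    apply (is_series_le_bound _ _ M HS'). intros m.
    eapply Rle_trans; [|apply (proj2 HB m)].
    rewrite !(sum_n_Reals _ m). apply sum_Rle. intros k _. apply (proj1 (Ha k)).
  - intros v Hv. apply is_series_C_iff. intros eps He.
    (* Rows beyond [m0] contribute at most [eps / 4] both to the full sum and to the sum truncated
       at degree [n]; the finitely many other rows converge as [n] grows. *)
    destruct (summable_below_tail B M (eps / 4)%R HB ltac:(lra)) as [m0 Hm0].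
    assert (H1 := Cseries_tail _ _ _ HB (Hfm v Hv) m0 _ Hm0).
    assert (H2 := is_series_sum_n (fun m n => a m n * v ^ n) (fun m => f m v) m0
                    (fun m => proj2 (Ha m) v Hv)).
    destruct (proj1 (is_series_C_iff _ _) H2 (eps / 4)%R ltac:(lra)) as [n0 Hn0].
    exists n0. intros n Hn. specialize (Hn0 n Hn).
    assert (E : sum_n (fun k => A k * v ^ k) n =
                Cseries (fun m => sum_n (fun k => a m k * v ^ k) n)).
    { symmetry. apply Cseries_unique.
      eapply is_series_ext.
      2: { apply (is_series_sum_n (fun k m => a m k * v ^ k) (fun k => A k * v ^ k) n).
           intros k. unfold A.
           eapply is_series_ext.
           2: { rewrite Cmult_comm. apply (is_series_scal (V := C_NormedModule) (v ^ k)).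
                apply (Cseries_correct _ _ _ (Hcol k)). intros m. lra. }
           intros m. apply Cmult_comm. }
      reflexivity. }
    rewrite E.
    assert (H3 : (Cmod (Cseries (fun m => sum_n (fun k => a m k * v ^ k)%C n) -
        sum_n (fun m => sum_n (fun k => a m k * v ^ k)%C n) m0) <= eps / 4)%R).
    { apply (Cseries_tail _ _ _ HB); [|exact Hm0]. intros m.
      eapply Rle_trans; [apply Cmod_sum_n|].
      eapply Rle_trans; [|apply (proj2 (proj1 (Ha m)) n)].
      rewrite !sum_n_Reals. apply sum_Rle. intros k _. now apply ps_term_le. }
    rewrite (sum_n_switch (G := C_AbelianMonoid) (fun m k => a m k * v ^ k) m0 n) in H3.
    revert H1 Hn0 H3.
    generalize (Cseries (fun n1 => f n1 v)) (sum_n (fun m => f m v) m0)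
      (Cseries (fun m => sum_n (fun k => a m k * v ^ k) n)).
    intros F Fm G.
    change (sum_n (G := C_AbelianMonoid) (fun j => sum_n (fun i => a i j * v ^ j) m0) n)
      with (sum_n (fun k => sum_n (fun m => a m k * v ^ k) m0) n).
    generalize (sum_n (fun k => sum_n (fun m => a m k * v ^ k) m0) n).
    intros Q H1 H3 H4.
    replace (G - F)%C with ((G - Q) + (Q - Fm) + - (F - Fm))%C by ring.
    eapply Rle_lt_trans; [apply Cmod_triangle|]. rewrite Cmod_opp.
    assert (H5 := Cmod_triangle (G - Q) (Q - Fm)). lra.
Qed.

Lemma majorant_ps_norm : majorant_norm S ps_norm.
Proof.
  constructor.
  - intros f g M Hfg (a & Ha & Hs). exists a. split; [exact Ha|].
    intros v Hv. rewrite <- Hfg by assumption. auto.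
  - intros f M M' (a & [H1 H2] & Hs) HM. exists a. split; [|exact Hs].
    split; [exact H1|]. intros K. specialize (H2 K). lra.
  - intros f M (a & Ha & _). exact (summable_below_ge0 _ _ Ha).
  - intros f M (a & Ha & Hs) v Hv. rewrite <- (Cseries_unique _ _ (Hs v Hv)).
    apply (Cseries_bound _ _ _ Ha). intros n. now apply ps_term_le.
  - intros c. exists (fun n => match n with O => c | Datatypes.S _ => 0 end).
    assert (E1 : forall K, sum_n (fun n => Cmod match n with O => c | Datatypes.S _ => 0 end * r ^ n)%R K = Cmod c).
    { induction K as [|K IH].
      - rewrite sum_O. simpl. ring.
      - rewrite sum_Sn, IH, Cmod_0, Rmult_0_l. apply Rplus_0_r. }
    split.
    + split.
      * intros n. apply Rmult_le_pos; [apply Cmod_ge_0|apply pow_le; lra].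
      * intros K. rewrite E1. lra.
    + intros v _. apply is_series_C_iff. intros eps He. exists 0%nat. intros n _.
      replace (sum_n (fun n => match n with O => c | Datatypes.S _ => 0 end * v ^ n) n)%C with c.
      * unfold Cminus. now rewrite Cplus_opp_r, Cmod_0.
      * induction n as [|n IH].
        -- rewrite sum_O. simpl. ring.
        -- rewrite sum_Sn, <- IH. unfold plus; simpl. ring.
  - intros f g M M' (a & Ha & Hs) (a' & Ha' & Hs').
    exists (fun n => a n + a' n). split.
    + apply (summable_below_le _ (fun n => Cmod (a n) * r ^ n + Cmod (a' n) * r ^ n)%R).
      * intros n. assert (Hrn : (0 < r ^ n)%R) by now apply pow_lt.
        split; [apply Rmult_le_pos; [apply Cmod_ge_0|lra]|].
        rewrite <- Rmult_plus_distr_r. apply Rmult_le_compat_r; [lra|apply Cmod_triangle].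
      * now apply summable_below_plus.
    + intros v Hv. eapply is_series_ext.
      2: { apply (is_series_plus (V := C_NormedModule)); [apply Hs, Hv|apply Hs', Hv]. }
      intros n. symmetry. apply Cmult_plus_distr_r.
  - intros f g M M' (a & Ha & Hs) (a' & Ha' & Hs').
    exists (conv (K := C_Ring) a a'). split.
    + apply (summable_below_le _ (conv (K := R_Ring) (fun n => Cmod (a n) * r ^ n)%R
        (fun n => Cmod (a' n) * r ^ n)%R)).
      * intros n. assert (Hrn : (0 < r ^ n)%R) by now apply pow_lt.
        split; [apply Rmult_le_pos; [apply Cmod_ge_0|lra]|].
        unfold conv.
        apply Rle_trans with (sum_n (fun k => Cmod (a k * a' (n - k)%nat)) n * r ^ n)%R.
        { apply Rmult_le_compat_r; [lra|apply Cmod_sum_n]. }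
        rewrite <- sum_n_Rmult_r. right. apply sum_n_ext_loc. intros k Hk.
        rewrite Cmod_mult. replace (r ^ n)%R with (r ^ k * r ^ (n - k))%R.
        -- unfold mult; simpl. ring.
        -- rewrite <- pow_add. f_equal. lia.
      * now apply summable_below_conv.
    + intros v Hv. eapply is_series_ext.
      2: { apply (is_series_conv (fun n => a n * v ^ n) (fun n => a' n * v ^ n) _ _ _ _ _ _ Ha Ha').
           - intros n. now apply ps_term_le.
           - intros n. now apply ps_term_le.
           - apply Hs, Hv.
           - apply Hs', Hv. }
      intros n. unfold conv.
      rewrite Cmult_comm.
      eapply eq_trans; [|exact (sum_n_mult_l (K := C_Ring) (v ^ n) _ n)].
      apply sum_n_ext_loc. intros k Hk. unfold mult; simpl.
      replace (v ^ n)%C with (v ^ k * v ^ (n - k))%C.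
      * ring.
      * rewrite <- Cpow_add_r. f_equal. lia.
  - exact ps_norm_series.
Qed.

End PowerSeriesNorm.

(** The maximum of two norms, so that a single estimate yields both kinds of information. *)
Lemma majorant_conj {X : Type} (S : X -> Prop) (N N' : (X -> C) -> R -> Prop) :
  majorant_norm S N -> majorant_norm S N' ->
  majorant_norm S (fun f M => N f M /\ N' f M).
Proof.
  intros [H1 H2 H3 H4 H5 H6 H7 H8] [G1 G2 G3 G4 G5 G6 G7 G8]. constructor.
  - intros f g M Hfg [A B]. split; eauto.
  - intros f M M' [A B] HM. split; eauto.
  - intros f M [A B]. eauto.
  - intros f M [A B]. eauto.
  - intros c. split; auto.
  - intros f g M M' [A B] [A' B']. split; auto.
  - intros f g M M' [A B] [A' B']. split; auto.
  - intros f b M Hf Hb. split; [apply H8 with b|apply G8 with b]; auto; intros n; apply Hf.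
Qed.

(** A supremum of norms over slices: covering by slices gives the pointwise bound, and one slice is
    enough for nonnegativity. *)
Lemma majorant_slices {X Y I : Type} (S : X -> Prop) (j : I -> Y -> X)
    (N : I -> (Y -> C) -> R -> Prop) :
  inhabited I ->
  (forall x, S x -> exists i y, x = j i y) ->
  (forall i, majorant_norm (fun y => S (j i y)) (N i)) ->
  majorant_norm S (fun f M => forall i, N i (fun y => f (j i y)) M).
Proof.
  intros [i0] Hj HN. constructor.
  - intros f g M Hfg Hf i. apply (mn_ext _ _ (HN i)) with (2 := Hf i). auto.
  - intros f M M' Hf HM i. exact (mn_le _ _ (HN i) _ _ _ (Hf i) HM).
  - intros f M Hf. exact (mn_ge0 _ _ (HN i0) _ _ (Hf i0)).
  - intros f M Hf x Hx. destruct (Hj x Hx) as (i & y & ->).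
    exact (mn_bound _ _ (HN i) _ _ (Hf i) y Hx).
  - intros c i. apply (mn_const _ _ (HN i)).
  - intros f g M M' Hf Hg i.
    exact (mn_plus _ _ (HN i) _ _ _ _ (Hf i) (Hg i)).
  - intros f g M M' Hf Hg i.
    exact (mn_mult _ _ (HN i) _ _ _ _ (Hf i) (Hg i)).
  - intros f b M Hf Hb i.
    exact (mn_series _ _ (HN i) (fun n y => f n (j i y)) b M (fun n => Hf n i) Hb).
Qed.

Section DualNorm.
Context {X : Type} {S : X -> Prop} {N : (X -> C) -> R -> Prop}.
Hypothesis HN : majorant_norm S N.
Variables (e : X -> C) (c : R).
Hypothesis (Hc : (0 < c)%R) (He : N e c).

(* The algebra of pairs [f0], [f1 = f0 + e * g], with the norm
   [|f0| + c * |g|]; the pair is encoded as a function on [X * bool]. *)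
Definition dual_norm (F : X * bool -> C) (M : R) : Prop :=
  exists g M0 M1, N (fun x => F (x, false)) M0 /\ N g M1 /\
    (forall x, S x -> F (x, true) = F (x, false) + e x * g x) /\ (M0 + c * M1 <= M)%R.

(** The cofactor of a product is [f0 h' + h g0 + e h h']; as [e] has norm at most [c], its bound
    completes [(M0 + c M1) (M0' + c M1')]. An estimate in this norm thus proves that a difference of
    two values is divisible by [e], with a bound on the quotient. *)
Lemma majorant_dual_norm : majorant_norm (fun p => S (fst p)) dual_norm.
Proof.
  constructor.
  - intros f g M Hfg (h & M0 & M1 & H0 & H1 & H2 & H3). exists h, M0, M1.
    split; [|split; [exact H1|split; [|exact H3]]].
    + apply (mn_ext _ _ HN) with (2 := H0). intros x Hx. now apply Hfg.
    + intros x Hx. rewrite <- !Hfg by assumption. auto.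
  - intros f M M' (h & M0 & M1 & H0 & H1 & H2 & H3) HM. exists h, M0, M1.
    repeat split; auto; lra.
  - intros f M (h & M0 & M1 & H0 & H1 & H2 & H3).
    assert (A := mn_ge0 _ _ HN _ _ H0). assert (B := mn_ge0 _ _ HN _ _ H1). nra.
  - intros f M (h & M0 & M1 & H0 & H1 & H2 & H3) [x b] Hx. simpl in Hx.
    assert (A := mn_bound _ _ HN _ _ H0 x Hx). assert (B := mn_bound _ _ HN _ _ H1 x Hx).
    assert (B0 := mn_ge0 _ _ HN _ _ H1).
    destruct b; [|nra]. rewrite H2 by assumption.
    eapply Rle_trans; [apply Cmod_triangle|]. rewrite Cmod_mult.
    assert (D := mn_bound _ _ HN _ _ He x Hx).
    assert (Cmod (e x) * Cmod (h x) <= c * M1)%R.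
    { apply Rmult_le_compat; auto; apply Cmod_ge_0. } lra.
  - intros k. exists (fun _ => RtoC 0), (Cmod k), 0%R.
    split; [apply (mn_const _ _ HN)|split; [apply (mn_zero HN)|split; [|lra]]].
    intros x _. ring.
  - intros f g M M' (h & M0 & M1 & H0 & H1 & H2 & H3)
      (h' & M0' & M1' & H0' & H1' & H2' & H3').
    exists (fun x => h x + h' x), (M0 + M0')%R, (M1 + M1')%R.
    split; [exact (mn_plus _ _ HN _ _ _ _ H0 H0')|].
    split; [exact (mn_plus _ _ HN _ _ _ _ H1 H1')|].
    split; [|lra]. intros x Hx. rewrite H2, H2' by assumption. ring.
  - intros f g M M' (h & M0 & M1 & H0 & H1 & H2 & H3)
      (h' & M0' & M1' & H0' & H1' & H2' & H3').
    assert (A := mn_ge0 _ _ HN _ _ H0). assert (B := mn_ge0 _ _ HN _ _ H1).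
    assert (A' := mn_ge0 _ _ HN _ _ H0'). assert (B' := mn_ge0 _ _ HN _ _ H1').
    exists (fun x => f (x, false) * h' x + h x * g (x, false) + e x * (h x * h' x)),
      (M0 * M0')%R, (M0 * M1' + M1 * M0' + c * (M1 * M1'))%R.
    split; [exact (mn_mult _ _ HN _ _ _ _ H0 H0')|].
    split.
    { repeat first [apply (mn_plus _ _ HN)|apply (mn_mult _ _ HN)]; assumption. }
    split.
    + intros x Hx. rewrite H2, H2' by assumption. ring.
    + apply Rle_trans with ((M0 + c * M1) * (M0' + c * M1'))%R; [right; ring|].
      apply Rmult_le_compat; auto; nra.
  - intros f b M Hf Hb.
    destruct (epsilon_choice _ Hf) as [g Hg].
    destruct (epsilon_choice _ Hg) as [m0 Hm0].
    destruct (epsilon_choice _ Hm0) as [m1 Hm1]. clear Hf Hg Hm0.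
    assert (P0 : forall n, (0 <= m0 n)%R).
    { intros n. apply (mn_ge0 _ _ HN _ _ (proj1 (Hm1 n))). }
    assert (P1 : forall n, (0 <= m1 n)%R).
    { intros n. apply (mn_ge0 _ _ HN _ _ (proj1 (proj2 (Hm1 n)))). }
    destruct (summable_below_weighted m0 m1 c M Hc P0 P1) as (M0 & M1 & S0 & S1 & HM).
    { apply (summable_below_le _ b); [|exact Hb]. intros n.
      destruct (Hm1 n) as (_ & _ & _ & H). specialize (P0 n). specialize (P1 n). nra. }
    exists (fun x => Cseries (fun n => g n x)), M0, M1.
    split; [|split; [|split; [|exact HM]]].
    + apply (mn_series _ _ HN (fun n x => f n (x, false)) m0); [|exact S0].
      intros n. apply Hm1.
    + apply (mn_series _ _ HN g m1); [|exact S1]. intros n. apply Hm1.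
    + intros x Hx. apply Cseries_unique.
      eapply is_series_ext.
      2: { apply (is_series_plus (V := C_NormedModule)).
           - apply (Cseries_correct _ _ _ S0). intros n.
             apply (mn_bound _ _ HN _ _ (proj1 (Hm1 n)) x Hx).
           - apply (is_series_scal (V := C_NormedModule) (e x)).
             apply (Cseries_correct _ _ _ S1). intros n.
             apply (mn_bound _ _ HN _ _ (proj1 (proj2 (Hm1 n))) x Hx). }
      intros n. symmetry. now apply Hm1.
Qed.

End DualNorm.

(** * Derivatives in one complex variable *)

Notation is_Cderive := (is_derive (K := C_AbsRing) (V := C_NormedModule)).
Notation is_Cseries := (is_series (K := C_AbsRing) (V := C_NormedModule)).

Lemma is_Cderive_const (c x : C) : is_Cderive (fun _ => c) x (RtoC 0).
Proof. apply (is_derive_const (V := C_NormedModule)). Qed.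

Lemma is_Cderive_id (x : C) : is_Cderive (fun t => t) x (RtoC 1).
Proof.
  apply is_derive_C_iff. apply filterdiff_ext_lin with (fun h : C => h).
  - apply filterdiff_id.
  - intros h. symmetry. apply Cmult_1_r.
Qed.

Lemma is_Cderive_eq (f : C -> C) (x l l' : C) : is_Cderive f x l -> l = l' -> is_Cderive f x l'.
Proof. now intros H <-. Qed.

Lemma is_Cderive_plus (f g : C -> C) (x l l' : C) :
  is_Cderive f x l -> is_Cderive g x l' -> is_Cderive (fun t => f t + g t) x (l + l').
Proof. intros H1 H2. exact (is_derive_plus (V := C_NormedModule) f g x l l' H1 H2). Qed.

Lemma is_Cderive_minus (f g : C -> C) (x l l' : C) :
  is_Cderive f x l -> is_Cderive g x l' -> is_Cderive (fun t => f t - g t) x (l - l').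
Proof. intros H1 H2. exact (is_derive_minus (V := C_NormedModule) f g x l l' H1 H2). Qed.

Lemma is_Cderive_mult (f g : C -> C) (x l l' : C) :
  is_Cderive f x l -> is_Cderive g x l' ->
  is_Cderive (fun t => f t * g t) x (l * g x + f x * l').
Proof.
  rewrite !is_derive_C_iff. intros H1 H2.
  eapply filterdiff_ext_lin.
  - exact (filterdiff_Cmult (U := C_NormedModule) f g x _ _ H1 H2).
  - intros h. simpl. ring.
Qed.

Lemma is_Cderive_scal (f : C -> C) (c x l : C) :
  is_Cderive f x l -> is_Cderive (fun t => c * f t) x (c * l).
Proof.
  intros H. eapply is_Cderive_eq; [apply is_Cderive_mult; [apply is_Cderive_const|exact H]|].
  cbv beta. ring.
Qed.

Lemma is_Cderive_comp (f g : C -> C) (x l l' : C) :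
  is_Cderive f (g x) l -> is_Cderive g x l' -> is_Cderive (fun t => f (g t)) x (l' * l).
Proof.
  rewrite !is_derive_C_iff. intros H1 H2.
  eapply filterdiff_ext_lin.
  - exact (filterdiff_comp' (U := C_NormedModule) (V := C_NormedModule)
      (W := C_NormedModule) g f x _ _ H2 H1).
  - intros h. simpl. ring.
Qed.

Lemma is_Cderive_inv_id (z : C) : z <> 0 -> is_Cderive Cinv z (- / (z * z)).
Proof.
  intros Hz. apply is_derive_C_eps. intros eps.
  assert (Hm : (0 < Cmod z)%R) by now apply Cmod_gt_0.
  (* The remainder is [(y - z)^2 / (y z^2)]. The first bound keeps the modulus of [y] above half
     that of [z]; the second then makes the remainder at most [eps] times that of [y - z]. *)
  set (d := Rmin (Cmod z / 2) (eps * Cmod z ^ 3 / 2)).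
  assert (Hd : (0 < d)%R).
  { apply Rmin_glb_lt; [lra|]. assert (H := cond_pos eps).
    assert (H1 : (0 < Cmod z ^ 3)%R) by now apply pow_lt. nra. }
  exists (mkposreal d Hd). simpl. intros y Hy.
  assert (H1 := Rlt_le_trans _ _ _ Hy (Rmin_l _ _)).
  assert (H2 := Rlt_le_trans _ _ _ Hy (Rmin_r _ _)).
  assert (Hy2 : (Cmod z / 2 < Cmod y)%R).
  { assert (H := Cmod_triangle y (- (y - z))). rewrite Cmod_opp in H.
    replace (y + - (y - z))%C with z in H by ring. lra. }
  assert (Hy0 : y <> 0).
  { intros ->. rewrite Cmod_0 in Hy2. lra. }
  replace (/ y - / z - (y - z) * - / (z * z))%C
    with ((y - z) * ((y - z) / (y * (z * z))))%C by (field; auto).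
  rewrite Cmod_mult, Rmult_comm. apply Rmult_le_compat_r; [apply Cmod_ge_0|].
  rewrite Cmod_div, !Cmod_mult.
  2: { repeat apply Cmult_neq_0; auto. }
  apply Rmult_le_reg_r with (Cmod y * (Cmod z * Cmod z))%R.
  { apply Rmult_lt_0_compat; [lra|nra]. }
  unfold Rdiv at 1. rewrite Rmult_assoc, Rinv_l, Rmult_1_r.
  2: { apply Rgt_not_eq, Rmult_lt_0_compat; [lra|nra]. }
  apply Rlt_le, (Rlt_le_trans _ _ _ H2).
  assert (H := cond_pos eps).
  replace (eps * Cmod z ^ 3 / 2)%R with (eps * ((Cmod z / 2) * (Cmod z * Cmod z)))%R by field.
  apply Rmult_le_compat_l; [lra|]. apply Rmult_le_compat_r; [nra|lra].
Qed.

Lemma is_Cderive_inv (f : C -> C) (x l : C) :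
  f x <> 0 -> is_Cderive f x l -> is_Cderive (fun t => / f t) x (- l / (f x * f x)).
Proof.
  intros Hx H. eapply is_Cderive_eq.
  - exact (is_Cderive_comp Cinv f x _ _ (is_Cderive_inv_id _ Hx) H).
  - unfold Cdiv. ring.
Qed.

Lemma is_Cderive_pow (f : C -> C) (x l : C) (n : nat) :
  is_Cderive f x l -> is_Cderive (fun t => f t ^ S n) x (RtoC (INR (S n)) * l * f x ^ n).
Proof.
  intros H. induction n as [|n IH].
  - eapply is_Cderive_eq.
    + apply (is_derive_ext (V := C_NormedModule) f); [intros t; simpl; ring|exact H].
    + simpl. ring.
  - eapply is_Cderive_eq; [exact (is_Cderive_mult f (fun t => f t ^ S n) x _ _ H IH)|].
    rewrite (S_INR (S n)), RtoC_plus. simpl Cpow. ring.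
Qed.

Lemma is_Cderive_ext_locally (f g : C -> C) (x l : C) (d : R) :
  (0 < d)%R -> (forall t, (Cmod (t - x) < d)%R -> f t = g t) ->
  is_Cderive f x l -> is_Cderive g x l.
Proof.
  intros Hd Hfg. rewrite !is_derive_C_iff. intros H.
  eapply (filterdiff_ext_locally (U := C_NormedModule) (V := C_NormedModule) f);
    [|exact H].
  apply (locally_iff_norm (U := C_NormedModule)). exists (mkposreal d Hd). exact Hfg.
Qed.

Lemma is_Cderive_unique (f : C -> C) (x l l' : C) :
  is_Cderive f x l -> is_Cderive f x l' -> l = l'.
Proof.
  intros H H'. rewrite <- (is_C_derive_unique f x l H). now apply is_C_derive_unique.
Qed.

Lemma is_Cderive_Cseries (f : nat -> C -> C) (d : nat -> C) (b b0 : nat -> R) (M M0 : R)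
    (x l : C) (rad : R) :
  summable_below b M -> summable_below b0 M0 -> (0 < rad)%R ->
  (forall n, is_Cderive (f n) x (d n)) ->
  (forall y, (Cmod (y - x) < rad)%R -> forall n, (Cmod (f n y) <= b0 n)%R /\
    (Cmod (f n y - f n x) <= b n * Cmod (y - x))%R) ->
  is_Cseries d l ->
  is_Cderive (fun y => Cseries (fun n => f n y)) x l.
Proof.
  intros Hb Hb0 Hrad Hf Hloc Hl. apply is_derive_C_iff.
  eapply filterdiff_ext_lin.
  - apply (filterdiff_Cseries (U := C_NormedModule) f (fun n h => h * d n) b b0 M M0 x Hb Hb0).
    + intros n. apply is_derive_C_iff, Hf.
    + apply (locally_iff_norm (U := C_NormedModule)). exists (mkposreal rad Hrad). exact Hloc.
  - intros h. apply Cseries_unique.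
    exact (is_series_scal (V := C_NormedModule) h d l Hl).
Qed.

(** * The series solving P1 in the hodograph variables *)

(** The part of [e] free of [m]. The equation for [e] gives [a / (6 - 4)] and [b / (6 - 5)]; at the
    resonance 6 the coefficient is free, and [- k / 4] is chosen so that [e = 1 / (4 w) - 1] amounts
    to [k = 4 - 1 / w]. *)
Definition src_coef (a b k : C) (n : nat) : C :=
  match n with 4 => a / 2 | 5 => b | 6 => - k / 4 | _ => 0 end.

(* From [rho e' = 6 e - rho^4 x]: at [n = N + 7] the factor is
   [- b / ((n - 4) (n - 6))], where [n - 4] comes from integrating [m] into [x]
   and [n - 6] from the resonant left-hand side. *)
Definition damp_coef (b : C) (n : nat) : C := - b / RtoC (INR (n + 3) * INR (n + 1)).

(** The powers of [rho] are absorbed in [a], [b], [k], so these are the terms of the series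
    themselves and not coefficients of a further variable. *)
Definition m_coef (a b k : C) : nat -> C :=
  rec_sol (K := C_Ring) (RtoC (- / 2)) (src_coef a b k) (damp_coef b).

Definition exc_coef (a b k : C) : nat -> C :=
  e_coef (K := C_Ring) (src_coef a b k) (damp_coef b) (m_coef a b k).

(** From [dx/drho = m]: integrating [rho ^ n] and dividing by [rho] gives the factor
    [1 / (n + 1)]. *)
Definition psi_coef (a b k : C) (n : nat) : C := m_coef a b k n / RtoC (INR (n + 1)).

Definition m_fun (a b k : C) : C := 1 + Cseries (m_coef a b k).
Definition psi_fun (a b k : C) : C := Cseries (psi_coef a b k).
Definition exc_fun (a b k : C) : C := Cseries (exc_coef a b k).

Definition src_maj (n : nat) : R :=
  (match n with 4 => / 20 | 5 => / 20 | 6 => / 20 | _ => 0 end)%R.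
Definition m_maj : nat -> R := rec_sol (K := R_Ring) (/ 2)%R src_maj (fun _ => / 20)%R.
Definition exc_maj : nat -> R := e_coef (K := R_Ring) src_maj (fun _ => / 20)%R m_maj.

Lemma summable_src_maj : summable_below src_maj (3 / 20).
Proof.
  split.
  - intros n. do 7 (destruct n as [|n]; [simpl; lra|]). simpl. lra.
  - intros K. apply Rle_trans with (sum_n src_maj (K + 6)).
    + apply sum_n_incr_le; [|lia].
      intros n. do 7 (destruct n as [|n]; [simpl; lra|]). simpl. lra.
    + right. induction K as [|K IH].
      * simpl Nat.add. rewrite !sum_Sn, sum_O. unfold plus; simpl. lra.
      * simpl Nat.add. rewrite sum_Sn, IH.
        replace (src_maj (S (K + 6))) with 0%R; [apply Rplus_0_r|].
        now replace (S (K + 6)) with (S (S (S (S (S (S (S K))))))) by lia.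
Qed.

(** [1 / 5] is a supersolution: [(0.04 + (0.15 + 0.01) 1.44) / 2 = 0.1352]. A bound below 1 also
    keeps [m] away from 0. *)
Lemma summable_m_maj : summable_below m_maj (1 / 5).
Proof.
  unfold m_maj. apply (summable_below_rec_sol _ _ (3 / 20) (/ 20)).
  - exact summable_src_maj.
  - intros _. lra.
  - lra.
  - lra.
  - reflexivity.
Qed.

Lemma summable_exc_maj : summable_below exc_maj (3 / 20 + / 20 * (1 / 5)).
Proof.
  apply summable_below_e_coef.
  - exact summable_src_maj.
  - intros _. lra.
  - exact summable_m_maj.
Qed.

Section NormBounds.
Context {X : Type} {S : X -> Prop} {N : (X -> C) -> R -> Prop}.
Hypothesis HN : majorant_norm S N.

Lemma mn_scal (c : C) (f : X -> C) (M : R) : N f M -> N (fun x => c * f x) (Cmod c * M).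
Proof. intros H. apply (mn_mult _ _ HN); [apply (mn_const _ _ HN)|exact H]. Qed.

Variables (a b k : X -> C).
Hypothesis (Ha : N a (/ 20)) (Hb : N b (/ 20)) (Hk : N k (/ 20)).

Lemma mn_contract (c : C) (f : X -> C) (M : R) :
  (Cmod c <= 1)%R -> N f M -> N (fun x => f x * c) M.
Proof.
  intros Hc Hf. assert (H0 := mn_ge0 _ _ HN _ _ Hf).
  apply (mn_le _ _ HN _ (M * Cmod c)%R).
  - apply (mn_mult _ _ HN); [exact Hf|apply (mn_const _ _ HN)].
  - nra.
Qed.

Lemma mn_src_coef (n : nat) : N (fun x => src_coef (a x) (b x) (k x) n) (src_maj n).
Proof.
  do 4 (destruct n as [|n]; [apply (mn_zero HN)|]).
  destruct n as [|n].
  { simpl. apply mn_contract; [|exact Ha].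
    rewrite <- RtoC_inv, Cmod_R, Rabs_pos_eq; lra. }
  destruct n as [|n]; [exact Hb|].
  destruct n as [|n]; [|apply (mn_zero HN)].
  simpl. apply (mn_ext _ _ HN) with (fun x => k x * - / 4)%C.
  { intros x _. unfold Cdiv. ring. }
  apply mn_contract; [|exact Hk].
  rewrite Cmod_opp, <- RtoC_inv, Cmod_R, Rabs_pos_eq; lra.
Qed.

Lemma mn_damp_coef (n : nat) : N (fun x => damp_coef (b x) n) (/ 20).
Proof.
  unfold damp_coef.
  assert (H : (1 <= INR (n + 3) * INR (n + 1))%R).
  { rewrite !plus_INR. simpl. assert (H := pos_INR n). nra. }
  apply (mn_ext _ _ HN) with (fun x => b x * - / RtoC (INR (n + 3) * INR (n + 1)))%C.
  { intros x _. unfold Cdiv. ring. }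
  apply mn_contract; [|exact Hb].
  rewrite Cmod_opp, <- RtoC_inv by lra. rewrite Cmod_R, Rabs_pos_eq.
  - rewrite <- Rinv_1. apply Rinv_le_contravar; lra.
  - apply Rlt_le, Rinv_0_lt_compat. lra.
Qed.

Lemma mn_m_coef (n : nat) : N (fun x => m_coef (a x) (b x) (k x) n) (m_maj n).
Proof.
  unfold m_coef, m_maj, rec_sol.
  assert (E : Cmod (RtoC (- / 2)) = (/ 2)%R).
  { rewrite Cmod_R, Rabs_Ropp, Rabs_pos_eq; lra. }
  assert (H := mn_rec_iter HN (RtoC (- / 2))
    (fun n x => src_coef (a x) (b x) (k x) n) (fun n x => damp_coef (b x) n)
    src_maj (fun _ => / 20)%R mn_src_coef mn_damp_coef (Datatypes.S n) n).
  rewrite E in H. exact H.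
Qed.

Lemma mn_exc_coef (n : nat) : N (fun x => exc_coef (a x) (b x) (k x) n) (exc_maj n).
Proof.
  unfold exc_coef, exc_maj.
  apply (mn_e_coef HN (fun n x => src_coef (a x) (b x) (k x) n) (fun n x => damp_coef (b x) n)).
  - exact mn_src_coef.
  - exact mn_damp_coef.
  - exact mn_m_coef.
Qed.

Lemma mn_psi_coef (n : nat) : N (fun x => psi_coef (a x) (b x) (k x) n) (m_maj n).
Proof.
  unfold psi_coef. apply mn_contract; [|apply mn_m_coef].
  assert (H : (1 <= INR (n + 1))%R).
  { rewrite plus_INR. simpl. assert (H := pos_INR n). lra. }
  rewrite <- RtoC_inv by lra. rewrite Cmod_R, Rabs_pos_eq.
  - rewrite <- Rinv_1. apply Rinv_le_contravar; lra.
  - apply Rlt_le, Rinv_0_lt_compat. lra.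
Qed.

Lemma mn_m_series : N (fun x => Cseries (m_coef (a x) (b x) (k x))) (1 / 5).
Proof.
  apply (mn_series _ _ HN (fun n x => m_coef (a x) (b x) (k x) n) m_maj).
  - exact mn_m_coef.
  - exact summable_m_maj.
Qed.

Lemma mn_psi_fun : N (fun x => psi_fun (a x) (b x) (k x)) (1 / 5).
Proof.
  apply (mn_series _ _ HN (fun n x => psi_coef (a x) (b x) (k x) n) m_maj).
  - exact mn_psi_coef.
  - exact summable_m_maj.
Qed.

End NormBounds.

Section Pointwise.
Variables (a b k : C).
Hypothesis (Ha : (Cmod a <= / 20)%R) (Hb : (Cmod b <= / 20)%R) (Hk : (Cmod k <= / 20)%R).

Lemma coef_bounds (n : nat) :
  (Cmod (m_coef a b k n) <= m_maj n)%R /\ (Cmod (exc_coef a b k n) <= exc_maj n)%R /\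
  (Cmod (psi_coef a b k n) <= m_maj n)%R.
Proof.
  (* Numbers are treated as constant functions and evaluated at 0; any instance of the norm would
     serve. *)
  assert (HN : majorant_norm (fun v => (Cmod v <= 1)%R) (ps_norm (fun v => (Cmod v <= 1)%R) 1)).
  { apply majorant_ps_norm; [lra|auto]. }
  assert (Hc : forall c, (Cmod c <= / 20)%R ->
    ps_norm (fun v => (Cmod v <= 1)%R) 1 (fun _ => c) (/ 20)).
  { intros c H. apply (mn_le _ _ HN _ (Cmod c)); [apply (mn_const _ _ HN)|exact H]. }
  assert (H0 : (Cmod 0 <= 1)%R) by (rewrite Cmod_0; lra).
  split; [|split].
  - exact (mn_bound _ _ HN _ _ (mn_m_coef HN (fun _ => a) (fun _ => b) (fun _ => k)
      (Hc a Ha) (Hc b Hb) (Hc k Hk) n) 0 H0).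
  - exact (mn_bound _ _ HN _ _ (mn_exc_coef HN (fun _ => a) (fun _ => b) (fun _ => k)
      (Hc a Ha) (Hc b Hb) (Hc k Hk) n) 0 H0).
  - exact (mn_bound _ _ HN _ _ (mn_psi_coef HN (fun _ => a) (fun _ => b) (fun _ => k)
      (Hc a Ha) (Hc b Hb) (Hc k Hk) n) 0 H0).
Qed.

Lemma is_series_m : is_Cseries (m_coef a b k) (m_fun a b k - 1).
Proof.
  unfold m_fun. replace (1 + Cseries (m_coef a b k) - 1)%C with (Cseries (m_coef a b k)) by ring.
  apply (Cseries_correct _ _ _ summable_m_maj). intros n. apply coef_bounds.
Qed.

Lemma is_series_exc : is_Cseries (exc_coef a b k) (exc_fun a b k).
Proof. apply (Cseries_correct _ _ _ summable_exc_maj). intros n. apply coef_bounds. Qed.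

Lemma is_series_psi : is_Cseries (psi_coef a b k) (psi_fun a b k).
Proof. apply (Cseries_correct _ _ _ summable_m_maj). intros n. apply coef_bounds. Qed.

Lemma m_fun_near_1 : (Cmod (m_fun a b k - 1) <= 1 / 5)%R.
Proof.
  rewrite <- (Cseries_unique _ _ is_series_m).
  apply (Cseries_bound _ _ _ summable_m_maj). intros n. apply coef_bounds.
Qed.

Lemma m_fun_neq_0 : m_fun a b k <> 0.
Proof.
  intros H. assert (H1 := m_fun_near_1). rewrite H in H1.
  replace (0 - 1)%C with (Copp (RtoC 1)) in H1 by ring.
  rewrite Cmod_opp, Cmod_1 in H1. lra.
Qed.

Lemma is_series_indicator0 (c : C) :
  is_Cseries (fun n => match n with O => c | S _ => RtoC 0 end) c.
Proof.
  apply is_series_C_iff. intros eps He. exists 0%nat. intros n _.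
  assert (E : sum_n (G := C_AbelianMonoid)
    (fun n => match n with O => c | S _ => RtoC 0 end) n = c).
  { induction n as [|n IH].
    - now rewrite sum_O.
    - rewrite sum_Sn, IH. apply Cplus_0_r. }
  change (Cmod (sum_n (G := C_AbelianMonoid)
    (fun n => match n with O => c | S _ => RtoC 0 end) n - c) < eps)%R.
  rewrite E. unfold Cminus. now rewrite Cplus_opp_r, Cmod_0.
Qed.

(** The termwise recursion passes to the sums, because convolutions of dominated series converge to
    products. *)
Lemma m_exc_identity : m_fun a b k ^ 2 * (1 + exc_fun a b k) = 1.
Proof.
  set (m := m_fun a b k). set (E := exc_fun a b k).
  assert (Hm := is_series_m). assert (HE := is_series_exc).
  assert (Bm : forall n, (Cmod (m_coef a b k n) <= m_maj n)%R) by (intros n; apply coef_bounds).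
  assert (BE : forall n, (Cmod (exc_coef a b k n) <= exc_maj n)%R) by (intros n; apply coef_bounds).
  fold m in Hm. fold E in HE.
  assert (H1 : is_Cseries (one_plus (K := C_Ring) (m_coef a b k)) m).
  { replace m with (1 + (m - 1))%C by ring.
    exact (is_series_plus (V := C_NormedModule) _ _ _ _ (is_series_indicator0 1) Hm). }
  set (q := fun n => (match n with O => 1 | S _ => 0 end + m_maj n)%R).
  assert (Sq : summable_below q (1 + 1 / 5)).
  { apply summable_below_plus; [apply summable_below_indicator0|apply summable_m_maj]. }
  assert (Bq : forall n, (Cmod (one_plus (K := C_Ring) (m_coef a b k) n) <= q n)%R).
  { intros n. unfold one_plus, q. eapply Rle_trans; [apply Cmod_triangle|].
    apply Rplus_le_compat; [|apply Bm]. destruct n.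
    - right. apply Cmod_1.
    - right. apply Cmod_0. }
  assert (H2 := is_series_conv _ _ _ _ _ _ _ _ Sq Sq Bq Bq H1 H1).
  assert (H3 := is_series_conv _ _ _ _ _ _ _ _ summable_m_maj summable_m_maj Bm Bm Hm Hm).
  assert (Bqq : forall n, (Cmod (conv (K := C_Ring) (one_plus (K := C_Ring) (m_coef a b k))
     (one_plus (K := C_Ring) (m_coef a b k)) n) <= conv (K := R_Ring) q q n)%R).
  { intros n. unfold conv. eapply Rle_trans; [apply Cmod_sum_n|].
    rewrite !sum_n_Reals. apply sum_Rle. intros i _.
    eapply Rle_trans; [right; apply Cmod_mult|].
    apply Rmult_le_compat; auto; apply Cmod_ge_0. }
  assert (H4 := is_series_conv _ _ _ _ _ _ _ _ summable_exc_maj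
    (summable_below_conv _ _ _ _ Sq Sq) BE Bqq HE H2).
  assert (H5 := is_series_scal (V := C_NormedModule) (RtoC (- / 2)) _ _
    (is_series_plus (V := C_NormedModule) _ _ _ _ H3 H4)).
  assert (H6 : m - 1 = RtoC (- / 2) * ((m - 1) * (m - 1) + E * (m * m))).
  { rewrite <- (Cseries_unique _ _ Hm). apply Cseries_unique.
    rewrite (Cseries_unique _ _ Hm).
    eapply is_series_ext; [|exact H5]. intros n. symmetry.
    apply (rec_sol_eq (K := C_Ring) (RtoC (- / 2)) (src_coef a b k) (damp_coef b) eq_refl n). }
  assert (H7 : (RtoC 2 * RtoC (- / 2) = Copp (RtoC 1))%C).
  { rewrite <- RtoC_mult. replace (2 * - / 2)%R with (- (1))%R by field. apply RtoC_opp. }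
  assert (H8 : (2 * (m - 1) = - ((m - 1) * (m - 1) + E * (m * m)))%C).
  { rewrite H6 at 1. rewrite Cmult_assoc, H7. ring. }
  replace (m ^ 2 * (1 + E))%C with ((m - 1) * (m - 1) + E * (m * m) + 2 * (m - 1) + 1)%C.
  - rewrite H8. ring.
  - simpl. ring.
Qed.

End Pointwise.

Definition box (c1 c2 c3 : C) (r1 r2 r3 : R) : C3 -> Prop :=
  fun p => (Cmod (fst (fst p) - c1) < r1)%R /\ (Cmod (snd (fst p) - c2) < r2)%R /\
           (Cmod (snd p - c3) < r3)%R.

Lemma coord1_le (p q : C3) : (Cmod (fst (fst p) - fst (fst q)) <= norm (minus p q))%R.
Proof.
  eapply Rle_trans; [|exact (norm_fst_le (K := C_AbsRing) (minus p q))].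
  exact (norm_fst_le (K := C_AbsRing) (U := C_NormedModule) (V := C_NormedModule)
    (fst (minus p q))).
Qed.

Lemma coord2_le (p q : C3) : (Cmod (snd (fst p) - snd (fst q)) <= norm (minus p q))%R.
Proof.
  eapply Rle_trans; [|exact (norm_fst_le (K := C_AbsRing) (minus p q))].
  exact (norm_snd_le (K := C_AbsRing) (U := C_NormedModule) (V := C_NormedModule)
    (fst (minus p q))).
Qed.

Lemma coord3_le (p q : C3) : (Cmod (snd p - snd q) <= norm (minus p q))%R.
Proof. exact (norm_snd_le (K := C_AbsRing) (minus p q)). Qed.

Lemma C3_norm_le (p : C3) :
  (norm p <= Cmod (fst (fst p)) + Cmod (snd (fst p)) + Cmod (snd p))%R.
Proof.
  eapply Rle_trans; [exact (norm_pair_le (K := C_AbsRing) p)|].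
  apply Rplus_le_compat_r.
  exact (norm_pair_le (K := C_AbsRing) (U := C_NormedModule) (V := C_NormedModule) (fst p)).
Qed.

Lemma open_box (c1 c2 c3 : C) (r1 r2 r3 : R) : open (box c1 c2 c3 r1 r2 r3).
Proof.
  intros p (H1 & H2 & H3). apply locally_iff_norm.
  set (d := Rmin (r1 - Cmod (fst (fst p) - c1))
    (Rmin (r2 - Cmod (snd (fst p) - c2)) (r3 - Cmod (snd p - c3)))).
  assert (Hd : (0 < d)%R) by (unfold d; repeat apply Rmin_glb_lt; lra).
  assert (D1 : (d <= r1 - Cmod (fst (fst p) - c1))%R) by apply Rmin_l.
  assert (D2 : (d <= r2 - Cmod (snd (fst p) - c2))%R)
    by (eapply Rle_trans; [apply Rmin_r|apply Rmin_l]).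
  assert (D3 : (d <= r3 - Cmod (snd p - c3))%R)
    by (eapply Rle_trans; [apply Rmin_r|apply Rmin_r]).
  exists (mkposreal d Hd). intros q Hq. simpl pos in Hq.
  assert (T : forall z z' c : C, (Cmod (z' - c) <= Cmod (z' - z) + Cmod (z - c))%R).
  { intros z z' c. replace (z' - c)%C with ((z' - z) + (z - c))%C by ring.
    apply Cmod_triangle. }
  assert (G1 := coord1_le q p). assert (G2 := coord2_le q p). assert (G3 := coord3_le q p).
  assert (T1 := T (fst (fst p)) (fst (fst q)) c1).
  assert (T2 := T (snd (fst p)) (snd (fst q)) c2).
  assert (T3 := T (snd p) (snd q) c3).
  repeat split; lra.
Qed.

Lemma lip_norm_coord (S : C3 -> Prop) (f : C3 -> C) (sigma b : R) :
  (0 < sigma)%R -> (0 <= b)%R -> (forall p, S p -> (Cmod (f p) <= b)%R) ->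
  (forall p q : C3, (Cmod (f q - f p) <= norm (minus q p))%R) ->
  is_linear (U := C3) (V := C_NormedModule) f -> lip_norm S sigma f (b + sigma).
Proof.
  intros Hs Hb Hf Hl Hlin. exists b, 1%R. repeat split; try lra; auto.
  - intros p q _ _. rewrite Rmult_1_l. apply Hl.
  - intros p _. exists f. now apply filterdiff_linear.
Qed.

Lemma is_linear_coord1 : is_linear (U := C3) (V := C_NormedModule) (fun p => fst (fst p)).
Proof.
  apply (is_linear_comp (U := C3)
    (V := prod_NormedModule C_AbsRing C_NormedModule C_NormedModule)
    (W := C_NormedModule) fst fst); apply is_linear_fst.
Qed.

Lemma is_linear_coord2 : is_linear (U := C3) (V := C_NormedModule) (fun p => snd (fst p)).
Proof.
  apply (is_linear_comp (U := C3)
    (V := prod_NormedModule C_AbsRing C_NormedModule C_NormedModule)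
    (W := C_NormedModule) fst snd); [apply is_linear_fst|apply is_linear_snd].
Qed.

Lemma is_linear_coord3 : is_linear (U := C3) (V := C_NormedModule) (fun p => snd p).
Proof. apply is_linear_snd. Qed.

(** Half of the admissible radius [1 / 20]: on this box a coordinate has sup bound [1 / 40] and
    Lipschitz constant 1, so its [lip_norm] with [sigma = 1 / 40] is [1 / 20]. *)
Definition small (a b k : C) : Prop :=
  (Cmod a < / 40)%R /\ (Cmod b < / 40)%R /\ (Cmod k < / 40)%R.

(** The majorant estimate in the Lipschitz norm of the box, divided by [sigma = 1 / 40]. It supplies
    the summable bound on difference quotients for termwise differentiation. *)
Lemma coef_lipschitz (a b k a' b' k' : C) (n : nat) :
  small a b k -> small a' b' k' ->
  let d := (40 * (Cmod (a' - a) + Cmod (b' - b) + Cmod (k' - k)))%R in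
  (Cmod (m_coef a' b' k' n - m_coef a b k n) <= m_maj n * d)%R /\
  (Cmod (exc_coef a' b' k' n - exc_coef a b k n) <= exc_maj n * d)%R /\
  (Cmod (psi_coef a' b' k' n - psi_coef a b k n) <= m_maj n * d)%R.
Proof.
  intros Hp Hq d.
  set (S := box 0 0 0 (/ 40) (/ 40) (/ 40)).
  assert (HS : forall x y z, small x y z -> S (x, y, z)).
  { intros x y z (H1 & H2 & H3). unfold S, box, Cminus; simpl.
    rewrite Copp_0, !Cplus_0_r. auto. }
  assert (HN : majorant_norm S (lip_norm S (/ 40))).
  { apply majorant_lip_norm; [apply open_box|lra]. }
  assert (B : forall f : C3 -> C, (forall p, S p -> (Cmod (f p) <= / 40)%R) ->
    (forall p q : C3, (Cmod (f q - f p) <= norm (minus q p))%R) ->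
    is_linear (U := C3) (V := C_NormedModule) f -> lip_norm S (/ 40) f (/ 20)).
  { intros f H1 H2 H3. apply (mn_le _ _ HN _ (/ 40 + / 40)%R); [|lra].
    apply lip_norm_coord; auto; lra. }
  assert (E : forall z : C, (z - 0 = z)%C) by (intros z; ring).
  assert (Na : lip_norm S (/ 40) (fun p : C3 => fst (fst p)) (/ 20)).
  { apply B; [|intros; apply coord1_le|apply is_linear_coord1].
    intros p (H & _ & _). rewrite E in H. lra. }
  assert (Nb : lip_norm S (/ 40) (fun p : C3 => snd (fst p)) (/ 20)).
  { apply B; [|intros; apply coord2_le|apply is_linear_coord2].
    intros p (_ & H & _). rewrite E in H. lra. }
  assert (Nk : lip_norm S (/ 40) (fun p : C3 => snd p) (/ 20)).
  { apply B; [|intros; apply coord3_le|apply is_linear_coord3].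
    intros p (_ & _ & H). rewrite E in H. lra. }
  assert (L : forall (f : C3 -> C) (M : R), lip_norm S (/ 40) f M ->
    (Cmod (f (a', b', k') - f (a, b, k)) <= M * d)%R).
  { intros f M Hf.
    assert (HM := mn_ge0 _ _ HN _ _ Hf).
    eapply Rle_trans.
    - apply (lip_norm_lip S (/ 40) ltac:(lra) f M (a, b, k) (a', b', k') Hf); auto.
    - unfold d. replace (M / / 40)%R with (M * 40)%R by field.
      rewrite Rmult_assoc. apply Rmult_le_compat_l; [exact HM|].
      apply Rmult_le_compat_l; [lra|].
      exact (C3_norm_le (minus (a', b', k') (a, b, k))). }
  split; [|split].
  - exact (L _ _ (mn_m_coef HN _ _ _ Na Nb Nk n)).
  - exact (L _ _ (mn_exc_coef HN _ _ _ Na Nb Nk n)).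
  - exact (L _ _ (mn_psi_coef HN _ _ _ Na Nb Nk n)).
Qed.

(** The vanishing at index 1 is the absence of a logarithm: otherwise the resonant equation would
    contain [b * psi_coef a b k 1]. *)
Lemma m_coef_01 (a b k : C) : m_coef a b k 0 = 0 /\ m_coef a b k 1 = 0.
Proof.
  assert (H0 : m_coef a b k 0 = 0)
    by exact (rec_sol_0 (K := C_Ring) (RtoC (- / 2)) (src_coef a b k) (damp_coef b) eq_refl).
  split; [exact H0|].
  unfold m_coef. rewrite (rec_sol_eq (K := C_Ring) _ _ _ eq_refl 1).
  fold (m_coef a b k). unfold rec_step, conv at 1 2. rewrite !sum_Sn, !sum_O. simpl Nat.sub.
  rewrite H0. unfold e_coef; simpl. unfold mult, plus, zero; simpl. ring.
Qed.

(* [n * e_n = 6 * e_n - ode_coef n], the recursion read as the equation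
   [rho e' = 6 e - rho^4 x] for the series of [e]. *)
Definition ode_coef (a b k : C) (n : nat) : C :=
  match n with
  | 4 => a
  | 5 => b
  | S (S (S (S (S n)))) => b * psi_coef a b k n
  | _ => 0
  end.

Lemma exc_coef_ode (a b k : C) (n : nat) :
  RtoC (INR n) * exc_coef a b k n = 6 * exc_coef a b k n - ode_coef a b k n.
Proof.
  destruct (m_coef_01 a b k) as [_ H1].
  assert (R6 : INR 6 = 6%R) by (simpl; ring).
  do 4 (destruct n as [|n];
    [unfold exc_coef, e_coef, ode_coef; simpl; unfold plus, zero; simpl; ring|]).
  destruct n as [|n].
  { unfold exc_coef, e_coef, ode_coef. simpl src_coef. unfold plus, zero; simpl Cplus.
    replace (INR 4) with 4%R by (simpl; ring). simpl. field. }
  destruct n as [|n].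
  { unfold exc_coef, e_coef, ode_coef. simpl src_coef. unfold plus, zero; simpl Cplus.
    replace (INR 5) with 5%R by (simpl; ring). simpl. ring. }
  destruct n as [|n].
  (* The resonance: [6 e_6] stands on both sides, and the equation holds for every [k] because
     [psi_1 = 0]. *)
  { rewrite R6. unfold ode_coef, psi_coef. rewrite H1. unfold Cdiv. ring. }
  unfold exc_coef, e_coef, ode_coef, psi_coef. simpl src_coef.
  change (@plus C_Ring) with Cplus. change (@mult C_Ring) with Cmult.
  unfold damp_coef.
  assert (Hn := pos_INR n).
  replace (INR (S (S (S (S (S (S (S n)))))))) with (INR n + 7)%R by (rewrite !S_INR; ring).
  replace (INR (S (S n) + 1)) with (INR n + 3)%R by (rewrite plus_INR, !S_INR; simpl; ring).
  rewrite !plus_INR. replace (INR 3) with 3%R by (simpl; ring).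
  replace (INR 1) with 1%R by reflexivity.
  rewrite RtoC_mult, !RtoC_plus. field.
  split; intros H; cbv beta in H; rewrite <- RtoC_plus in H; apply RtoC_inj in H; lra.
Qed.

Lemma is_series_ode_coef (a b k : C) (l : C) :
  is_Cseries (psi_coef a b k) l -> is_Cseries (ode_coef a b k) (a + b + b * l).
Proof.
  intros Hl.
  apply (is_series_decr_n (V := C_NormedModule) _ 5); [lia|].
  assert (E : plus (a + b + b * l) (opp (sum_n (ode_coef a b k) (pred 5))) = b + b * l).
  { simpl pred. rewrite !sum_Sn, sum_O. simpl. unfold plus, opp; simpl. ring. }
  match goal with |- is_series _ ?u => replace u with (b + b * l)%C by (symmetry; exact E) end.
  eapply is_series_ext.
  2: { apply (is_series_plus (V := C_NormedModule)).
       - apply (is_series_indicator0 b).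
       - apply (is_series_scal (V := C_NormedModule) b), Hl. }
  (* The term at index 5 is [b] instead of [b + b psi_0]; these agree since [psi_0 = 0]. *)
  intros n. destruct (m_coef_01 a b k) as [H0 _].
  destruct n as [|n]; simpl.
  - unfold psi_coef. rewrite H0. unfold plus, scal; simpl. unfold mult; simpl.
    unfold Cdiv. ring.
  - unfold plus, scal; simpl. unfold mult; simpl. ring.
Qed.

(** * Derivatives of the series along a curve that scales the weighted variables *)

Section AlongCurve.
Variables (a b k : C -> C) (t0 al : C).
Hypothesis (Ha : is_Cderive a t0 (4 * al * a t0)) (Hb : is_Cderive b t0 (5 * al * b t0))
  (Hk : is_Cderive k t0 (6 * al * k t0)).
Hypothesis Hsmall : small (a t0) (b t0) (k t0).

(* Degree [n] homogeneity for the weights 4, 5, 6 of [a], [b], [k]. *)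
Definition euler (f : C -> C) (n : nat) : Prop :=
  is_Cderive f t0 (RtoC (INR n) * al * f t0).

Lemma euler_mult (f g : C -> C) (i j : nat) :
  euler f i -> euler g j -> euler (fun t => f t * g t) (i + j).
Proof.
  intros Hf Hg. unfold euler. rewrite plus_INR, RtoC_plus.
  eapply is_Cderive_eq; [apply is_Cderive_mult; [exact Hf|exact Hg]|]. ring.
Qed.

Lemma euler_plus (f g : C -> C) (n : nat) :
  euler f n -> euler g n -> euler (fun t => f t + g t) n.
Proof.
  intros Hf Hg. eapply is_Cderive_eq; [apply is_Cderive_plus; [exact Hf|exact Hg]|]. ring.
Qed.

Lemma euler_const (c : C) : euler (fun _ => c) 0.
Proof. eapply is_Cderive_eq; [apply is_Cderive_const|]. simpl. ring. Qed.

Lemma euler_zero (n : nat) : euler (fun _ => RtoC 0) n.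
Proof. eapply is_Cderive_eq; [apply is_Cderive_const|]. ring. Qed.

Lemma euler_sum (f : nat -> C -> C) (m n : nat) :
  (forall i, (i <= n)%nat -> euler (f i) m) -> euler (fun t => sum_n (fun i => f i t) n) m.
Proof.
  induction n as [|n IH]; intros H.
  - assert (G := H 0%nat (Nat.le_refl _)). unfold euler in *.
    rewrite sum_O. eapply is_derive_ext; [|exact G].
    intros t. exact (eq_sym (sum_O (G := C_AbelianMonoid) (fun i => f i t))).
  - assert (G := euler_plus _ _ m (IH (fun i Hi => H i ltac:(lia))) (H (S n) (Nat.le_refl _))).
    unfold euler in *. rewrite sum_Sn. eapply is_derive_ext; [|exact G].
    intros t. exact (eq_sym (sum_Sn (G := C_AbelianMonoid) (fun i => f i t) n)).
Qed.

Lemma euler_conv (f g : nat -> C -> C) (n : nat) :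
  (forall i, euler (f i) i) -> (forall i, euler (g i) i) ->
  euler (fun t => conv (K := C_Ring) (fun i => f i t) (fun i => g i t) n) n.
Proof.
  intros Hf Hg. apply (euler_sum (fun i t => f i t * g (n - i)%nat t)).
  intros i Hi. assert (G := euler_mult _ _ i (n - i) (Hf i) (Hg (n - i)%nat)).
  replace (i + (n - i))%nat with n in G by lia. exact G.
Qed.

Lemma euler_src (n : nat) : euler (fun t => src_coef (a t) (b t) (k t) n) n.
Proof.
  do 4 (destruct n as [|n]; [apply euler_zero|]).
  destruct n as [|n].
  { apply (euler_mult a (fun _ => / 2) 4 0); [|apply euler_const].
    eapply is_Cderive_eq; [exact Ha|]. replace (INR 4) with 4%R by (simpl; ring). reflexivity. }
  destruct n as [|n].
  { eapply is_Cderive_eq; [exact Hb|]. replace (INR 5) with 5%R by (simpl; ring). reflexivity. }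
  destruct n as [|n]; [|apply euler_zero].
  apply (euler_mult (fun t => - k t) (fun _ => / 4) 6 0); [|apply euler_const].
  assert (G : euler (fun t => (- (1)) * k t) (0 + 6)).
  { apply euler_mult; [apply euler_const|].
    eapply is_Cderive_eq; [exact Hk|]. replace (INR 6) with 6%R by (simpl; ring). reflexivity. }
  unfold euler in *. simpl Nat.add in G.
  eapply is_Cderive_eq; [eapply is_derive_ext; [|exact G]|].
  - intros t. simpl. ring.
  - ring.
Qed.

Lemma euler_damp (n : nat) : euler (fun t => damp_coef (b t) n) 5.
Proof.
  assert (G : euler (fun t => b t * (- / RtoC (INR (n + 3) * INR (n + 1)))) (5 + 0)).
  { apply euler_mult; [|apply euler_const].
    eapply is_Cderive_eq; [exact Hb|]. replace (INR 5) with 5%R by (simpl; ring). reflexivity. }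
  unfold euler in *. simpl Nat.add in G. unfold damp_coef.
  eapply is_Cderive_eq; [eapply is_derive_ext; [|exact G]|].
  - intros t. simpl. unfold Cdiv. ring.
  - unfold Cdiv. ring.
Qed.

Lemma euler_e_coef (f : nat -> C -> C) (n : nat) : (forall i, euler (f i) i) ->
  euler (fun t => e_coef (K := C_Ring) (src_coef (a t) (b t) (k t)) (damp_coef (b t))
    (fun i => f i t) n) n.
Proof.
  intros Hf. unfold e_coef. apply euler_plus; [apply euler_src|].
  do 7 (destruct n as [|n]; [apply euler_zero|]).
  apply (euler_mult (fun t => damp_coef (b t) n) (f (S (S n))) 5 (S (S n)));
    [apply euler_damp|apply Hf].
Qed.

(** Each ring operation of the recursion respects the weights, the degree 5 of [damp_coef] making up
    for the index shift by 5; so every iterate is homogeneous. *)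
Lemma euler_m_coef (n : nat) : euler (fun t => m_coef (a t) (b t) (k t) n) n.
Proof.
  unfold m_coef, rec_sol.
  assert (G : forall j n, euler (fun t => rec_iter (K := C_Ring) (RtoC (- / 2))
    (src_coef (a t) (b t) (k t)) (damp_coef (b t)) j n) n); [|apply G].
  clear n. induction j as [|j IH]; intros n; [apply euler_zero|].
  simpl. unfold rec_step.
  apply (euler_mult (fun _ => RtoC (- / 2)) _ 0 n); [apply euler_const|].
  apply euler_plus; [apply euler_conv; exact IH|].
  apply euler_conv; [intros i; now apply euler_e_coef|].
  intros i.
  apply (euler_conv
    (fun i t => one_plus (K := C_Ring) (rec_iter (K := C_Ring) (RtoC (- / 2))
       (src_coef (a t) (b t) (k t)) (damp_coef (b t)) j) i)
    (fun i t => one_plus (K := C_Ring) (rec_iter (K := C_Ring) (RtoC (- / 2))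
       (src_coef (a t) (b t) (k t)) (damp_coef (b t)) j) i));
  intros i'; unfold one_plus; (apply euler_plus; [|apply IH]);
  (destruct i'; [apply euler_const|apply euler_zero]).
Qed.

Lemma euler_exc_coef (n : nat) : euler (fun t => exc_coef (a t) (b t) (k t) n) n.
Proof. apply (euler_e_coef (fun i t => m_coef (a t) (b t) (k t) i)), euler_m_coef. Qed.

Lemma euler_psi_coef (n : nat) : euler (fun t => psi_coef (a t) (b t) (k t) n) n.
Proof.
  assert (G := euler_mult _ _ _ _ (euler_m_coef n) (euler_const (/ RtoC (INR (n + 1))))).
  rewrite Nat.add_0_r in G. exact G.
Qed.

Lemma Cderive_lipschitz (f : C -> C) (x l : C) : is_Cderive f x l ->
  exists d L : R, (0 < d)%R /\ (0 <= L)%R /\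
    forall t, (Cmod (t - x) < d)%R -> (Cmod (f t - f x) <= L * Cmod (t - x))%R.
Proof.
  intros H. destruct (proj1 (is_derive_C_eps _ _ _) H (mkposreal 1 Rlt_0_1)) as [d Hd].
  exists d, (1 + Cmod l)%R. split; [apply cond_pos|]. split.
  { assert (H0 := Cmod_ge_0 l). lra. }
  intros t Ht. specialize (Hd t Ht). simpl in Hd.
  replace (f t - f x)%C with ((f t - f x - (t - x) * l) + (t - x) * l)%C by ring.
  eapply Rle_trans; [apply Cmod_triangle|]. rewrite Cmod_mult. lra.
Qed.

(** A differentiable curve is Lipschitz at [t0], and the gap between [1 / 40] and the moduli at [t0]
    keeps it in the box nearby. *)
Lemma curve_domination : exists d L : R, (0 < d)%R /\ (0 <= L)%R /\
  forall t, (Cmod (t - t0) < d)%R ->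
    small (a t) (b t) (k t) /\
    (40 * (Cmod (a t - a t0) + Cmod (b t - b t0) + Cmod (k t - k t0)) <= L * Cmod (t - t0))%R.
Proof.
  destruct (Cderive_lipschitz _ _ _ Ha) as (d1 & L1 & D1 & P1 & H1).
  destruct (Cderive_lipschitz _ _ _ Hb) as (d2 & L2 & D2 & P2 & H2).
  destruct (Cderive_lipschitz _ _ _ Hk) as (d3 & L3 & D3 & P3 & H3).
  destruct Hsmall as (S1 & S2 & S3).
  set (g := Rmin (/ 40 - Cmod (a t0)) (Rmin (/ 40 - Cmod (b t0)) (/ 40 - Cmod (k t0)))).
  assert (Hg : (0 < g)%R) by (unfold g; repeat apply Rmin_glb_lt; lra).
  assert (G1 : (g <= / 40 - Cmod (a t0))%R) by apply Rmin_l.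
  assert (G2 : (g <= / 40 - Cmod (b t0))%R)
    by (eapply Rle_trans; [apply Rmin_r|apply Rmin_l]).
  assert (G3 : (g <= / 40 - Cmod (k t0))%R)
    by (eapply Rle_trans; [apply Rmin_r|apply Rmin_r]).
  set (L := (L1 + L2 + L3 + 1)%R).
  assert (HL : (0 < L)%R) by (unfold L; lra).
  set (d := Rmin (g / L) (Rmin d1 (Rmin d2 d3))).
  assert (Hd : (0 < d)%R).
  { unfold d. repeat apply Rmin_glb_lt; try lra. apply Rdiv_lt_0_compat; lra. }
  exists d, (40 * L)%R. split; [exact Hd|]. split; [lra|].
  intros t Ht.
  assert (T0 : (Cmod (t - t0) < g / L)%R) by (apply (Rlt_le_trans _ _ _ Ht), Rmin_l).
  assert (T1 : (Cmod (t - t0) < d1)%R).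
  { apply (Rlt_le_trans _ _ _ Ht). eapply Rle_trans; [apply Rmin_r|apply Rmin_l]. }
  assert (T2 : (Cmod (t - t0) < d2)%R).
  { apply (Rlt_le_trans _ _ _ Ht). eapply Rle_trans; [apply Rmin_r|].
    eapply Rle_trans; [apply Rmin_r|apply Rmin_l]. }
  assert (T3 : (Cmod (t - t0) < d3)%R).
  { apply (Rlt_le_trans _ _ _ Ht). eapply Rle_trans; [apply Rmin_r|].
    eapply Rle_trans; [apply Rmin_r|apply Rmin_r]. }
  specialize (H1 t T1). specialize (H2 t T2). specialize (H3 t T3).
  assert (Tg : (L * Cmod (t - t0) < g)%R).
  { apply Rmult_lt_compat_l with (r := L) in T0; [|exact HL].
    replace (L * (g / L))%R with g in T0 by (field; lra). exact T0. }
  assert (C0 := Cmod_ge_0 (t - t0)).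
  assert (Q1 : (0 <= L1 * Cmod (t - t0))%R) by (apply Rmult_le_pos; lra).
  assert (Q2 : (0 <= L2 * Cmod (t - t0))%R) by (apply Rmult_le_pos; lra).
  assert (Q3 : (0 <= L3 * Cmod (t - t0))%R) by (apply Rmult_le_pos; lra).
  assert (EL : (L * Cmod (t - t0) = L1 * Cmod (t - t0) + L2 * Cmod (t - t0) +
    L3 * Cmod (t - t0) + Cmod (t - t0))%R) by (unfold L; ring).
  assert (T : forall z z' : C, (Cmod z' <= Cmod z + Cmod (z' - z))%R).
  { intros z z'. replace z' with (z + (z' - z))%C at 1 by ring. apply Cmod_triangle. }
  assert (W1 := T (a t0) (a t)). assert (W2 := T (b t0) (b t)). assert (W3 := T (k t0) (k t)).
  split; [repeat split; lra|lra].
Qed.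

Lemma small_le (x y z : C) : small x y z ->
  (Cmod x <= / 20)%R /\ (Cmod y <= / 20)%R /\ (Cmod z <= / 20)%R.
Proof. intros (H1 & H2 & H3). lra. Qed.

(** Termwise [n psi_n = m_n - psi_n], because [(n + 1) psi_n = m_n]. *)
Lemma is_Cderive_psi :
  is_Cderive (fun t => psi_fun (a t) (b t) (k t)) t0
    (al * (m_fun (a t0) (b t0) (k t0) - 1 - psi_fun (a t0) (b t0) (k t0))).
Proof.
  destruct curve_domination as (d & L & Hd & HL & H).
  apply (is_Cderive_Cseries (fun n t => psi_coef (a t) (b t) (k t) n)
    (fun n => RtoC (INR n) * al * psi_coef (a t0) (b t0) (k t0) n)
    (fun n => m_maj n * L)%R m_maj (1 / 5 * L)%R (1 / 5)%R t0 _ d).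
  - exact (summable_below_scal_r _ _ L HL summable_m_maj).
  - exact summable_m_maj.
  - exact Hd.
  - exact euler_psi_coef.
  - intros t Ht n. destruct (H t Ht) as [Hs Hl].
    destruct (small_le _ _ _ Hs) as (B1 & B2 & B3).
    split; [apply (coef_bounds _ _ _ B1 B2 B3)|].
    eapply Rle_trans; [apply (coef_lipschitz _ _ _ _ _ _ n Hsmall Hs)|].
    rewrite Rmult_assoc. apply Rmult_le_compat_l; [apply summable_m_maj|exact Hl].
  - destruct (small_le _ _ _ Hsmall) as (B1 & B2 & B3).
    eapply is_series_ext.
    2: { apply (is_series_scal (V := C_NormedModule) al).
         apply (is_series_minus (V := C_NormedModule)).
         - exact (is_series_m _ _ _ B1 B2 B3).
         - exact (is_series_psi _ _ _ B1 B2 B3). }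
    intros n. unfold psi_coef. unfold scal, minus, plus, opp; simpl.
    change (@mult C_Ring) with Cmult.
    rewrite plus_INR. simpl (INR 1). rewrite RtoC_plus.
    unfold mult; simpl. field.
    assert (Hn := pos_INR n). intros E. cbv beta in E. rewrite <- RtoC_plus in E. apply RtoC_inj in E. lra.
Qed.

(** Homogeneity produces [n e_n], which is [6 e_n - ode_coef n]; the subtracted series is
    [rho ^ 4 x] in terms of [a], [b] and [psi]. *)
Lemma is_Cderive_exc :
  is_Cderive (fun t => exc_fun (a t) (b t) (k t)) t0
    (al * (6 * exc_fun (a t0) (b t0) (k t0) -
      (a t0 + b t0 + b t0 * psi_fun (a t0) (b t0) (k t0)))).
Proof.
  destruct curve_domination as (d & L & Hd & HL & H).
  apply (is_Cderive_Cseries (fun n t => exc_coef (a t) (b t) (k t) n)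
    (fun n => RtoC (INR n) * al * exc_coef (a t0) (b t0) (k t0) n)
    (fun n => exc_maj n * L)%R exc_maj ((3 / 20 + / 20 * (1 / 5)) * L)%R
    (3 / 20 + / 20 * (1 / 5))%R t0 _ d).
  - exact (summable_below_scal_r _ _ L HL summable_exc_maj).
  - exact summable_exc_maj.
  - exact Hd.
  - exact euler_exc_coef.
  - intros t Ht n. destruct (H t Ht) as [Hs Hl].
    destruct (small_le _ _ _ Hs) as (B1 & B2 & B3).
    split; [apply (coef_bounds _ _ _ B1 B2 B3)|].
    eapply Rle_trans; [apply (coef_lipschitz _ _ _ _ _ _ n Hsmall Hs)|].
    rewrite Rmult_assoc. apply Rmult_le_compat_l; [apply summable_exc_maj|exact Hl].
  - destruct (small_le _ _ _ Hsmall) as (B1 & B2 & B3).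
    eapply is_series_ext.
    2: { apply (is_series_scal (V := C_NormedModule) al).
         apply (is_series_minus (V := C_NormedModule)).
         - apply (is_series_scal (V := C_NormedModule) (RtoC 6)).
           exact (is_series_exc _ _ _ B1 B2 B3).
         - exact (is_series_ode_coef _ _ _ _ (is_series_psi _ _ _ B1 B2 B3)). }
    intros n.
    change (al * (6 * exc_coef (a t0) (b t0) (k t0) n - ode_coef (a t0) (b t0) (k t0) n) =
      RtoC (INR n) * al * exc_coef (a t0) (b t0) (k t0) n).
    rewrite <- exc_coef_ode. ring.
Qed.

(** Existence is enough: the value is found afterwards by differentiating an algebraic identity,
    [mu ^ 2 = 4 w] or [m ^ 2 (1 + e) = 1]. *)
Lemma ex_Cderive_m :
  exists l, is_Cderive (fun t => m_fun (a t) (b t) (k t)) t0 l.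
Proof.
  destruct curve_domination as (d & L & Hd & HL & H).
  assert (G : ex_filterdiff (U := C_NormedModule) (V := C_NormedModule)
    (fun t => Cseries (fun n => m_coef (a t) (b t) (k t) n)) (locally t0)).
  { eexists. apply (filterdiff_Cseries (U := C_NormedModule)
      (fun n t => m_coef (a t) (b t) (k t) n)
      (fun n h => h * (RtoC (INR n) * al * m_coef (a t0) (b t0) (k t0) n))
      (fun n => m_maj n * L)%R m_maj (1 / 5 * L)%R (1 / 5)%R t0).
    - exact (summable_below_scal_r _ _ L HL summable_m_maj).
    - exact summable_m_maj.
    - intros n. apply is_derive_C_iff, euler_m_coef.
    - apply (locally_iff_norm (U := C_NormedModule)). exists (mkposreal d Hd).
      intros t Ht n. destruct (H t Ht) as [Hs Hl].
      destruct (small_le _ _ _ Hs) as (B1 & B2 & B3).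
      split; [apply (coef_bounds _ _ _ B1 B2 B3)|].
      eapply Rle_trans; [apply (coef_lipschitz _ _ _ _ _ _ n Hsmall Hs)|].
      rewrite Rmult_assoc. apply Rmult_le_compat_l; [apply summable_m_maj|exact Hl]. }
  destruct (proj2 (ex_derive_C_iff _ _) G) as [l Hl].
  exists (0 + l). apply is_Cderive_plus; [apply is_Cderive_const|exact Hl].
Qed.

End AlongCurve.

(** * The map *)

Definition kap (w : C) : C := 4 - / w.
Definition mu (w : C) : C := m_fun 0 0 (kap w).
Definition rho (v w : C) : C := v * mu w / 2.
Definition pole (t v w : C) : C := t - rho v w * (1 + psi_fun 0 0 (kap w)).
Definition coef_a (t v w : C) : C := pole t v w * rho v w ^ 4.
Definition coef_b (v w : C) : C := rho v w ^ 5.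
Definition mfun (t v w : C) : C := m_fun (coef_a t v w) (coef_b v w) (kap w).
Definition gam (t v w : C) : C :=
  pole t v w + rho v w * (1 + psi_fun (coef_a t v w) (coef_b v w) (kap w)).
Definition eta (t v w : C) : C := v * mu w / mfun t v w.
Definition tht (t v w : C) : C := mfun t v w ^ 2 / 4.

(** On the polydisk [pole] is of size [1 + Cmod x0], so the radii in [v] and [w] are inversely
    proportional to it; 10000 leaves room in all later estimates. *)
Definition inv_radius (x0 : C) : R := (10000 * (1 + Cmod x0))%R.
Definition Delta (x0 : C) : C3 -> Prop := polydisk x0 (inv_radius x0) (/ inv_radius x0).

Lemma inv_radius_ge (x0 : C) : (10000 <= inv_radius x0)%R.
Proof. unfold inv_radius. assert (H := Cmod_ge_0 x0). lra. Qed.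

Lemma Cminus_0_r (z : C) : z - 0 = z.
Proof. ring. Qed.

Lemma Delta_box (x0 : C) (p : C3) :
  Delta x0 p <-> box x0 0 (1 / 4) 1 (/ inv_radius x0) (/ inv_radius x0) p.
Proof.
  destruct p as [[t v] w]. unfold Delta, polydisk, box; simpl.
  rewrite Cminus_0_r. tauto.
Qed.

Lemma open_Delta (x0 : C) : open (Delta x0).
Proof.
  apply (open_ext (box x0 0 (1 / 4) 1 (/ inv_radius x0) (/ inv_radius x0))).
  - intros p. symmetry. apply Delta_box.
  - apply open_box.
Qed.

(** Inverses come from the geometric series, the norm being closed under summable series; the ratio
    [1 / 2] gives the bound 2. *)
Lemma mn_geometric {X : Type} {D : X -> Prop} {N : (X -> C) -> R -> Prop} (g : X -> C) :
  majorant_norm D N -> N g (/ 2)%R -> N (fun x => / (1 + g x)) 2%R.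
Proof.
  intros HN Hg.
  assert (Hg' : N (fun x => - g x) (/ 2)%R).
  { apply (mn_ext _ _ HN) with (fun x => - (1) * g x).
    - intros x _. ring.
    - apply (mn_le _ _ HN _ (Cmod (- (1)) * / 2)%R); [now apply (mn_scal HN)|].
      rewrite Cmod_opp, Cmod_1. lra. }
  assert (Hn : forall n, N (fun x => (- g x) ^ n) ((/ 2) ^ n)%R).
  { induction n as [|n IH]; [apply (mn_one HN)|]. now apply (mn_mult _ _ HN). }
  assert (Hs : summable_below (fun n => (/ 2) ^ n)%R 2).
  { split; [intros n; apply pow_le; lra|]. intros K.
    assert (E : sum_n (fun n => (/ 2) ^ n)%R K = (2 - (/ 2) ^ K)%R).
    { induction K as [|K IH]; [rewrite sum_O; simpl; ring|].
      rewrite sum_Sn, IH. unfold plus; simpl. field. }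
    rewrite E. assert (H : (0 < (/ 2) ^ K)%R) by (apply pow_lt; lra). lra. }
  eapply (mn_ext _ _ HN); [|apply (mn_series _ _ HN (fun n x => (- g x) ^ n) _ _ Hn Hs)].
  intros x Hx. simpl.
  assert (B : forall n, (Cmod ((- g x) ^ n) <= (/ 2) ^ n)%R).
  { intros n. exact (mn_bound _ _ HN _ _ (Hn n) x Hx). }
  assert (H1 : 1 + g x <> 0).
  { intros E. assert (H := mn_bound _ _ HN _ _ Hg x Hx).
    replace (g x) with (- (1))%C in H.
    - rewrite Cmod_opp, Cmod_1 in H. lra.
    - replace (g x) with (1 + g x - 1)%C by ring. rewrite E. ring. }
  apply Cseries_unique, is_series_C_iff. intros eps He.
  assert (E : forall n, sum_n (fun n => (- g x) ^ n) n - / (1 + g x) =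
    - ((- g x) ^ S n / (1 + g x))).
  { induction n as [|n IH].
    - rewrite sum_O. simpl. field. exact H1.
    - rewrite sum_Sn. unfold plus; simpl.
      replace (sum_n (fun n => (- g x) ^ n) n + - g x * (- g x) ^ n - / (1 + g x))%C
        with ((sum_n (fun n => (- g x) ^ n) n - / (1 + g x)) + - g x * (- g x) ^ n)%C by ring.
      rewrite IH. simpl. field. exact H1. }
  assert (Hm : (0 < Cmod (1 + g x))%R) by now apply Cmod_gt_0.
  destruct (pow_lt_1_zero (/ 2)) with (y := (eps * Cmod (1 + g x))%R) as [n0 Hn0].
  { rewrite Rabs_pos_eq; lra. }
  { nra. }
  exists n0. intros n Hn'. change (Cmod (sum_n (fun n => ((- g x) ^ n)%C) n - / (1 + g x)) < eps)%R.
  rewrite E, Cmod_opp, Cmod_div by exact H1.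
  specialize (Hn0 (S n) ltac:(lia)).
  rewrite Rabs_pos_eq in Hn0 by (apply pow_le; lra).
  apply Rmult_lt_reg_r with (Cmod (1 + g x)); [exact Hm|].
  unfold Rdiv. rewrite Rmult_assoc, Rinv_l, Rmult_1_r by lra.
  eapply Rle_lt_trans; [apply B|exact Hn0].
Qed.

Lemma small_kap_w (w : C) : (Cmod (w - 1 / 4) < / 10000)%R ->
  w <> 0 /\ (Cmod (kap w) < / 40)%R.
Proof.
  intros H.
  assert (Hw : (24 / 100 < Cmod w)%R).
  { assert (T := Cmod_triangle w (- (w - 1 / 4))). rewrite Cmod_opp in T.
    replace (w + - (w - 1 / 4))%C with (RtoC (/ 4)) in T
      by (rewrite RtoC_inv by lra; field).
    rewrite Cmod_R, Rabs_pos_eq in T by lra. lra. }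
  assert (Hw0 : w <> 0).
  { intros ->. rewrite Cmod_0 in Hw. lra. }
  split; [exact Hw0|].
  unfold kap. replace (4 - / w)%C with (4 * (w - 1 / 4) / w)%C by (field; exact Hw0).
  rewrite Cmod_div, Cmod_mult, Cmod_R, Rabs_pos_eq by (auto; lra).
  apply Rmult_lt_reg_r with (Cmod w); [lra|].
  unfold Rdiv. rewrite Rmult_assoc, Rinv_l, Rmult_1_r by lra. lra.
Qed.

(** With [b = 0] there is no feedback of [m] into [e], and [a = 0] leaves only the resonant term. *)
Lemma exc_fun_00 (k : C) : exc_fun 0 0 k = - k / 4.
Proof.
  unfold exc_fun. apply Cseries_unique, (is_series_decr_n (V := C_NormedModule) _ 6); [lia|].
  assert (Z : forall n, exc_coef 0 0 k n = src_coef 0 0 k n).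
  { intros n. unfold exc_coef, e_coef.
    do 7 (destruct n as [|n]; [apply Cplus_0_r|]).
    unfold damp_coef. unfold plus, mult; simpl. unfold Cdiv. ring. }
  eapply is_series_ext.
  2: { assert (E : plus (- k / 4) (opp (sum_n (exc_coef 0 0 k) (pred 6))) = - k / 4).
       { simpl pred. rewrite !sum_Sn, sum_O, !Z. simpl. unfold plus, opp; simpl.
         unfold Cdiv. ring. }
       match goal with |- is_series _ ?u =>
         replace u with (- k / 4)%C by (symmetry; exact E) end.
       apply (is_series_indicator0 (- k / 4)). }
  intros n. change (6 + n)%nat with (S (S (S (S (S (S n)))))). rewrite Z.
  destruct n as [|n]; reflexivity.
Qed.

(** At [a = b = 0] the identity for [m] reads [mu ^ 2 (1 - k / 4) = 1], and
    [1 - k / 4 = 1 / (4 w)]. *)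
Lemma mu_sqr (w : C) : (Cmod (w - 1 / 4) < / 10000)%R -> mu w ^ 2 = 4 * w.
Proof.
  intros H. destruct (small_kap_w w H) as [Hw Hk].
  assert (E := m_exc_identity 0 0 (kap w)). rewrite exc_fun_00 in E.
  rewrite Cmod_0 in E. specialize (E ltac:(lra) ltac:(lra) ltac:(lra)).
  fold (mu w) in E.
  assert (E2 : 1 + - kap w / 4 = / (4 * w)).
  { unfold kap. field. exact Hw. }
  rewrite E2 in E.
  replace (mu w ^ 2)%C with (mu w ^ 2 * / (4 * w) * (4 * w))%C.
  - rewrite E. ring.
  - field. exact Hw.
Qed.

Lemma mu_near_1 (w : C) : (Cmod (w - 1 / 4) < / 10000)%R ->
  (Cmod (mu w - 1) <= 1 / 5)%R /\ mu w <> 0.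
Proof.
  intros H. destruct (small_kap_w w H) as [Hw Hk].
  assert (H0 : (Cmod 0 <= / 20)%R) by (rewrite Cmod_0; lra).
  assert (H1 : (Cmod (kap w) <= / 20)%R) by lra.
  split.
  - exact (m_fun_near_1 0 0 (kap w) H0 H0 H1).
  - exact (m_fun_neq_0 0 0 (kap w) H0 H0 H1).
Qed.

Lemma kap_eq (w : C) : w <> 0 ->
  kap w = 16 * ((w - 1 / 4) * / (1 + 4 * (w - 1 / 4))).
Proof.
  intros Hw. unfold kap.
  replace (1 + 4 * (w - 1 / 4))%C with (4 * w)%C by field.
  field. exact Hw.
Qed.

(** * Estimates on the polydisk *)

Section Estimates.
Variable x0 : C.
Let A : R := (1 + Cmod x0)%R.
Let r : R := (/ inv_radius x0)%R.

Lemma A_ge_1 : (1 <= A)%R.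
Proof. unfold A. assert (H := Cmod_ge_0 x0). lra. Qed.

Lemma rA : (r * A = / 10000)%R.
Proof. unfold r, inv_radius. fold A. assert (H := A_ge_1). field. lra. Qed.

Lemma r_bounds : (0 < r <= / 10000)%R.
Proof.
  assert (H := inv_radius_ge x0). unfold r. split.
  - apply Rinv_0_lt_compat. lra.
  - apply Rinv_le_contravar; lra.
Qed.

(** All pairs [(t, w)] are allowed; where the slice misses the polydisk, the condition on values is
    vacuous and [M >= 0] suffices, with zero coefficients. *)
Definition slice_norm (f : C3 -> C) (M : R) : Prop :=
  forall i : C * C, ps_norm (fun v => Delta x0 (fst i, v, snd i)) r
    (fun v => f (fst i, v, snd i)) M.

Definition Delta_norm (f : C3 -> C) (M : R) : Prop :=
  lip_norm (Delta x0) r f M /\ slice_norm f M.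

Lemma majorant_Delta_norm : majorant_norm (Delta x0) Delta_norm.
Proof.
  destruct r_bounds as [R1 R2].
  apply majorant_conj.
  - apply majorant_lip_norm; [apply open_Delta|exact R1].
  - apply (majorant_slices (I := C * C) (Y := C) (Delta x0)
      (fun i v => (fst i, v, snd i) : C3)
      (fun i => ps_norm (fun v => Delta x0 (fst i, v, snd i)) r)).
    + exact (inhabits (RtoC 0, RtoC 0)).
    + intros [[t v] w] _. exists (t, w), v. reflexivity.
    + intros i. apply majorant_ps_norm; [exact R1|].
      intros v (_ & H & _). apply Rlt_le, H.
Qed.

Let HN := majorant_Delta_norm.

Lemma slice_norm_const_in_v (f : C -> C -> C) (M : R) : (0 <= M)%R ->
  (forall t v w : C, Delta x0 (t, v, w) -> (Cmod (f t w) <= M)%R) ->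
  slice_norm (fun p => f (fst (fst p)) (snd p)) M.
Proof.
  intros HM Hf [t w]. simpl.
  destruct (excluded_middle_informative (exists v, Delta x0 (t, v, w))) as [[v Hv]|Hno].
  - assert (HP : majorant_norm (fun v => Delta x0 (t, v, w))
      (ps_norm (fun v => Delta x0 (t, v, w)) r)).
    { apply majorant_ps_norm; [apply r_bounds|]. intros v' (_ & H & _). apply Rlt_le, H. }
    apply (mn_le _ _ HP _ (Cmod (f t w))); [apply (mn_const _ _ HP)|].
    exact (Hf t v w Hv).
  - exists (fun _ => RtoC 0). split.
    + apply (summable_below_le _ (fun _ => 0)%R).
      * intros n. rewrite Cmod_0. lra.
      * split; [intros; lra|]. intros K. eapply Rle_trans; [right|exact HM].
        induction K as [|K IH]; [apply sum_O|]. rewrite sum_Sn, IH. apply Rplus_0_l.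
    + intros v Hv. exfalso. apply Hno. now exists v.
Qed.

(** As for the other coordinates, the sup bound is increased by [sigma = r] times the Lipschitz
    constant 1. *)
Lemma norm_t : Delta_norm (fun p => fst (fst p)) (A + r)%R.
Proof.
  assert (HA := A_ge_1). assert (Hr := r_bounds).
  assert (B : forall p, Delta x0 p -> (Cmod (fst (fst p)) <= A)%R).
  { intros p Hp. apply Delta_box in Hp. destruct Hp as (H & _ & _).
    replace (fst (fst p)) with ((fst (fst p) - x0) + x0)%C by ring.
    eapply Rle_trans; [apply Cmod_triangle|]. unfold A. lra. }
  split.
  - apply lip_norm_coord; [lra|lra|exact B|intros; apply coord1_le|apply is_linear_coord1].
  - apply (slice_norm_const_in_v (fun t _ => t)); [lra|].
    intros t v w Hp. apply Rle_trans with A; [|lra]. exact (B _ Hp).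
Qed.

Lemma norm_w : Delta_norm (fun p => snd p - 1 / 4) (2 * r)%R.
Proof.
  assert (Hr := r_bounds).
  assert (B : forall p, Delta x0 p -> (Cmod (snd p - 1 / 4) <= r)%R).
  { intros p Hp. apply Delta_box in Hp. apply Rlt_le, Hp. }
  split.
  - exists r, 1%R. repeat split; try lra; auto.
    + intros p q _ _. rewrite Rmult_1_l.
      replace (snd q - 1 / 4 - (snd p - 1 / 4))%C with (snd q - snd p)%C by ring.
      apply coord3_le.
    + intros p _. eexists. apply (filterdiff_Cplus (U := C3) (fun p => snd p) (fun _ => - (1 / 4))).
      * apply (filterdiff_linear (U := C3) (V := C_NormedModule)), is_linear_coord3.
      * apply (filterdiff_const (V := C_NormedModule)).
  - apply (slice_norm_const_in_v (fun _ w => w - 1 / 4)%C); [lra|].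
    intros t v w Hp. apply Rle_trans with r; [|lra]. exact (B _ Hp).
Qed.

Lemma norm_v : Delta_norm (fun p => snd (fst p)) (2 * r)%R.
Proof.
  assert (Hr := r_bounds).
  assert (B : forall p, Delta x0 p -> (Cmod (snd (fst p)) <= r)%R).
  { intros [[t v] w] (_ & H & _). apply Rlt_le, H. }
  split.
  - replace (2 * r)%R with (r + r)%R by ring.
    apply lip_norm_coord; [lra|lra|exact B|intros; apply coord2_le|apply is_linear_coord2].
  - intros [t w]. simpl.
    exists (fun n => match n with 1%nat => RtoC 1 | _ => RtoC 0 end). split.
    + split.
      * intros n. apply Rmult_le_pos; [apply Cmod_ge_0|apply pow_le; lra].
      * intros K. apply Rle_trans with r; [|lra].
        destruct K as [|K]; [rewrite sum_O, Cmod_0; lra|].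
        right. induction K as [|K IH].
        -- rewrite sum_Sn, sum_O, Cmod_0, Cmod_1. unfold plus; simpl. ring.
        -- rewrite sum_Sn, IH, Cmod_0, Rmult_0_l. apply Rplus_0_r.
    + intros v _. apply (is_series_decr_1 (V := C_NormedModule)).
      eapply is_series_ext; [|apply (is_series_indicator0
        (plus v (opp (RtoC 0 * v ^ 0))))].
      intros [|n]; simpl; unfold plus, opp; simpl; ring.
Qed.

Lemma norm_kap : Delta_norm (fun p => kap (snd p)) (64 * r)%R.
Proof.
  destruct r_bounds as [R1 R2].
  assert (H4 : Delta_norm (fun p => 4 * (snd p - 1 / 4)) (/ 2)%R).
  { apply (mn_le _ _ HN _ (Cmod 4 * (2 * r))%R); [apply (mn_scal HN), norm_w|].
    rewrite Cmod_R, Rabs_pos_eq; lra. }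
  apply (mn_ext _ _ HN) with
    (fun p => 16 * ((snd p - 1 / 4) * / (1 + 4 * (snd p - 1 / 4)))).
  - intros p Hp. apply Delta_box in Hp. destruct Hp as (_ & _ & H).
    destruct (small_kap_w (snd p)) as [Hw _]. { fold r in H. lra. }
    exact (eq_sym (kap_eq _ Hw)).
  - apply (mn_le _ _ HN _ (Cmod 16 * ((2 * r) * 2))%R).
    + apply (mn_scal HN), (mn_mult _ _ HN); [apply norm_w|]. now apply (mn_geometric _ HN).
    + rewrite Cmod_R, Rabs_pos_eq; lra.
Qed.


Lemma norm_0 (M : R) : (0 <= M)%R -> Delta_norm (fun _ => RtoC 0) M.
Proof. intros H. apply (mn_le _ _ HN _ 0%R); [apply (mn_zero HN)|exact H]. Qed.

Lemma norm_kap_le : Delta_norm (fun p => kap (snd p)) (/ 20)%R.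
Proof.
  assert (Hr := r_bounds). apply (mn_le _ _ HN _ _ _ norm_kap). lra.
Qed.

Lemma norm_mu : Delta_norm (fun p => mu (snd p)) (6 / 5)%R.
Proof.
  replace (6 / 5)%R with (1 + 1 / 5)%R by field.
  apply (mn_plus _ _ HN (fun _ => RtoC 1)); [apply (mn_one HN)|].
  apply (mn_m_series HN (fun _ => RtoC 0) (fun _ => RtoC 0) (fun p => kap (snd p)));
    [apply norm_0; lra|apply norm_0; lra|exact norm_kap_le].
Qed.

Lemma norm_phi : Delta_norm (fun p => 1 + psi_fun 0 0 (kap (snd p))) (6 / 5)%R.
Proof.
  replace (6 / 5)%R with (1 + 1 / 5)%R by field.
  apply (mn_plus _ _ HN (fun _ => RtoC 1)); [apply (mn_one HN)|].
  apply (mn_psi_fun HN (fun _ => RtoC 0) (fun _ => RtoC 0) (fun p => kap (snd p)));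
    [apply norm_0; lra|apply norm_0; lra|exact norm_kap_le].
Qed.

Lemma norm_div (f : C3 -> C) (M c : R) : (0 < c)%R ->
  Delta_norm f M -> Delta_norm (fun p => f p / RtoC c) (M * / c)%R.
Proof.
  intros Hc Hf. apply (mn_mult _ _ HN f (fun _ => / RtoC c)); [exact Hf|].
  apply (mn_le _ _ HN _ (Cmod (/ RtoC c))); [apply (mn_const _ _ HN)|].
  rewrite <- RtoC_inv by lra. rewrite Cmod_R, Rabs_pos_eq; [lra|].
  apply Rlt_le, Rinv_0_lt_compat, Hc.
Qed.

Lemma norm_pow (f : C3 -> C) (M : R) (n : nat) :
  Delta_norm f M -> Delta_norm (fun p => f p ^ n) (M ^ n)%R.
Proof.
  intros Hf. induction n as [|n IH]; [apply (mn_one HN)|].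
  exact (mn_mult _ _ HN f (fun p => f p ^ n) _ _ Hf IH).
Qed.

Lemma norm_rho : Delta_norm (fun p => rho (snd (fst p)) (snd p)) (2 * r)%R.
Proof.
  assert (Hr := r_bounds).
  apply (mn_le _ _ HN _ ((2 * r) * (6 / 5) * / 2)%R); [|lra].
  apply (norm_div (fun p => snd (fst p) * mu (snd p))); [lra|].
  apply (mn_mult _ _ HN); [exact norm_v|exact norm_mu].
Qed.

Lemma norm_pole :
  Delta_norm (fun p => pole (fst (fst p)) (snd (fst p)) (snd p)) (A + 1)%R.
Proof.
  assert (Hr := r_bounds).
  apply (mn_le _ _ HN _ ((A + r) + Cmod (- (1)) * ((2 * r) * (6 / 5)))%R).
  2: { rewrite Cmod_opp, Cmod_1. lra. }
  apply (mn_ext _ _ HN) with (fun p => fst (fst p) + - (1) *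
    (rho (snd (fst p)) (snd p) * (1 + psi_fun 0 0 (kap (snd p))))).
  { intros [[t v] w] _. unfold pole; simpl. ring. }
  apply (mn_plus _ _ HN); [exact norm_t|].
  apply (mn_scal HN (- (1)) (fun p : C3 =>
    rho (snd (fst p)) (snd p) * (1 + psi_fun 0 0 (kap (snd p))))).
  apply (mn_mult _ _ HN); [exact norm_rho|exact norm_phi].
Qed.

Lemma norm_v4 : Delta_norm (fun p => snd (fst p) ^ 4) ((2 * r) ^ 4)%R.
Proof. apply (norm_pow _ _ 4 norm_v). Qed.

(** [r A = 1 / 10000] absorbs the size of [x0]. A factor [r] is kept on the right because dividing
    by [sigma = r] then gives Lipschitz constant [1 / 1000] to any [v ^ 4 G] with [G] of norm
    [2 A]. *)
Lemma v4_small : ((2 * r) ^ 4 * (2 * A) <= r * / 1000)%R.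
Proof.
  assert (Hr := r_bounds). assert (HrA := rA).
  replace ((2 * r) ^ 4 * (2 * A))%R with (32 * (r * A) * (r * r * r))%R by ring.
  rewrite HrA. assert (H1 : (r * r * r <= r * / 1000)%R).
  { assert (r * r <= / 1000)%R by nra. nra. }
  lra.
Qed.

(* Both [a] and [b] are divisible by [v^4]; hence so is the difference between
   a series at [(a, b, k)] and the same series at [(0, 0, k)]. *)
Lemma series_increments : exists gm gp : C3 -> C,
  Delta_norm gm (2 * A)%R /\ Delta_norm gp (2 * A)%R /\
  forall t v w : C, Delta x0 (t, v, w) ->
    mfun t v w = mu w + v ^ 4 * gm (t, v, w) /\
    psi_fun (coef_a t v w) (coef_b v w) (kap w) = psi_fun 0 0 (kap w) + v ^ 4 * gp (t, v, w).
Proof.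
  assert (Hr := r_bounds). assert (HA := A_ge_1). assert (HrA := rA).
  (* Here [c * (A / 2) = 1 / 20] admits [a] and [b] with cofactors of norm [A / 2], and the
     resulting bound [1 / 5] divided by [c] is the [2 A] of the conclusion. *)
  set (c := (/ (10 * A))%R).
  assert (Hc : (0 < c)%R) by (unfold c; apply Rinv_0_lt_compat; lra).
  assert (HcA : (c * A = / 10)%R) by (unfold c; field; lra).
  assert (Hv4 : Delta_norm (fun p => snd (fst p) ^ 4) c).
  { apply (mn_le _ _ HN _ _ _ norm_v4).
    apply Rmult_le_reg_r with A; [lra|]. rewrite HcA.
    assert (H := v4_small). lra. }
  assert (HD := majorant_dual_norm HN (fun p => snd (fst p) ^ 4) c Hc Hv4).
  set (D := dual_norm (S := Delta x0) (N := Delta_norm) (fun p => snd (fst p) ^ 4) c) in HD.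
  (* The flag [true] selects the point [(a, b, k)], [false] the point [(0, 0, k)]; the cofactors of
     [v ^ 4] in [a] and [b] are [p mu^4 / 16] and [v mu^5 / 32]. *)
  set (Fa := fun q : C3 * bool => if snd q then
    coef_a (fst (fst (fst q))) (snd (fst (fst q))) (snd (fst q)) else RtoC 0).
  set (Fb := fun q : C3 * bool => if snd q then
    coef_b (snd (fst (fst q))) (snd (fst q)) else RtoC 0).
  set (Fk := fun q : C3 * bool => kap (snd (fst q))).
  assert (Ha : D Fa (/ 20)%R).
  { exists (fun p => pole (fst (fst p)) (snd (fst p)) (snd p) * mu (snd p) ^ 4 / RtoC 16),
      0%R, (A / 2)%R.
    split; [apply norm_0; lra|]. split; [|split].
    - apply (mn_le _ _ HN _ ((A + 1) * (6 / 5) ^ 4 * / 16)%R); [|simpl; lra].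
      apply (norm_div (fun p =>
        pole (fst (fst p)) (snd (fst p)) (snd p) * mu (snd p) ^ 4)); [lra|].
      apply (mn_mult _ _ HN); [exact norm_pole|]. apply (norm_pow _ _ 4 norm_mu).
    - intros [[t v] w] _. unfold Fa, coef_a, rho; simpl. field.
    - lra. }
  assert (Hb : D Fb (/ 20)%R).
  { exists (fun p => snd (fst p) * mu (snd p) ^ 5 / RtoC 32), 0%R, (A / 2)%R.
    split; [apply norm_0; lra|]. split; [|split].
    - apply (mn_le _ _ HN _ ((2 * r) * (6 / 5) ^ 5 * / 32)%R); [|simpl; lra].
      apply (norm_div (fun p => snd (fst p) * mu (snd p) ^ 5)); [lra|].
      apply (mn_mult _ _ HN); [exact norm_v|]. apply (norm_pow _ _ 5 norm_mu).
    - intros [[t v] w] _. unfold Fb, coef_b, rho; simpl. field.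
    - lra. }
  assert (Hk : D Fk (/ 20)%R).
  { exists (fun _ => RtoC 0), (/ 20)%R, 0%R.
    split; [exact norm_kap_le|]. split; [apply norm_0; lra|]. split; [|lra].
    intros p _. unfold Fk; simpl. ring. }
  destruct (mn_m_series HD Fa Fb Fk Ha Hb Hk) as (gm & M0 & M1 & N0 & N1 & E & HM).
  destruct (mn_psi_fun HD Fa Fb Fk Ha Hb Hk) as (gp & M0' & M1' & N0' & N1' & E' & HM').
  assert (B : forall m0 m1 : R, (0 <= m0)%R -> (m0 + c * m1 <= 1 / 5)%R -> (m1 <= 2 * A)%R).
  { intros m0 m1 H0 H1. apply Rmult_le_reg_l with c; [exact Hc|].
    replace (c * (2 * A))%R with (2 * (c * A))%R by ring. lra. }
  exists gm, gp. split; [|split].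
  - apply (mn_le _ _ HN _ _ _ N1). apply (B M0); [|exact HM].
    exact (mn_ge0 _ _ HN _ _ N0).
  - apply (mn_le _ _ HN _ _ _ N1'). apply (B M0'); [|exact HM'].
    exact (mn_ge0 _ _ HN _ _ N0').
  - intros t v w Hp. specialize (E _ Hp). specialize (E' _ Hp). split.
    + unfold mfun, mu, m_fun. rewrite <- Cplus_assoc. f_equal. exact E.
    + exact E'.
Qed.

Lemma Delta_w (t v w : C) : Delta x0 (t, v, w) -> (Cmod (w - 1 / 4) < / 10000)%R.
Proof. intros (_ & _ & H). fold r in H. assert (Hr := r_bounds). lra. Qed.

(** The cofactors come from [gamma - t = rho (psi(a,b,k) - psi(0,0,k))], [eta - v = v (mu - m) / m]
    and [theta - w = (m^2 - mu^2) / 4]; the fifth power in [gamma] is due to the factor [rho]. *)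
Lemma Delta_expansions : exists Gg Gh Gt gm : C3 -> C,
  Delta_norm Gg (2 * A)%R /\ Delta_norm Gh (2 * A)%R /\ Delta_norm Gt (2 * A)%R /\
  Delta_norm gm (2 * A)%R /\
  forall t v w : C, Delta x0 (t, v, w) ->
    mfun t v w <> 0 /\ mfun t v w = mu w + v ^ 4 * gm (t, v, w) /\
    gam t v w = t + v ^ 5 * Gg (t, v, w) /\
    eta t v w = v + v ^ 4 * Gh (t, v, w) /\
    tht t v w = w + v ^ 4 * Gt (t, v, w).
Proof.
  assert (Hr := r_bounds). assert (HA := A_ge_1). assert (Hv4 := v4_small).
  destruct series_increments as (gm & gp & Nm & Np & E).
  set (m := fun p : C3 => mu (snd p) + snd (fst p) ^ 4 * gm p).
  assert (Nvg : Delta_norm (fun p => snd (fst p) ^ 4 * gm p) ((2 * r) ^ 4 * (2 * A))%R).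
  { apply (mn_mult _ _ HN); [exact norm_v4|exact Nm]. }
  assert (Nm1 : Delta_norm (fun p => (mu (snd p) - 1) + snd (fst p) ^ 4 * gm p) (/ 2)%R).
  { apply (mn_le _ _ HN _ (1 / 5 + (2 * r) ^ 4 * (2 * A))%R); [|lra].
    apply (mn_plus _ _ HN); [|exact Nvg].
    apply (mn_ext _ _ HN) with (fun p : C3 => Cseries (m_coef 0 0 (kap (snd p)))).
    { intros p _. unfold mu, m_fun. ring. }
    apply (mn_m_series HN (fun _ => RtoC 0) (fun _ => RtoC 0) (fun p => kap (snd p)));
      [apply norm_0; lra|apply norm_0; lra|exact norm_kap_le]. }
  assert (Ninv : Delta_norm (fun p => / m p) 2%R).
  { eapply (mn_ext _ _ HN); [|exact (mn_geometric _ HN Nm1)].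
    intros p _. unfold m. f_equal. ring. }
  assert (Nmm : Delta_norm m (13 / 10)%R).
  { apply (mn_le _ _ HN _ (6 / 5 + (2 * r) ^ 4 * (2 * A))%R); [|lra].
    apply (mn_plus _ _ HN); [exact norm_mu|exact Nvg]. }
  assert (Hm0 : forall p, Delta x0 p -> m p <> 0).
  { intros p Hp H. assert (B := mn_bound _ _ HN _ _ Nm1 p Hp).
    assert (Em : mu (snd p) - 1 + snd (fst p) ^ 4 * gm p = m p - 1) by (unfold m; ring).
    cbv beta in B. rewrite Em in B.
    rewrite H in B. replace (0 - 1)%C with (Copp (RtoC 1)) in B by ring.
    rewrite Cmod_opp, Cmod_1 in B. lra. }
  exists (fun p => mu (snd p) * gp p / RtoC 2),
    (fun p => - (1) * (snd (fst p) * (gm p * / m p))),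
    (fun p => gm p * (m p + mu (snd p)) / RtoC 4), gm.
  split; [|split; [|split; [|split; [exact Nm|]]]].
  - apply (mn_le _ _ HN _ ((6 / 5) * (2 * A) * / 2)%R); [|lra].
    apply (norm_div (fun p => mu (snd p) * gp p)); [lra|].
    apply (mn_mult _ _ HN); [exact norm_mu|exact Np].
  - apply (mn_le _ _ HN _ (Cmod (- (1)) * ((2 * r) * ((2 * A) * 2)))%R).
    + apply (mn_scal HN (- (1)) (fun p : C3 => snd (fst p) * (gm p * / m p))).
      apply (mn_mult _ _ HN); [exact norm_v|].
      apply (mn_mult _ _ HN); [exact Nm|exact Ninv].
    + rewrite Cmod_opp, Cmod_1. nra.
  - apply (mn_le _ _ HN _ ((2 * A) * (13 / 10 + 6 / 5) * / 4)%R); [|lra].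
    apply (norm_div (fun p => gm p * (m p + mu (snd p)))); [lra|].
    apply (mn_mult _ _ HN); [exact Nm|].
    apply (mn_plus _ _ HN); [exact Nmm|exact norm_mu].
  - intros t v w Hp. destruct (E t v w Hp) as [E1 E2].
    assert (M0 := Hm0 _ Hp). unfold m in M0; simpl fst in M0; simpl snd in M0.
    assert (Ms := mu_sqr w (Delta_w _ _ _ Hp)).
    split; [rewrite E1; exact M0|]. split; [exact E1|]. split; [|split].
    + unfold gam. rewrite E2. unfold pole, rho. simpl fst; simpl snd.
      generalize (psi_fun 0 0 (kap w)) (gp (t, v, w)) (mu w). intros z1 z2 z3.
      simpl. field.
    + unfold eta, m. simpl fst; simpl snd. rewrite E1. field. exact M0.
    + unfold tht, m. simpl fst; simpl snd. rewrite E1.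
      revert Ms. clear. generalize (mu w) (gm (t, v, w)). intros z g Ms.
      replace w with (z ^ 2 / 4)%C by (rewrite Ms; field). simpl. field.
Qed.

End Estimates.

Lemma Delta_small (x0 t v w : C) : Delta x0 (t, v, w) ->
  small (coef_a t v w) (coef_b v w) (kap w).
Proof.
  intros Hp. assert (HN := majorant_Delta_norm x0).
  assert (Hr := r_bounds x0). assert (Hv := v4_small x0).
  assert (HA := A_ge_1 x0).
  split; [|split].
  - assert (H := mn_bound _ _ HN _ _ (mn_mult _ _ HN _ _ _ _ (norm_pole x0)
      (norm_pow x0 _ _ 4 (norm_rho x0))) _ Hp).
    eapply Rle_lt_trans; [exact H|].
    assert (H4 : (0 <= (2 * / inv_radius x0) ^ 4)%R) by (apply pow_le; lra).
    nra.
  - assert (H := mn_bound _ _ HN _ _ (norm_pow x0 _ _ 5 (norm_rho x0)) _ Hp).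
    eapply Rle_lt_trans; [exact H|].
    assert (H5 : ((2 * / inv_radius x0) ^ 5 <= 1 ^ 4 * (2 * / inv_radius x0))%R).
    { replace ((2 * / inv_radius x0) ^ 5)%R
        with ((2 * / inv_radius x0) ^ 4 * (2 * / inv_radius x0))%R by ring.
      apply Rmult_le_compat_r; [lra|]. apply pow_incr. lra. }
    rewrite pow1 in H5. lra.
  - apply small_kap_w, (Delta_w x0 t v w Hp).
Qed.

Lemma Cinv_neq_0 (z : C) : z <> 0 -> / z <> 0.
Proof.
  intros Hz H. apply C1_nz. rewrite <- (Cinv_r z Hz), H. ring.
Qed.

Lemma small_00k (k : C) : (Cmod k < / 40)%R -> small 0 0 k.
Proof. intros H. unfold small. rewrite Cmod_0. lra. Qed.

(** * Transport of the vector field *)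

Section RegularPoint.
Variables (x0 t0 : C) (v w : C -> C).
Hypothesis HD : exists d : R, (0 < d)%R /\
  forall t, (Cmod (t - t0) < d)%R -> Delta x0 (t, v t, w t).
Hypothesis (Hv0 : v t0 <> 0) (Hw0 : w t0 <> 0).
Hypothesis (Hv : is_Cderive v t0 (2 / w t0 - 6)).
Hypothesis (Hw : is_Cderive w t0 (12 / v t0 * (w t0 - 1 / 4))).

Let m0 := mfun t0 (v t0) (w t0).
Let mu0 := mu (w t0).
Let al := / (2 * v t0 * w t0).

Lemma at_t0 : Delta x0 (t0, v t0, w t0).
Proof.
  destruct HD as (d & Hd & H). apply H. unfold Cminus. now rewrite Cplus_opp_r, Cmod_0.
Qed.

Lemma mu0_facts : mu0 <> 0 /\ w t0 = mu0 ^ 2 / 4.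
Proof.
  assert (H := Delta_w _ _ _ _ at_t0). split; [apply (mu_near_1 _ H)|].
  unfold mu0. rewrite (mu_sqr _ H). field.
Qed.

Lemma m0_facts : m0 <> 0.
Proof.
  destruct (Delta_expansions x0) as (Gg & Gh & Gt & gm & _ & _ & _ & _ & H).
  apply (H _ _ _ at_t0).
Qed.

Lemma derive_kap : is_Cderive (fun t => kap (w t)) t0 (6 * al * kap (w t0)).
Proof.
  eapply is_Cderive_eq.
  - apply (is_Cderive_minus (fun _ => 4) (fun t => / w t)); [apply is_Cderive_const|].
    apply is_Cderive_inv; [exact Hw0|exact Hw].
  - unfold al, kap. field. auto.
Qed.

Lemma along_00 : is_Cderive (fun _ => RtoC 0) t0 (4 * al * 0) /\
  is_Cderive (fun _ => RtoC 0) t0 (5 * al * 0).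
Proof.
  split; (eapply is_Cderive_eq; [apply is_Cderive_const|]); ring.
Qed.

Lemma kap_small : small 0 0 (kap (w t0)).
Proof. apply small_00k, (Delta_small x0 _ _ _ at_t0). Qed.

Lemma derive_mu : is_Cderive (fun t => mu (w t)) t0 (24 / (v t0 * mu0) * (w t0 - 1 / 4)).
Proof.
  destruct along_00 as [Z1 Z2].
  destruct (ex_Cderive_m (fun _ => 0) (fun _ => 0) (fun t => kap (w t)) t0 al
    Z1 Z2 derive_kap kap_small) as [l Hl].
  change (is_Cderive (fun t => mu (w t)) t0 l) in Hl.
  destruct mu0_facts as [Hmu Ew].
  assert (H1 := is_Cderive_mult _ _ _ _ _ Hl Hl). cbv beta in H1. fold mu0 in H1.
  assert (H2 : is_Cderive (fun t => mu (w t) * mu (w t)) t0 (4 * (12 / v t0 * (w t0 - 1 / 4)))).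
  { destruct HD as (d & Hd & HDd).
    apply (is_Cderive_ext_locally (fun t => 4 * w t) _ _ _ d Hd).
    - intros t Ht. rewrite <- (mu_sqr _ (Delta_w _ _ _ _ (HDd t Ht))). simpl. ring.
    - now apply is_Cderive_scal. }
  assert (E := is_Cderive_unique _ _ _ _ H1 H2).
  eapply is_Cderive_eq; [exact Hl|].
  replace l with ((l * mu0 + mu0 * l) / (2 * mu0))%C by (field; exact Hmu).
  rewrite E. field. auto.
Qed.

Lemma al_mu : al = 2 / (v t0 * mu0 ^ 2).
Proof.
  destruct mu0_facts as [Hmu Ew]. unfold al. rewrite Ew. field. auto.
Qed.

Lemma derive_rho : is_Cderive (fun t => rho (v t) (w t)) t0 (/ mu0).
Proof.
  destruct mu0_facts as [Hmu Ew].
  eapply is_Cderive_eq.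
  - apply (is_Cderive_mult (fun t => v t * mu (w t)) (fun _ => / 2));
      [apply (is_Cderive_mult v (fun t => mu (w t))); [exact Hv|exact derive_mu]
      |apply is_Cderive_const].
  - cbv beta. fold mu0. rewrite Ew. field. auto.
Qed.

(** The pole position is a first integral of (B): [rho (1 + psi(0,0,k))] has derivative [mu] times
    that of [rho], which is [1 / mu], and this cancels the derivative of [t]. *)
Lemma derive_pole : is_Cderive (fun t => pole t (v t) (w t)) t0 (RtoC 0).
Proof.
  destruct mu0_facts as [Hmu Ew]. destruct along_00 as [Z1 Z2].
  eapply is_Cderive_eq.
  - apply is_Cderive_minus; [apply is_Cderive_id|].
    apply (is_Cderive_mult (fun t => rho (v t) (w t)) (fun t => 1 + psi_fun 0 0 (kap (w t))));
      [exact derive_rho|].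
    apply is_Cderive_plus; [apply is_Cderive_const|].
    exact (is_Cderive_psi (fun _ => 0) (fun _ => 0) (fun t => kap (w t)) t0 al
      Z1 Z2 derive_kap kap_small).
  - cbv beta. fold (mu (w t0)). fold mu0. rewrite al_mu. unfold rho. fold mu0.
    generalize (psi_fun 0 0 (kap (w t0))). intros z. simpl. field. auto.
Qed.

(** So [al] is the logarithmic derivative of [rho]; as [pole] is constant, [coef_a] and [coef_b]
    scale with weights 4 and 5. *)
Lemma rho_log : / mu0 = al * rho (v t0) (w t0).
Proof.
  destruct mu0_facts as [Hmu Ew]. rewrite al_mu. unfold rho. fold mu0.
  simpl. field. auto.
Qed.

Lemma derive_coef_a :
  is_Cderive (fun t => coef_a t (v t) (w t)) t0 (4 * al * coef_a t0 (v t0) (w t0)).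
Proof.
  eapply is_Cderive_eq.
  - apply (is_Cderive_mult (fun t => pole t (v t) (w t)) (fun t => rho (v t) (w t) ^ 4));
      [exact derive_pole|]. exact (is_Cderive_pow (fun t => rho (v t) (w t)) t0 (/ mu0) 3 derive_rho).
  - cbv beta. rewrite rho_log. unfold coef_a.
    replace (INR 4) with 4%R by (simpl; ring). simpl. ring.
Qed.

Lemma derive_coef_b :
  is_Cderive (fun t => coef_b (v t) (w t)) t0 (5 * al * coef_b (v t0) (w t0)).
Proof.
  eapply is_Cderive_eq.
  - exact (is_Cderive_pow (fun t => rho (v t) (w t)) t0 (/ mu0) 4 derive_rho).
  - rewrite rho_log. unfold coef_b.
    replace (INR 5) with 5%R by (simpl; ring). simpl. ring.
Qed.

Lemma derive_gam : is_Cderive (fun t => gam t (v t) (w t)) t0 (m0 / mu0).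
Proof.
  eapply is_Cderive_eq.
  - apply is_Cderive_plus; [exact derive_pole|].
    apply (is_Cderive_mult (fun t => rho (v t) (w t))
      (fun t => 1 + psi_fun (coef_a t (v t) (w t)) (coef_b (v t) (w t)) (kap (w t))));
      [exact derive_rho|].
    apply is_Cderive_plus; [apply is_Cderive_const|].
    exact (is_Cderive_psi _ _ _ t0 al derive_coef_a derive_coef_b derive_kap
      (Delta_small _ _ _ _ at_t0)).
  - cbv beta. fold (mfun t0 (v t0) (w t0)). fold m0.
    unfold Cdiv. rewrite rho_log.
    generalize (psi_fun (coef_a t0 (v t0) (w t0)) (coef_b (v t0) (w t0)) (kap (w t0))).
    intros z. ring.
Qed.

Let x1 := gam t0 (v t0) (w t0).

(** Differentiating [m ^ 2 (1 + e) = 1] determines the derivative; then [1 + e = 1 / m ^ 2]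
    eliminates [e], and [a + b + b psi] is recognized as [rho ^ 4 x]. *)
Lemma derive_mfun : is_Cderive (fun t => mfun t (v t) (w t)) t0
  (- m0 ^ 3 / (v t0 * mu0 ^ 2) * (6 * (/ m0 ^ 2 - 1) - (v t0 * mu0 / 2) ^ 4 * x1)).
Proof.
  assert (Hs := Delta_small _ _ _ _ at_t0).
  destruct (ex_Cderive_m _ _ _ t0 al derive_coef_a derive_coef_b derive_kap Hs) as [l Hl].
  change (is_Cderive (fun t => mfun t (v t) (w t)) t0 l) in Hl.
  assert (HE := is_Cderive_exc _ _ _ t0 al derive_coef_a derive_coef_b derive_kap Hs).
  set (E0 := exc_fun (coef_a t0 (v t0) (w t0)) (coef_b (v t0) (w t0)) (kap (w t0))) in *.
  set (P0 := psi_fun (coef_a t0 (v t0) (w t0)) (coef_b (v t0) (w t0)) (kap (w t0))) in *.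
  assert (H1 := is_Cderive_mult _ _ _ _ _ (is_Cderive_mult _ _ _ _ _ Hl Hl)
    (is_Cderive_plus _ _ _ _ _ (is_Cderive_const 1 t0) HE)).
  cbv beta in H1. fold m0 in H1. fold E0 in H1.
  assert (H2 : is_Cderive (fun t => mfun t (v t) (w t) * mfun t (v t) (w t) *
      (1 + exc_fun (coef_a t (v t) (w t)) (coef_b (v t) (w t)) (kap (w t)))) t0 (RtoC 0)).
  { destruct HD as (d & Hd & HDd).
    apply (is_Cderive_ext_locally (fun _ => 1) _ _ _ d Hd); [|apply is_Cderive_const].
    intros t Ht. destruct (small_le _ _ _ (Delta_small _ _ _ _ (HDd t Ht))) as (B1 & B2 & B3).
    eapply eq_trans; [exact (eq_sym (m_exc_identity _ _ _ B1 B2 B3))|].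
    unfold mfun. simpl. ring. }
  assert (Eq := is_Cderive_unique _ _ _ _ H1 H2).
  destruct (small_le _ _ _ Hs) as (B1 & B2 & B3).
  assert (Id := m_exc_identity _ _ _ B1 B2 B3).
  fold (mfun t0 (v t0) (w t0)) in Id. fold m0 in Id. fold E0 in Id.
  assert (Hm := m0_facts). destruct mu0_facts as [Hmu _].
  assert (EE : E0 = / m0 ^ 2 - 1).
  { replace E0 with ((m0 ^ 2 * (1 + E0)) / m0 ^ 2 - 1)%C by (simpl; field; exact Hm).
    rewrite Id. simpl. field. exact Hm. }
  assert (Ex : coef_a t0 (v t0) (w t0) + coef_b (v t0) (w t0) + coef_b (v t0) (w t0) * P0 =
    (v t0 * mu0 / 2) ^ 4 * x1).
  { unfold x1, gam. fold P0. clearbody P0. unfold coef_a, coef_b, rho. fold mu0. simpl. field. }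
  rewrite Ex, EE in Eq. rewrite al_mu in Eq.
  eapply is_Cderive_eq; [exact Hl|].
  set (Q := (6 * (/ m0 ^ 2 - 1) - (v t0 * mu0 / 2) ^ 4 * x1)%C) in *.
  assert (L2 : 2 * l / m0 + m0 ^ 2 * (2 / (v t0 * mu0 ^ 2) * Q) = 0).
  { rewrite <- Eq. simpl. field. auto. }
  replace l with ((2 * l / m0 + m0 ^ 2 * (2 / (v t0 * mu0 ^ 2) * Q)) * (m0 / 2)
    - m0 ^ 3 / (v t0 * mu0 ^ 2) * Q)%C by (simpl; field; auto).
  rewrite L2. unfold Cdiv. ring.
Qed.

Let v1 := eta t0 (v t0) (w t0).
Let w1 := tht t0 (v t0) (w t0).

(** The factor [m0 / mu0] is [dx/dt], the other one the right-hand side of (A). Given the derivative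
    of [m], this is an identity of rational functions. *)
Lemma derive_tht : is_Cderive (fun t => tht t (v t) (w t)) t0
  (m0 / mu0 * (12 / v1 * (w1 - 1 / 4) + 2 * x1 * w1 ^ 3 * v1 ^ 3)).
Proof.
  assert (Hm := m0_facts). destruct mu0_facts as [Hmu _].
  eapply is_Cderive_eq.
  - apply (is_Cderive_mult (fun t => mfun t (v t) (w t) ^ 2) (fun _ => / 4));
      [|apply is_Cderive_const].
    exact (is_Cderive_pow (fun t => mfun t (v t) (w t)) t0 _ 1 derive_mfun).
  - cbv beta. unfold v1, w1, eta, tht. fold m0 mu0.
    replace (INR 2) with 2%R by (simpl; ring). simpl. field. auto.
Qed.

Lemma derive_eta : is_Cderive (fun t => eta t (v t) (w t)) t0
  (m0 / mu0 * (2 / w1 - 6 - x1 * w1 ^ 2 * v1 ^ 4)).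
Proof.
  assert (Hm := m0_facts). destruct mu0_facts as [Hmu Ew].
  eapply is_Cderive_eq.
  - apply (is_Cderive_mult (fun t => v t * mu (w t)) (fun t => / mfun t (v t) (w t))).
    + apply (is_Cderive_mult v (fun t => mu (w t))); [exact Hv|exact derive_mu].
    + apply is_Cderive_inv; [exact Hm|exact derive_mfun].
  - cbv beta. unfold v1, w1, eta, tht. fold m0 mu0. rewrite Ew.
    simpl. field. auto.
Qed.

Lemma eta_neq_0 : v1 <> 0 /\ w1 <> 0.
Proof.
  assert (Hm := m0_facts). destruct mu0_facts as [Hmu _].
  unfold v1, w1, eta, tht. fold m0 mu0. split.
  - apply Cmult_neq_0; [now apply Cmult_neq_0|]. now apply Cinv_neq_0.
  - intros H. apply Hm.
    assert (H2 : m0 * m0 = 0).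
    { replace (m0 * m0)%C with (4 * (m0 ^ 2 / 4))%C by (simpl; field). rewrite H. ring. }
    destruct (Ceq_dec m0 0) as [H3|H3]; [exact H3|].
    exfalso. exact (Cmult_neq_0 _ _ H3 H3 H2).
Qed.

End RegularPoint.

(** * Holomorphic functions along curves in phase space *)

Lemma ex_filterdiff_pair {U V W : NormedModule C_AbsRing} (f : U -> V) (g : U -> W) (x : U) :
  ex_filterdiff f (locally x) -> ex_filterdiff g (locally x) ->
  ex_filterdiff (V := prod_NormedModule C_AbsRing V W) (fun y => (f y, g y)) (locally x).
Proof.
  intros [lf Hf] [lg Hg]. exists (fun h => (lf h, lg h)).
  apply (filterdiff_comp'_2 (W := prod_NormedModule C_AbsRing V W)
    f g (fun a b => (a, b)) x lf lg (fun a b => (a, b)) Hf Hg).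
  apply (filterdiff_linear (U := prod_NormedModule C_AbsRing V W)
    (V := prod_NormedModule C_AbsRing V W) (fun t => (fst t, snd t))).
  apply is_linear_prod; [apply is_linear_fst|apply is_linear_snd].
Qed.

Lemma ex_Cderive_curve (v w : C -> C) (t0 : C) :
  ex_derive (K := C_AbsRing) (V := C_NormedModule) v t0 ->
  ex_derive (K := C_AbsRing) (V := C_NormedModule) w t0 ->
  ex_filterdiff (U := C_NormedModule) (V := C3) (fun t => (t, v t, w t)) (locally t0).
Proof.
  intros Hv Hw. apply ex_derive_C_iff in Hv. apply ex_derive_C_iff in Hw.
  apply (ex_filterdiff_pair (U := C_NormedModule)
    (V := prod_NormedModule C_AbsRing C_NormedModule C_NormedModule) (W := C_NormedModule)
    (fun t => (t, v t)) w); [|exact Hw].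
  apply (ex_filterdiff_pair (U := C_NormedModule)
    (V := C_NormedModule) (W := C_NormedModule) (fun t => t) v); [|exact Hv].
  eexists. apply filterdiff_id.
Qed.

Lemma ex_Cderive_comp_curve (G : C3 -> C) (v w : C -> C) (t0 : C) :
  ex_derive (K := C_AbsRing) (V := C_NormedModule) v t0 ->
  ex_derive (K := C_AbsRing) (V := C_NormedModule) w t0 ->
  ex_filterdiff (U := C3) (V := C_NormedModule) G (locally ((t0, v t0, w t0) : C3)) ->
  exists l, is_Cderive (fun t => G (t, v t, w t)) t0 l.
Proof.
  intros Hv Hw [lG HG]. destruct (ex_Cderive_curve v w t0 Hv Hw) as [lc Hc].
  apply ex_derive_C_iff. eexists.
  exact (filterdiff_comp' (U := C_NormedModule) (V := C3) (W := C_NormedModule)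
    (fun t => (t, v t, w t)) G t0 lc lG Hc HG).
Qed.

Lemma locally_C_disk (t : C) (P : C -> Prop) :
  locally t P <-> exists d : posreal, forall s, disk t d s -> P s.
Proof. apply (locally_iff_norm (U := C_NormedModule)). Qed.

Lemma open_disk (c : C) (r : R) : open (disk c r).
Proof.
  intros t Ht. apply locally_C_disk.
  assert (Hd : (0 < r - Cmod (t - c))%R) by (unfold disk in Ht; lra).
  exists (mkposreal _ Hd). intros s Hs. unfold disk in *. simpl in Hs.
  replace (s - c)%C with ((s - t) + (t - c))%C by ring.
  eapply Rle_lt_trans; [apply Cmod_triangle|]. lra.
Qed.

Lemma disk_center (c : C) (r : R) : (0 < r)%R -> disk c r c.
Proof. intros H. unfold disk, Cminus. now rewrite Cplus_opp_r, Cmod_0. Qed.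

(** * The map as a perturbation of the identity on the polydisk *)

Definition Fgam (p : C3) : C := gam (fst (fst p)) (snd (fst p)) (snd p).
Definition Feta (p : C3) : C := eta (fst (fst p)) (snd (fst p)) (snd p).
Definition Ftht (p : C3) : C := tht (fst (fst p)) (snd (fst p)) (snd p).
Definition Fmap (p : C3) : C3 := (Fgam p, Feta p, Ftht p).

Section OnDelta.
Variable x0 : C.
Let A : R := (1 + Cmod x0)%R.
Let r : R := (/ inv_radius x0)%R.
Let HN := majorant_Delta_norm x0.

(** Each deviation gets Lipschitz constant [1 / 1000], so the three coordinates together stay well
    below the [1 / 2] required of a perturbation of the identity. *)
Lemma Fmap_near_Id : exists Dg Dh Dt : C3 -> C,
  Delta_norm x0 Dg (r * / 1000)%R /\ Delta_norm x0 Dh (r * / 1000)%R /\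
  Delta_norm x0 Dt (r * / 1000)%R /\
  forall p, Delta x0 p ->
    Fgam p = fst (fst p) + Dg p /\ Feta p = snd (fst p) + Dh p /\ Ftht p = snd p + Dt p.
Proof.
  assert (Hr := r_bounds x0). assert (Hv := v4_small x0). assert (HA := A_ge_1 x0).
  fold r in Hr, Hv. fold A in Hv, HA.
  destruct (Delta_expansions x0) as (Gg & Gh & Gt & gm & Ng & Nh & Nt & _ & E).
  fold A in Ng, Nh, Nt.
  assert (B : forall G, Delta_norm x0 G (2 * A)%R ->
    Delta_norm x0 (fun p => snd (fst p) ^ 4 * G p) (r * / 1000)%R).
  { intros G HG. apply (mn_le _ _ HN _ ((2 * r) ^ 4 * (2 * A))%R); [|exact Hv].
    apply (mn_mult _ _ HN); [apply norm_v4|exact HG]. }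
  exists (fun p => snd (fst p) ^ 4 * (snd (fst p) * Gg p)),
    (fun p => snd (fst p) ^ 4 * Gh p), (fun p => snd (fst p) ^ 4 * Gt p).
  split; [|split; [now apply B|split; [now apply B|]]].
  - apply B. apply (mn_le _ _ HN _ ((2 * r) * (2 * A))%R); [|nra].
    apply (mn_mult _ _ HN); [apply norm_v|exact Ng].
  - intros [[t v] w] Hp. destruct (E t v w Hp) as (_ & _ & E1 & E2 & E3).
    unfold Fgam, Feta, Ftht; simpl fst; simpl snd.
    rewrite E1, E2, E3. split; [|split]; try reflexivity. simpl. ring.
Qed.

Lemma Fmap_components_diff (p : C3) : Delta x0 p ->
  ex_filterdiff (U := C3) (V := C_NormedModule) Fgam (locally p) /\
  ex_filterdiff (U := C3) (V := C_NormedModule) Feta (locally p) /\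
  ex_filterdiff (U := C3) (V := C_NormedModule) Ftht (locally p).
Proof.
  intros Hp. destruct Fmap_near_Id as (Dg & Dh & Dt & Ng & Nh & Nt & E).
  assert (B : forall (f c d : C3 -> C) M, is_linear (U := C3) (V := C_NormedModule) c ->
    Delta_norm x0 d M -> (forall p, Delta x0 p -> f p = c p + d p) ->
    ex_filterdiff (U := C3) (V := C_NormedModule) f (locally p)).
  { intros f c d M Hc Hd Hf.
    destruct (lip_norm_diff _ _ _ _ p (proj1 Hd) Hp) as [l Hl].
    eexists. eapply (filterdiff_ext_locally (U := C3) (V := C_NormedModule) (fun p => c p + d p)).
    - eapply filter_imp; [|exact (open_Delta x0 p Hp)]. intros q Hq. symmetry. now apply Hf.
    - apply (filterdiff_Cplus (U := C3) c d p c l); [|exact Hl].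
      now apply (filterdiff_linear (U := C3) (V := C_NormedModule)). }
  split; [|split].
  - apply (B _ (fun p => fst (fst p)) Dg _ is_linear_coord1 Ng). intros q Hq. now apply E.
  - apply (B _ (fun p => snd (fst p)) Dh _ is_linear_coord2 Nh). intros q Hq. now apply E.
  - apply (B _ (fun p => snd p) Dt _ is_linear_coord3 Nt). intros q Hq. now apply E.
Qed.

Lemma Fmap_holomorphic : holomorphic_on (Delta x0) Fmap.
Proof.
  intros p Hp. destruct (Fmap_components_diff p Hp) as (H1 & H2 & H3).
  apply (ex_filterdiff_pair (U := C3)
    (V := prod_NormedModule C_AbsRing C_NormedModule C_NormedModule) (W := C_NormedModule)
    (fun p => (Fgam p, Feta p)) Ftht); [|exact H3].
  now apply (ex_filterdiff_pair (U := C3) (V := C_NormedModule) (W := C_NormedModule)).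
Qed.

Lemma Fmap_near_identity : near_identity (E := C3) (Delta x0) Fmap.
Proof.
  assert (Hr := r_bounds x0). fold r in Hr.
  destruct Fmap_near_Id as (Dg & Dh & Dt & Ng & Nh & Nt & E).
  intros p q Hp Hq.
  destruct (E p Hp) as (P1 & P2 & P3). destruct (E q Hq) as (Q1 & Q2 & Q3).
  assert (B : forall d, Delta_norm x0 d (r * / 1000)%R ->
    (Cmod (d p - d q) <= / 1000 * norm (minus p q))%R).
  { intros d Hd.
    replace (/ 1000)%R with (r * / 1000 / r)%R by (field; lra).
    exact (lip_norm_lip _ r (proj1 Hr) d _ q p (proj1 Hd) Hq Hp). }
  assert (Bg := B _ Ng). assert (Bh := B _ Nh). assert (Bt := B _ Nt).
  assert (T : forall a b c d : C, a + b - (c + d) - (a - c) = b - d) by (intros; ring).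
  eapply Rle_trans; [apply C3_norm_le|].
  change (Cmod (Fgam p - Fgam q - (fst (fst p) - fst (fst q))) +
    Cmod (Feta p - Feta q - (snd (fst p) - snd (fst q))) +
    Cmod (Ftht p - Ftht q - (snd p - snd q)) <= / 2 * norm (minus p q))%R.
  rewrite P1, P2, P3, Q1, Q2, Q3, !T.
  assert (H := norm_ge_0 (minus p q)). lra.
Qed.

Lemma Fmap_v0 (t w : C) : Delta x0 (t, RtoC 0, w) -> Fmap (t, RtoC 0, w) = (t, RtoC 0, w).
Proof.
  intros Hp. destruct (Delta_expansions x0) as (Gg & Gh & Gt & gm & _ & _ & _ & _ & E).
  destruct (E t (RtoC 0) w Hp) as (_ & _ & E1 & E2 & E3).
  unfold Fmap, Fgam, Feta, Ftht; simpl fst; simpl snd.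
  rewrite E1, E2, E3. f_equal; [f_equal|]; simpl; ring.
Qed.

Lemma Delta_center : Delta x0 (x0, RtoC 0, 1 / 4).
Proof.
  assert (Hr := r_bounds x0). fold r in Hr.
  unfold Delta, polydisk. fold r. unfold Cminus. rewrite !Cplus_opp_r, Cmod_0. lra.
Qed.

Lemma norm_C3_complete : norm_complete C3.
Proof.
  apply norm_complete_prod; [apply norm_complete_prod|]; apply norm_complete_C.
Qed.

(** At [q = Fmap p] the difference [g q - q] is [p - Fmap p], of order [v ^ 4]; it remains to
    compare [v] with the second coordinate [eta] of [q]. *)
Lemma Fmap_biholomorphic : exists g : C3 -> C3,
  biholomorphic_onto_image (Delta x0) Fmap g /\
  exists M : R, locally ((x0, RtoC 0, 1 / 4) : C3) (fun q : C3 =>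
    image (Delta x0) Fmap q /\
    (norm (minus (g q) q) <= M * Cmod (snd (fst q)) ^ 4)%R).
Proof.
  assert (Hr := r_bounds x0). assert (Hv := v4_small x0). assert (HA := A_ge_1 x0).
  assert (HrA := rA x0). fold r A in Hr, Hv, HA, HrA.
  destruct (near_identity_biholomorphic norm_C3_complete (Delta x0) Fmap
    (open_Delta x0) Fmap_holomorphic Fmap_near_identity) as [g Hg].
  (* Three components, each at most [2 A] times the fourth power of [Cmod v], and a factor [2 ^ 4]
     from [Cmod v <= 2 * Cmod eta]. *)
  exists g. split; [exact Hg|]. exists (96 * A)%R.
  destruct Hg as (_ & Hopen & _ & Hinv).
  assert (Hc : image (Delta x0) Fmap (x0, RtoC 0, 1 / 4)).
  { exists (x0, RtoC 0, 1 / 4). split; [exact Delta_center|apply Fmap_v0, Delta_center]. }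
  eapply filter_imp; [|exact (Hopen _ Hc)].
  intros q Hq. split; [exact Hq|]. destruct Hq as [p [Hp Eq]].
  rewrite <- Eq. rewrite Hinv by exact Hp. clear Eq q.
  destruct (Delta_expansions x0) as (Gg & Gh & Gt & gm & Ng & Nh & Nt & _ & E).
  cut (forall t v w : C, Delta x0 (t, v, w) ->
    (norm (minus ((t, v, w) : C3) (Fmap (t, v, w))) <=
      96 * A * Cmod (snd (fst (Fmap (t, v, w)))) ^ 4)%R).
  { intros K. destruct p as [[t v] w]. exact (K t v w Hp). }
  clear p Hp. intros t v w Hp. destruct (E t v w Hp) as (_ & _ & E1 & E2 & E3).
  assert (Bg := mn_bound _ _ HN _ _ Ng _ Hp). assert (Bh := mn_bound _ _ HN _ _ Nh _ Hp).
  assert (Bt := mn_bound _ _ HN _ _ Nt _ Hp). fold A in Bg, Bh, Bt.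
  assert (Hvr : (Cmod v < r)%R) by apply Hp.
  assert (Hv0 := Cmod_ge_0 v).
  eapply Rle_trans; [apply C3_norm_le|].
  change (Cmod (t - gam t v w) + Cmod (v - eta t v w) + Cmod (w - tht t v w) <=
    96 * A * Cmod (eta t v w) ^ 4)%R.
  assert (Hlow : (Cmod v <= 2 * Cmod (eta t v w))%R).
  { rewrite E2. assert (T := Cmod_triangle (v + v ^ 4 * Gh (t, v, w)) (- (v ^ 4 * Gh (t, v, w)))).
    replace (v + v ^ 4 * Gh (t, v, w) + - (v ^ 4 * Gh (t, v, w)))%C with v in T by ring.
    rewrite Cmod_opp, Cmod_mult, Cmod_pow in T.
    assert (H4 : (Cmod v ^ 4 * Cmod (Gh (t, v, w)) <= Cmod v * / 2)%R).
    { replace (Cmod v ^ 4)%R with (Cmod v * Cmod v ^ 3)%R by ring.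
      rewrite Rmult_assoc. apply Rmult_le_compat_l; [exact Hv0|].
      apply Rle_trans with (r * (2 * A))%R; [|nra].
      apply Rmult_le_compat; [apply pow_le; exact Hv0|apply Cmod_ge_0| |exact Bh].
      assert (H2 : (Cmod v ^ 2 <= 1)%R) by nra.
      replace (Cmod v ^ 3)%R with (Cmod v * Cmod v ^ 2)%R by ring. nra. }
    lra. }
  assert (H4 : (Cmod v ^ 4 <= 16 * Cmod (eta t v w) ^ 4)%R).
  { replace (16 * Cmod (eta t v w) ^ 4)%R with ((2 * Cmod (eta t v w)) ^ 4)%R by ring.
    apply pow_incr. lra. }
  assert (V4 : (0 <= Cmod v ^ 4)%R) by (apply pow_le; exact Hv0).
  replace (t - gam t v w)%C with (- (v ^ 4 * (v * Gg (t, v, w))))%C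
    by (rewrite E1; simpl; ring).
  replace (v - eta t v w)%C with (- (v ^ 4 * Gh (t, v, w)))%C by (rewrite E2; ring).
  replace (w - tht t v w)%C with (- (v ^ 4 * Gt (t, v, w)))%C by (rewrite E3; ring).
  rewrite !Cmod_opp, !Cmod_mult, !Cmod_pow.
  assert (Hvg : (Cmod v * Cmod (Gg (t, v, w)) <= 2 * A)%R).
  { assert (H := Cmod_ge_0 (Gg (t, v, w))). nra. }
  apply Rle_trans with (Cmod v ^ 4 * (6 * A))%R; [|nra].
  nra.
Qed.

Lemma Delta_norm_expansion (f f0 G : C3 -> C) (M : R) (m : nat) :
  Delta_norm x0 G M ->
  (forall t v w : C, Delta x0 (t, v, w) -> f (t, v, w) - f0 (t, v, w) = v ^ m * G (t, v, w)) ->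
  expansion_in_v (Delta x0) f f0 m.
Proof.
  intros [_ HG] Hf.
  destruct (epsilon_choice _ HG) as [a Ha].
  exists (fun k t w => if Nat.ltb k m then RtoC 0 else a (t, w) (k - m)%nat).
  intros t v w Hp. destruct (Ha (t, w)) as [_ Hs]. simpl in Hs. specialize (Hs v Hp).
  rewrite Hf by exact Hp.
  eapply is_series_ext; [|apply (is_series_scal (V := C_NormedModule) (v ^ m)); exact Hs].
  intros n. simpl.
  replace (Nat.ltb (m + n) m) with false by (symmetry; apply Nat.ltb_ge; lia).
  replace (m + n - m)%nat with n by lia.
  rewrite Cpow_add_r. unfold scal; simpl. unfold mult; simpl. ring.
Qed.

(** * Solutions of (B) inside the polydisk *)

Section Solution.
Variables (v w : C -> C) (D : C -> Prop).
Hypothesis Hsol : solution_B D v w.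
Hypothesis HD : forall t, D t -> Delta x0 (t, v t, w t).

Let F1 (x v1 w1 : C) : C := 2 / w1 - 6 - x * w1 ^ 2 * v1 ^ 4.
Let F2 (x v1 w1 : C) : C := 12 / v1 * (w1 - 1 / 4) + 2 * x * w1 ^ 3 * v1 ^ 3.
Let xx (t : C) : C := gam t (v t) (w t).
Let vv (t : C) : C := eta t (v t) (w t).
Let ww (t : C) : C := tht t (v t) (w t).
Let regB (t : C) : Prop := regular_at (fun _ v w => 2 / w - 6) (fun _ v w => 12 / v * (w - 1 / 4)) v w t.

Lemma near_in_Delta (t : C) : D t -> exists d : R, (0 < d)%R /\
  forall s, (Cmod (s - t) < d)%R -> Delta x0 (s, v s, w s).
Proof.
  intros Ht. destruct (proj1 (locally_C_disk t D) (proj1 Hsol t Ht)) as [d Hd].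
  exists d. split; [apply cond_pos|]. intros s Hs. apply HD, Hd, Hs.
Qed.

(** [q = m / mu] is [dx/dt]; it differs from 1 by [v ^ 4 gm / mu], which is small. *)
Lemma regular_derivatives (t : C) : D t -> regB t ->
  exists q : C, (Cmod (q - 1) <= / 2)%R /\ vv t <> 0 /\ ww t <> 0 /\
    is_Cderive xx t q /\ is_Cderive vv t (q * F1 (xx t) (vv t) (ww t)) /\
    is_Cderive ww t (q * F2 (xx t) (vv t) (ww t)).
Proof.
  intros Ht (Hv0 & Hw0 & Hv & Hw). assert (Hn := near_in_Delta t Ht).
  exists (mfun t (v t) (w t) / mu (w t)).
  destruct (eta_neq_0 x0 t v w Hn Hv0) as [N1 N2].
  split; [|split; [exact N1|split; [exact N2|split; [|split]]]].
  - assert (Hr := r_bounds x0). assert (Hv4 := v4_small x0). fold r A in Hr, Hv4.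
    destruct (Delta_expansions x0) as (Gg & Gh & Gt & gm & _ & _ & _ & Nm & E).
    assert (Hp := HD t Ht). destruct (E _ _ _ Hp) as (_ & Em & _).
    destruct (mu_near_1 (w t) (Delta_w _ _ _ _ Hp)) as [M1 M0].
    rewrite Em.
    replace ((mu (w t) + v t ^ 4 * gm (t, v t, w t)) / mu (w t) - 1)%C
      with ((v t ^ 4 * gm (t, v t, w t)) / mu (w t))%C by (field; exact M0).
    assert (B := mn_bound _ _ HN _ _ (mn_mult _ _ HN _ _ _ _ (norm_v4 x0) Nm) _ Hp).
    cbv beta in B. simpl fst in B. simpl snd in B. fold r A in B.
    rewrite Cmod_div by exact M0.
    assert (L : (4 / 5 <= Cmod (mu (w t)))%R).
    { assert (T := Cmod_triangle (mu (w t)) (- (mu (w t) - 1))).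
      rewrite Cmod_opp in T. replace (mu (w t) + - (mu (w t) - 1))%C with (RtoC 1) in T by ring.
      rewrite Cmod_1 in T. lra. }
    apply Rmult_le_reg_r with (Cmod (mu (w t))); [lra|].
    unfold Rdiv. rewrite Rmult_assoc, Rinv_l, Rmult_1_r by lra. lra.
  - exact (derive_gam x0 t v w Hn Hv0 Hw0 Hv Hw).
  - exact (derive_eta x0 t v w Hn Hv0 Hw0 Hv Hw).
  - exact (derive_tht x0 t v w Hn Hv0 Hw0 Hv Hw).
Qed.

(** The vector fields are singular here, so the expansions are differentiated instead:
    [x = t + v ^ 5 Gg] has derivative 1. The map fixes the points with [v = 0], so the values at the
    singularity are kept. *)
Lemma pole_derivatives (t : C) : D t -> v t = 0 -> w t = 1 / 4 ->
  ex_derive (K := C_AbsRing) (V := C_NormedModule) v t ->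
  ex_derive (K := C_AbsRing) (V := C_NormedModule) w t ->
  is_Cderive xx t (RtoC 1) /\ (exists l, is_Cderive vv t l) /\ (exists l, is_Cderive ww t l) /\
  vv t = 0 /\ ww t = 1 / 4.
Proof.
  intros Ht Hv0 Hw0 Hv Hw. assert (Hp := HD t Ht).
  destruct (Fmap_components_diff _ Hp) as (_ & De & Dt).
  split; [|split; [|split]].
  - destruct (Delta_expansions x0) as (Gg & Gh & Gt & gm & Ng & _ & _ & _ & E).
    destruct (near_in_Delta t Ht) as (d & Hd & Hn).
    destruct (ex_Cderive_comp_curve Gg v w t Hv Hw) as [lg Hg].
    { exact (lip_norm_diff _ _ _ _ _ (proj1 Ng) Hp). }
    destruct Hv as [lv Hlv].
    apply (is_Cderive_ext_locally (fun s => s + v s ^ 5 * Gg (s, v s, w s)) _ _ _ d Hd).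
    { intros s Hs. symmetry. apply (E _ _ _ (Hn s Hs)). }
    eapply is_Cderive_eq.
    + apply is_Cderive_plus; [apply is_Cderive_id|].
      apply (is_Cderive_mult (fun s => v s ^ 5) (fun s => Gg (s, v s, w s))); [|exact Hg].
      exact (is_Cderive_pow v t lv 4 Hlv).
    + cbv beta. rewrite Hv0. simpl. ring.
  - exact (ex_Cderive_comp_curve Feta v w t Hv Hw De).
  - exact (ex_Cderive_comp_curve Ftht v w t Hv Hw Dt).
  - rewrite Hv0, Hw0 in Hp. assert (H := Fmap_v0 _ _ Hp).
    unfold vv, ww. rewrite Hv0, Hw0.
    split; [exact (f_equal (fun p : C3 => snd (fst p)) H)|exact (f_equal (fun p : C3 => snd p) H)].
Qed.

Lemma xx_derivative (t : C) : D t -> exists q, is_Cderive xx t q /\ (Cmod (q - 1) <= / 2)%R.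
Proof.
  intros Ht. destruct (proj2 Hsol t Ht) as [Hr|(Hv0 & Hw0 & Hv & Hw & _)].
  - destruct (regular_derivatives t Ht Hr) as (q & Hq & _ & _ & Hd & _).
    exists q. split; assumption.
  - exists (RtoC 1). split; [apply (pole_derivatives t Ht Hv0 Hw0 Hv Hw)|].
    unfold Cminus. rewrite Cplus_opp_r, Cmod_0. lra.
Qed.

(** The mean value inequality on the disk makes [x - t] Lipschitz with constant [1 / 2], so the
    result on perturbations of the identity applies in dimension one. *)
Lemma xx_biholomorphic (c : C) (e : R) : (forall t, disk c e t -> D t) ->
  exists g : C -> C, biholomorphic_onto_image (U := C_NormedModule) (V := C_NormedModule)
    (disk c e) xx g.
Proof.
  intros Hsub.
  assert (Hch : forall t, exists q, disk c e t -> is_Cderive xx t q /\ (Cmod (q - 1) <= / 2)%R).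
  { intros t. destruct (excluded_middle_informative (disk c e t)) as [H|H].
    - destruct (xx_derivative t (Hsub t H)) as [q Hq]. exists q. auto.
    - exists (RtoC 0). tauto. }
  destruct (epsilon_choice _ Hch) as [q Hq].
  apply (near_identity_biholomorphic (E := C_NormedModule) norm_complete_C).
  - apply open_disk.
  - intros t Ht. apply ex_derive_C_iff. exists (q t). now apply Hq.
  - intros s t Hs Ht.
    assert (H := disk_mean_value (fun t => xx t - t) (fun t => q t - 1) c e (/ 2) ltac:(lra)).
    assert (H' : (Cmod (xx s - s - (xx t - t)) <= / 2 * Cmod (s - t))%R).
    { apply H; [|exact Ht|exact Hs]. intros z Hz. destruct (Hq z Hz) as [Q1 Q2].
      split; [|exact Q2]. apply is_Cderive_minus; [exact Q1|apply is_Cderive_id]. }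
    change (Cmod (xx s - xx t - (s - t)) <= / 2 * Cmod (s - t))%R.
    replace (xx s - xx t - (s - t))%C with (xx s - s - (xx t - t))%C by ring. exact H'.
Qed.

(** Differentiating [g (x s) = s] gives [g' = 1 / x'], which cancels the factor [dx/dt] in the
    derivatives of [vv] and [ww] and leaves (A). *)
Lemma graph_on_disk (c : C) (e : R) (g : C -> C) : (forall t, disk c e t -> D t) ->
  biholomorphic_onto_image (U := C_NormedModule) (V := C_NormedModule) (disk c e) xx g ->
  solution_A (image (disk c e) xx) (fun z => vv (g z)) (fun z => ww (g z)).
Proof.
  intros Hsub (Hhol & Hopen & Hg & Hinv).
  split; [exact Hopen|].
  assert (Hder : forall t q : C, disk c e t -> is_Cderive xx t q -> q <> 0 /\
    is_Cderive g (xx t) (/ q)).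
  { intros t q Ht Hq.
    destruct (proj2 (ex_derive_C_iff g (xx t)) (Hg _ (ex_intro _ t (conj Ht eq_refl)))) as [l Hl].
    assert (H1 := is_Cderive_comp g xx t l q Hl Hq).
    destruct (proj1 (locally_C_disk t (disk c e)) (open_disk c e t Ht)) as [d Hd].
    assert (H2 : is_Cderive (fun s => g (xx s)) t (RtoC 1)).
    { apply (is_Cderive_ext_locally (fun s => s) _ _ _ d (cond_pos d)); [|apply is_Cderive_id].
      intros s Hs. symmetry. apply Hinv, Hd, Hs. }
    assert (E := is_Cderive_unique _ _ _ _ H1 H2).
    assert (Hq0 : q <> 0). { intros ->. apply C1_nz. rewrite <- E. ring. }
    split; [exact Hq0|]. eapply is_Cderive_eq; [exact Hl|].
    replace l with (q * l / q)%C by (field; exact Hq0). rewrite E. field. exact Hq0. }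
  assert (Hreg : forall t, disk c e t -> regB t ->
    regular_at F1 F2 (fun z => vv (g z)) (fun z => ww (g z)) (xx t)).
  { intros t Ht HB.
    destruct (regular_derivatives t (Hsub t Ht) HB) as (q & _ & N1 & N2 & Hx & Hv & Hw).
    destruct (Hder t q Ht Hx) as [Hq Hgd].
    assert (Et : g (xx t) = t) by exact (Hinv t Ht).
    unfold regular_at. rewrite Et. split; [exact N1|]. split; [exact N2|].
    split.
    - eapply is_Cderive_eq; [apply (is_Cderive_comp vv g (xx t)); [rewrite Et; exact Hv|exact Hgd]|].
      field. exact Hq.
    - eapply is_Cderive_eq; [apply (is_Cderive_comp ww g (xx t)); [rewrite Et; exact Hw|exact Hgd]|].
      field. exact Hq. }
  intros z [t [Ht <-]].
  destruct (proj2 Hsol t (Hsub t Ht)) as [HB|(Hv0 & Hw0 & Hv & Hw & Hloc)].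
  - left. exact (Hreg t Ht HB).
  - right.
    destruct (pole_derivatives t (Hsub t Ht) Hv0 Hw0 Hv Hw) as (Dx & [lv Dv] & [lw Dw] & V0 & W0).
    destruct (Hder t (RtoC 1) Ht Dx) as [_ Hgd].
    assert (Et : g (xx t) = t) by exact (Hinv t Ht).
    rewrite Et. split; [exact V0|]. split; [exact W0|]. split; [|split].
    + eexists. apply (is_Cderive_comp vv g (xx t)); [rewrite Et; exact Dv|exact Hgd].
    + eexists. apply (is_Cderive_comp ww g (xx t)); [rewrite Et; exact Dw|exact Hgd].
    + destruct (proj1 (locally_C_disk t _) Hloc) as [d1 Hd1].
      assert (Him : image (disk c e) xx (xx t)) by (exists t; auto).
      (* A point near [xx t] lies in the open image, hence is some [xx s]; the Lipschitz bound for
         [g] at [xx t] puts [s] within [d1] of [t], where the equations of (B) hold. *)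
      destruct (proj1 (locally_C_disk (xx t) _) (Hopen _ Him)) as [d2 Hd2].
      destruct (Cderive_lipschitz g (xx t) _ Hgd) as (d3 & L & D3 & L0 & HL).
      assert (Hpos : (0 < Rmin d2 (Rmin d3 (d1 / (L + 1))))%R).
      { repeat apply Rmin_glb_lt; [apply cond_pos|exact D3|].
        apply Rdiv_lt_0_compat; [apply cond_pos|lra]. }
      apply locally_C_disk. exists (mkposreal _ Hpos). intros z Hz Hne.
      unfold disk in Hz; simpl in Hz.
      assert (Z2 := Rlt_le_trans _ _ _ Hz (Rmin_l _ _)).
      assert (Z3 := Rlt_le_trans _ _ _ (Rlt_le_trans _ _ _ Hz (Rmin_r _ _)) (Rmin_l _ _)).
      assert (Z1 := Rlt_le_trans _ _ _ (Rlt_le_trans _ _ _ Hz (Rmin_r _ _)) (Rmin_r _ _)).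
      destruct (Hd2 z Z2) as [s [Hs Es]]. subst z.
      specialize (HL _ Z3). rewrite Et in HL.
      assert (Es : g (xx s) = s) by exact (Hinv s Hs). rewrite Es in HL.
      apply Hreg; [exact Hs|]. apply Hd1.
      * unfold disk. assert (H0 := Cmod_ge_0 (xx s - xx t)).
        apply Rmult_lt_compat_l with (r := (L + 1)%R) in Z1; [|lra].
        replace ((L + 1) * (d1 / (L + 1)))%R with (pos d1) in Z1 by (field; lra). lra.
      * intros ->. now apply Hne.
Qed.

End Solution.
End OnDelta.

Theorem proposition1 :
  exists (Om : C3 -> Prop) (gamma eta theta : C3 -> C),
    let Gam : C3 -> C3 := fun p => (gamma p, eta p, theta p) in
    (forall t v w : C, Om (t, v, w) -> v <> 0 ->
       eta (t, v, w) <> 0 /\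
       theta (t, v, w) = v ^ 2 * w * / (eta (t, v, w) ^ 2)) /\
    transforms_A_into_B Om Gam /\
    forall x0 : C, exists rho eps : R,
      (1 <= rho)%R /\ (0 < eps < 1 / 4)%R /\
      let Delta : C3 -> Prop := polydisk x0 rho eps in
      (* (i) *)
      ((forall p, Delta p -> Om p) /\
       holomorphic_on Delta Gam /\
       expansion_in_v Delta gamma (fun p => let '(t, v, w) := p in t) 5 /\
       expansion_in_v Delta eta (fun p => let '(t, v, w) := p in v) 4 /\
       expansion_in_v Delta theta (fun p => let '(t, v, w) := p in w) 4) /\
      (* (ii) *)
      (exists Gaminv : C3 -> C3,
         biholomorphic_onto_image Delta Gam Gaminv /\
         exists M : R,
           locally ((x0, RtoC 0, 1 / 4) : C3)
             (fun q : C3 =>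
                image Delta Gam q /\
                (norm (minus (Gaminv q) q)
                   <= M * Cmod (snd (fst q)) ^ 4)%R)) /\
      (* (iii) *)
      (forall (v w : C -> C) (t1 : C) (eps' : R),
         (0 < eps')%R ->
         solution_B (disk t1 eps') v w ->
         (forall t, disk t1 eps' t -> Delta (t, v t, w t)) ->
         exists g : C -> C,
           biholomorphic_onto_image (U := C_NormedModule) (V := C_NormedModule)
             (disk t1 eps') (fun t => gamma (t, v t, w t)) g).
Proof.
  (* The formulas do not involve [x0], so the domain is the union of all the polydisks and nothing
     has to be glued. *)
  exists (fun p => exists x0, Delta x0 p), Fgam, Feta, Ftht.
  split; [|split].
  - intros t v w [x0 Hp] Hv.
    assert (Hw := Delta_w _ _ _ _ Hp).
    destruct (mu_near_1 w Hw) as [_ Hmu]. assert (Ms := mu_sqr w Hw).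
    destruct (Delta_expansions x0) as (Gg & Gh & Gt & gm & _ & _ & _ & _ & E).
    destruct (E t v w Hp) as [Hm _].
    unfold Feta, Ftht, eta, tht; simpl fst; simpl snd. split.
    + apply Cmult_neq_0; [now apply Cmult_neq_0|now apply Cinv_neq_0].
    (* [v ^ 2 w / eta ^ 2] equals [w m ^ 2 / mu ^ 2], which is [m ^ 2 / 4] since [mu ^ 2 = 4 w]. *)
    + replace w with (mu w ^ 2 / 4)%C at 2 by (rewrite Ms; field).
      simpl. field. auto.
  - intros D v w Hsol HD t0 Ht0.
    destruct (HD t0 Ht0) as [x0 Hp].
    (* A solution may cross many polydisks; by continuity a short piece of it lies in a single one,
       which is enough for the local notion of graph. *)
    assert (Hc : exists d : posreal, forall t, disk t0 d t -> D t /\ Delta x0 (t, v t, w t)).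
    { assert (Hex : ex_derive (K := C_AbsRing) (V := C_NormedModule) v t0 /\
        ex_derive (K := C_AbsRing) (V := C_NormedModule) w t0).
      { destruct (proj2 Hsol t0 Ht0) as [(_ & _ & H1 & H2)|(_ & _ & H1 & H2 & _)].
        - split; eexists; [exact H1|exact H2].
        - split; assumption. }
      apply locally_C_disk. apply filter_and; [exact (proj1 Hsol t0 Ht0)|].
      apply (filterdiff_continuous (U := C_NormedModule) (V := C3)
        (fun t => (t, v t, w t))).
      + now apply ex_Cderive_curve.
      + exact (open_Delta x0 _ Hp). }
    destruct Hc as [d Hd].
    assert (Hsol' : solution_B (disk t0 d) v w).
    { split; [apply open_disk|]. intros t Ht. apply Hsol, (Hd t Ht). }
    destruct (xx_biholomorphic x0 v w (disk t0 d) Hsol' (fun t Ht => proj2 (Hd t Ht)) t0 d)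
      as [g Hg]; [auto|].
    exists (disk t0 d), g.
    split; [apply open_disk|]. split; [apply disk_center, cond_pos|].
    split; [intros t Ht; apply (Hd t Ht)|].
    split; [exact Hg|].
    exact (graph_on_disk x0 v w (disk t0 d) Hsol' (fun t Ht => proj2 (Hd t Ht)) t0 d g
      (fun t Ht => Ht) Hg).
  - intros x0. exists (inv_radius x0), (/ inv_radius x0)%R.
    assert (Hr := inv_radius_ge x0). assert (Hr' := r_bounds x0).
    split; [lra|]. split; [lra|].
    intros Dl. change Dl with (Delta x0). clear Dl.
    destruct (Delta_expansions x0) as (Gg & Gh & Gt & gm & Ng & Nh & Nt & _ & E).
    split; [|split].
    + split; [intros p Hp; now exists x0|]. split; [apply Fmap_holomorphic|].
      split; [|split].
      * apply (Delta_norm_expansion x0 _ _ Gg _ 5 Ng). intros t v w Hp.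
        unfold Fgam; simpl fst; simpl snd. destruct (E t v w Hp) as (_ & _ & E1 & _).
        rewrite E1. ring.
      * apply (Delta_norm_expansion x0 _ _ Gh _ 4 Nh). intros t v w Hp.
        unfold Feta; simpl fst; simpl snd. destruct (E t v w Hp) as (_ & _ & _ & E1 & _).
        rewrite E1. ring.
      * apply (Delta_norm_expansion x0 _ _ Gt _ 4 Nt). intros t v w Hp.
        unfold Ftht; simpl fst; simpl snd. destruct (E t v w Hp) as (_ & _ & _ & _ & E1).
        rewrite E1. ring.
    + apply Fmap_biholomorphic.
    + intros v w t1 e He Hsol HD.
      exact (xx_biholomorphic x0 v w (disk t1 e) Hsol HD t1 e (fun t Ht => Ht)).
Qed.
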